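(* Let $J$ be a Jacobi operator with diagonal entries $(\alpha_k)_{k\ge 0}$ and off-diagonal entries $(\beta_k)_{k\ge 0}$, and suppose there exists a positive integer $n$ such that $\alpha_k=0$ and $\beta_{k-1}=\tfrac12$ for all $k\ge n$. Let $C=C_{J\to\Delta}$, let $c$ be the Toeplitz symbol of the Toeplitz part of $C$, let $p_C=\sum_{k=0}^{2n-1}c_{0,k}P_k$, and let $\lambda(z)=\frac12(z+z^{-1})$. Let $z_1,\dots,z_r$ be the roots of $c$ in the open unit disc $\mathbb D\subset\mathbb C$. Then $z_1,\dots,z_r$ are all real and simple, the only possible roots of $c$ on the unit circle are $\pm1$, which can only be simple, and $r\le n$. The spectral measure of $J$ is $$\mu=\frac{1}{p_C}\,\mu_\Delta+\sum_{k=1}^r\frac{(z_k-z_k^{-1})^2}{z_k\,c'(z_k)\,c(z_k^{-1})}\,\delta_{\lambda(z_k)},$$ where $\mathrm d\mu_\Delta(s)=\frac2\pi\sqrt{1-s^2}\,\mathbf 1_{[-1,1]}(s)\,\mathrm ds$ and $\delta_x$ is the Dirac measure at $x$.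
   Context: All matrices are indexed from $0$. A Jacobi operator $J$ is a bounded self-adjoint operator on $\ell^2(\{0,1,2,\dots\})$ given by a symmetric tridiagonal matrix with real diagonal entries $J_{k,k}=\alpha_k$ and off-diagonal entries $J_{k,k+1}=J_{k+1,k}=\beta_k>0$. Its orthonormal polynomials are defined by $P_{-1}=0$, $P_0=1$, $sP_k(s)=\beta_{k-1}P_{k-1}(s)+\alpha_kP_k(s)+\beta_kP_{k+1}(s)$. Its spectral measure is the unique compactly supported probability measure $\mu$ on $\mathbb R$ with $\langle e_0,(J-\lambda)^{-1}e_0\rangle=\int(s-\lambda)^{-1}\,\mathrm d\mu(s)$ for $\lambda\in\mathbb C\setminus\sigma(J)$. The free Jacobi operator $\Delta$ has diagonal entries $0$ and off-diagonal entries $\tfrac12$; its spectral measure is $\mu_\Delta$ and its orthonormal polynomials are the Chebyshev polynomials of the second kind $U_k$. The connection coefficient matrix $C_{J\to\Delta}=(c_{i,j})_{i,j\ge0}$ is the upper triangular matrix defined by $P_k=\sum_{i=0}^k c_{i,k}U_i$. For $J$ as in the claim, it is known that $c_{i,j}=c_{i-1,j-1}$ for all $i,j>0$ with $i+j\ge 2n$ and $c_{0,j}=0$ for $j\ge 2n$. Hence $C=C_{\rm Toe}+C_{\rm fin}$, where $C_{\rm Toe}$ is the upper triangular Toeplitz matrix with $(i,j)$ entry $t_{j-i}$, $t_k$ being the value of $c_{i,i+k}$ for all sufficiently large $i$ (with $t_k=0$ for $k>2n-1$), and $C_{\rm fin}$ has finitely many nonzero entries. The Toeplitz symbol of $C_{\rm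 Toe}$ is the polynomial $c(z)=\sum_{k=0}^{2n-1}t_kz^k$. *)

(* Defs.v *)
From HB Require Import structures.
From mathcomp Require Import all_boot all_order all_algebra.
From mathcomp Require Import complex.
From mathcomp Require Import all_classical all_reals all_analysis.
From mathcomp Require Import measurable_realfun.

Set Implicit Arguments.
Unset Strict Implicit.
Unset Printing Implicit Defensive.

Import Order.TTheory GRing.Theory Num.Theory.
Import numFieldNormedType.Exports.

Local Open Scope classical_set_scope.
Local Open Scope ring_scope.
Local Open Scope complex_scope.

(* Complex sequences; l^2({0,1,2,...}) is the set of those u with l2 u. *)
Section SquareSummable.
Variable R : realType.
Implicit Types (u v : nat -> R[i]) (T : (nat -> R[i]) -> (nat -> R[i])).

Definition sqnorm u : \bar R :=
  (\sum_(0 <= k <oo) (Normc.normc (u k) ^+ 2)%:E)%E.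

Definition l2 u : Prop := (sqnorm u < +oo)%E.

(* Only the values of T on l^2 matter; the estimate implies that T maps l^2
   into itself. *)
Definition bounded_on_l2 T : Prop :=
  (forall (a : R[i]) u v, l2 u -> l2 v ->
     T (fun k => a * u k + v k) = (fun k => a * T u k + T v k)) /\
  (exists M : R, forall u, l2 u -> (sqnorm (T u) <= M%:E * sqnorm u)%E).

Definition e0 : nat -> R[i] := fun k => (k == 0%N)%:R.

End SquareSummable.

Section Jacobi.
Variable R : realType.
Implicit Types alpha beta : nat -> R.

Definition jacobi_op alpha beta (u : nat -> R[i]) : nat -> R[i] := fun k =>
  (if k is j.+1 then (beta j)%:C * u j else 0)
  + (alpha k)%:C * u k + (beta k)%:C * u k.+1.

(* Self-adjointness is automatic: a bounded operator given by a real symmetric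
   matrix is self-adjoint. *)
Definition is_jacobi alpha beta : Prop :=
  (forall k, 0 < beta k) /\ bounded_on_l2 (jacobi_op alpha beta).

(* T = (J - lam)^-1, a bounded two-sided inverse on l^2; some such T exists
   exactly when lam is not in the spectrum of J. *)
Definition is_resolvent alpha beta (lam : R[i])
    (T : (nat -> R[i]) -> (nat -> R[i])) : Prop :=
  bounded_on_l2 T /\
  forall u, l2 u ->
    T (fun k => jacobi_op alpha beta u k - lam * u k) = u /\
    (fun k => jacobi_op alpha beta (T u) k - lam * T u k) = u.

(* The pair (P_{k-1}, P_k), with P_{-1} = 0; the coefficient of P_{-1} is
   irrelevant, so that beta k.-1 can be used at k = 0. *)
Fixpoint orthopoly_pair alpha beta (k : nat) : {poly R} * {poly R} :=
  if k is j.+1 then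
    let: (p, q) := orthopoly_pair alpha beta j in
    (q, (beta j)^-1 *: (('X - (alpha j)%:P) * q - beta j.-1 *: p))
  else (0, 1).

Definition orthopoly alpha beta (k : nat) : {poly R} :=
  (orthopoly_pair alpha beta k).2.

Lemma orthopoly_pair1 alpha beta k :
  (orthopoly_pair alpha beta k.+1).1 = orthopoly alpha beta k.
Proof. by rewrite /orthopoly /=; case: orthopoly_pair. Qed.

Lemma orthopoly_rec0 alpha beta : beta 0%N != 0 ->
  'X * orthopoly alpha beta 0 =
  alpha 0%N *: orthopoly alpha beta 0 + beta 0%N *: orthopoly alpha beta 1.
Proof.
move=> b0; rewrite /orthopoly /= scaler0 subr0 !mulr1 scalerA divff// scale1r.
by rewrite alg_polyC addrC subrK.
Qed.

Lemma orthopoly_recS alpha beta k : beta k.+1 != 0 ->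
  'X * orthopoly alpha beta k.+1 =
  beta k *: orthopoly alpha beta k + alpha k.+1 *: orthopoly alpha beta k.+1
  + beta k.+1 *: orthopoly alpha beta k.+2.
Proof.
move=> bk; rewrite -(orthopoly_pair1 alpha beta k) /orthopoly.
rewrite [orthopoly_pair _ _ k.+2]/=.
rewrite -[let: (_, _) := orthopoly_pair _ _ k in _]/(orthopoly_pair alpha beta k.+1).
case: (orthopoly_pair alpha beta k.+1) => p q /=.
rewrite scalerA divff// scale1r mulrBl mul_polyC.
by rewrite addrC addrA subrK subrK.
Qed.

(* Chebyshev polynomials of the second kind. *)
Definition chebyU : nat -> {poly R} :=
  orthopoly (fun=> 0) (fun=> 2^-1).

(* c is the matrix C_{J -> Delta}; the U_i being a basis, c is unique. *)
Definition is_connection alpha beta (c : nat -> nat -> R) : Prop :=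
  (forall i k, (k < i)%N -> c i k = 0) /\
  (forall k, orthopoly alpha beta k = \sum_(i < k.+1) c i k *: chebyU i).

(* t k is the entry on the k-th superdiagonal of the Toeplitz part of c. *)
Definition is_toeplitz_part (c : nat -> nat -> R) (t : nat -> R) : Prop :=
  forall k, \forall i \near \oo, c i (i + k)%N = t k.

Definition toeplitz_symbol (n : nat) (t : nat -> R) : {poly R} :=
  \poly_(k < n.*2) t k.

Definition pC alpha beta (n : nat) (c : nat -> nat -> R) : {poly R} :=
  \sum_(k < n.*2) c 0%N k *: orthopoly alpha beta k.

End Jacobi.

Section SpectralMeasure.
Variable R : realType.
Implicit Types alpha beta : nat -> R.

Definition cintegrable (mu : probability (measurableTypeR R) R)
    (f : R -> R[i]) : Prop :=
  mu.-integrable setT (fun s => (complex.Re (f s))%:E) /\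
  mu.-integrable setT (fun s => (complex.Im (f s))%:E).

Definition cintegral (mu : probability (measurableTypeR R) R)
    (f : R -> R[i]) : R[i] :=
  (\int[mu]_s complex.Re (f s)) +i* (\int[mu]_s complex.Im (f s)).

Definition cauchy_kernel (lam : R[i]) (s : R) : R[i] := (s%:C - lam)^-1.

(* <e_0, v> is the entry v 0. *)
Definition is_spectral_measure alpha beta
    (mu : probability (measurableTypeR R) R) : Prop :=
  (exists K : set R, compact K /\ mu (~` K) = 0%E) /\
  (forall lam T, is_resolvent alpha beta lam T ->
     cintegrable mu (cauchy_kernel lam) /\
     T (@e0 R) 0%N = cintegral mu (cauchy_kernel lam)).

Definition free_density (s : R) : R :=
  2 / pi * Num.sqrt (1 - s ^+ 2) * \1_(`[-1, 1]%classic) s.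

Definition mu_free : set (measurableTypeR R) -> \bar R := fun A =>
  (\int[lebesgue_measure]_(s in A) (free_density s)%:E)%E.

Lemma free_density_ge0 s : 0 <= free_density s.
Proof. by rewrite !mulr_ge0 ?invr_ge0 ?pi_ge0 ?sqrtr_ge0. Qed.

Lemma measurable_free_density : measurable_fun setT free_density.
Proof.
apply: measurable_funM; last exact: measurable_indic.
apply: measurable_funM => //.
apply: measurableT_comp.
  by apply: continuous_measurable_fun; exact: sqrt_continuous.
by apply: measurable_funB => //; exact: measurable_funX.
Qed.

Let mu_free0 : mu_free set0 = 0%E.
Proof. by rewrite /mu_free integral_set0. Qed.

Let mu_free_ge0 A : (0 <= mu_free A)%E.
Proof. by apply: integral_ge0 => s _; rewrite lee_fin free_density_ge0. Qed.

Let mu_free_sigma_additive : semi_sigma_additive mu_free.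
Proof.
move=> /= F mF tF mUF; rewrite /mu_free ge0_integral_bigcup//=; last 2 first.
- apply/measurable_EFinP/measurable_funTS; exact: measurable_free_density.
- by move=> s _; rewrite lee_fin free_density_ge0.
apply: is_cvg_ereal_nneg_natsum_cond => k _ _; exact: mu_free_ge0.
Qed.

HB.instance Definition _ := isMeasure.Build _ _ _
  mu_free mu_free0 mu_free_ge0 mu_free_sigma_additive.

Definition joukowski (z : R) : R := 2^-1 * (z + z^-1).

Definition eigen_mass (c : {poly R}) (z : R) : R :=
  (z - z^-1) ^+ 2 / (z * c^`().[z] * c.[z^-1]).

End SpectralMeasure.

(* Main.v *)
Require Import Defs.
From HB Require Import structures.
From mathcomp Require Import all_boot all_order all_algebra.
From mathcomp Require Import complex.
From mathcomp Require Import all_classical all_reals all_analysis.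
From mathcomp Require Import measurable_realfun ring lra zify.

Set Implicit Arguments.
Unset Strict Implicit.
Unset Printing Implicit Defensive.

Import Order.TTheory GRing.Theory Num.Theory.
Import numFieldNormedType.Exports.

Local Open Scope classical_set_scope.
Local Open Scope ring_scope.
Local Open Scope complex_scope.

(** The proof rests on the Jost solution. Extend the three-term recurrence of J at lambda(z) by one
    dummy index with coefficient 1/2; the solution F_k(z) = z^k G_k(z) that equals z^k for k >= n
    has polynomial G_k ([jost]). F(z) and F(1/z) solve the same recurrence and their Wronskian can
    be read off where both are pure powers, so P_k(lambda(z)) is an explicit combination of the two
    ([orthopoly_jost]). Expanding it in Chebyshev polynomials for large k shows that the Toeplitz
    symbol c is G_0 ([toeplitz_symbolE]).

    Roots. Green's identity for F(z) and F(w) gives a symmetric form B with (z - w) B(z,w) = G_0(w)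
    z G_1(z) - G_0(z) w G_1(w) ([bezout_form_jost]). It vanishes at pairs of distinct roots of c and
    is positive at (w, conj w) for 0 < |w| <= 1, so roots in the closed disc are real
    ([complex_root_real]). Its diagonal value at a root is a multiple of c', so they are simple
    ([jost_root_deriv]). It is a sum of n squares minus n - 1 squares, so at most n roots lie in the
    open disc ([jost_root_count]).

    Measure. At large real lambda(y) the vector with entries -2 F_{k+1}(y) / c(y) is the resolvent
    applied to e_0 ([stieltjes_jost]); letting lambda tend to infinity gives that P_k has integral 1
    for k = 0 and 0 otherwise ([moment_orthopoly]), whence orthonormality. Then p_C P_k integrates
    to c_{0,k} against mu, which is also the integral of P_k against mu_Delta ([wint_pC]). Moments
    on a bounded interval determine a weighted measure ([moments_determine]), so p_C mu = mu_Delta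
    ([integral_pC]).

    Hence mu is mu_Delta / p_C off the zeros of p_C, and only atoms at these zeros remain. An atom
    at s makes the sum of P_k(s)^2 finite, so P_k(s) tends to 0, which forces s = lambda(y) with
    c(y) = 0 and |y| < 1 ([atom_root]). At such a point the mass is the inverse of that sum, which
    the diagonal of B evaluates ([atom_mass]). *)

(** * The Jost polynomials of an eventually free recurrence *)

Section JostPolynomials.
Variables (K : numFieldType) (a b : nat -> K) (n : nat).

(** Downward recursion from index n: step m carries the polynomials of indices n - m and n - m + 1.
    It is the three-term recurrence solved for its lowest index, after the powers of z are factored
    out. *)
Fixpoint jost_pair (m : nat) : {poly K} * {poly K} :=
  if m is m'.+1 then
    let: (p, q) := jost_pair m' in
    let k := (n - m)%N in
    ((b k)^-1 *: ((2^-1 *: ('X^2 + 1) - a k *: 'X) * p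
                  - b k.+1 *: ('X^2 * q)), p)
  else (1, 1).

(* [z ^+ k * (jost k).[z]] is the solution of the three-term recurrence at
   [(z + z^-1) / 2] that equals [z ^+ k] for [k >= n]. *)
Definition jost (k : nat) : {poly K} := (jost_pair (n - k)).1.

Lemma jost_ge k : (n <= k)%N -> jost k = 1.
Proof. by rewrite /jost -subn_eq0 => /eqP ->. Qed.

Lemma jost_pair2 m : (m <= n)%N -> (jost_pair m).2 = jost (n - m).+1.
Proof.
case: m => [|m] mn; first by rewrite jost_ge// subn0.
rewrite /jost /= (_ : (n - (n - m.+1).+1)%N = m); last lia.
by case: jost_pair.
Qed.

Hypothesis b_neq0 : forall k, b k != 0.
Hypothesis b0E : b 0 = 2^-1.
Hypothesis free_ge : forall k, (n <= k)%N -> a k = 0 /\ b k = 2^-1.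

Lemma jost_rec k : b k *: jost k =
  (2^-1 *: ('X^2 + 1) - a k *: 'X) * jost k.+1 - b k.+1 *: ('X^2 * jost k.+2).
Proof.
have [nk|kn] := leqP n k.
  rewrite !jost_ge ?leqW//.
  have [-> ->] := free_ge nk; have [_ ->] := free_ge (leqW nk).
  by rewrite scale0r subr0 !mulr1 scalerDr addrAC subrr add0r.
have e1 : jost k.+1 = (jost_pair (n - k.+1)).1 by [].
have e2 : jost k.+2 = (jost_pair (n - k.+1)).2.
  by rewrite jost_pair2 ?leq_subr// (_ : (n - (n - k.+1))%N = k.+1)//; lia.
rewrite {1}/jost (_ : (n - k)%N = (n - k.+1).+1) /=; last lia.
rewrite (_ : (n - (n - k.+1).+1)%N = k); last lia.
rewrite e1 e2; case: jost_pair => p q /=.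
by rewrite scalerA divff// scale1r.
Qed.

Lemma horner0_jost_rec k : b k * (jost k).[0] = 2^-1 * (jost k.+1).[0].
Proof.
have := congr1 (horner^~ 0) (jost_rec k).
by rewrite !hornerE !expr0n /= => ->; ring.
Qed.

(** At z = 0 the recurrence collapses to a two-term one with nonzero coefficients, so the value 1 at
    index n propagates down. This excludes the root 0, where lambda(z) makes no sense. *)
Lemma horner0_jost_neq0 k : (jost k).[0] != 0.
Proof.
have [m] := ubnP (n - k); elim: m k => // m IH k km.
have [nk|kn] := leqP n k; first by rewrite jost_ge// hornerE oner_neq0.
have : b k * (jost k).[0] != 0.
  by rewrite horner0_jost_rec mulf_neq0 ?invr_neq0 ?pnatr_eq0// IH//; lia.
by rewrite mulf_eq0 negb_or => /andP[].
Qed.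

Lemma horner0_jost01 : (jost 0).[0] = (jost 1).[0].
Proof.
have := horner0_jost_rec 0; rewrite b0E => /mulfI; apply.
by rewrite invr_neq0 ?pnatr_eq0.
Qed.

(** Each step down raises the degree by at most 2, except the step from n to n - 1, which raises it
    by at most 1 because the two terms in z^2 cancel. Hence the degree bound 2n - 1 for index 0. *)
Lemma size_jost k : (k < n)%N -> (size (jost k) <= (n - k).*2)%N.
Proof.
have [m] := ubnP (n - k); elim: m k => // m IH k km kn.
rewrite -(size_scale _ (b_neq0 k)) jost_rec.
case: (ltnP k.+1 n) => k1n; last first.
  rewrite (jost_ge k1n) (jost_ge (leqW k1n)) !mulr1; have [_ ->] := free_ge k1n.
  have e (A B C : {poly K}) : A + B - C - A = B - C by ring.
  rewrite scalerDr e.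
  rewrite (_ : (n - k)%N = 1%N); last lia.
  rewrite (leq_trans (size_polyD _ _))// geq_max size_polyN.
  rewrite !(leq_trans (size_scale_leq _ _)) ?size_polyX// ?size_poly1//.
have sX2 (p : {poly K}) l : (size p <= l)%N -> (size ('X^2 * p)%R <= l.+2)%N.
  move=> pl; rewrite (leq_trans (size_polyMleq _ _))// size_polyXn/=.
  by rewrite !ltnS.
have s2 : (size (2^-1 *: ('X^2 + 1) - a k *: 'X)%R <= 3)%N.
  rewrite (leq_trans (size_polyD _ _))// geq_max size_polyN.
  rewrite !(leq_trans (size_scale_leq _ _)) ?size_polyX//.
  by rewrite (leq_trans (size_polyD _ _))// geq_max size_polyXn size_poly1.
rewrite (leq_trans (size_polyD _ _))// geq_max size_polyN; apply/andP; split.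
  rewrite (leq_trans (size_polyMleq _ _))//.
  have kS : (n - k)%N = (n - k.+1).+1 by lia.
  have := IH k.+1 ltac:(lia) k1n; rewrite kS doubleS => h.
  by have := leq_add s2 h; case: (_ + _)%N => // l; rewrite add3n.
rewrite (leq_trans (size_scale_leq _ _))//.
rewrite (_ : (n - k).*2 = (n - k).*2.-2.+2); last by rewrite -!addnn; lia.
apply: sX2; case: (ltnP k.+2 n) => k2n.
  have h := IH k.+2 ltac:(lia) k2n; rewrite (leq_trans h)//.
  by rewrite (_ : (n - k)%N = (n - k.+2).+2) ?doubleS//; lia.
by rewrite jost_ge// size_poly1; lia.
Qed.

Lemma size_jost0 : (0 < n)%N -> (size (jost 0) <= n.*2)%N.
Proof. by move=> n0; rewrite (leq_trans (size_jost n0))// subn0. Qed.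

Definition jost_sol (z : K) (k : nat) : K := z ^+ k * (jost k).[z].

Lemma jost_sol0 z : jost_sol z 0 = (jost 0).[z].
Proof. by rewrite /jost_sol mul1r. Qed.

Lemma jost_sol_ge z k : (n <= k)%N -> jost_sol z k = z ^+ k.
Proof. by move=> nk; rewrite /jost_sol jost_ge// hornerE mulr1. Qed.

Lemma jost_sol_rec z k : z != 0 ->
  2^-1 * (z + z^-1) * jost_sol z k.+1 =
  b k * jost_sol z k + a k * jost_sol z k.+1 + b k.+1 * jost_sol z k.+2.
Proof.
move=> z0; rewrite /jost_sol.
have e := congr1 (horner^~ z) (jost_rec k); rewrite !hornerE /= in e.
rewrite [b k * _]mulrCA e !exprS; field.
by rewrite z0.
Qed.

End JostPolynomials.

(** * Wronskians and Green's identity *)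

Section Wronskian.
Variables (K : comRingType) (a b phi psi : nat -> K) (l l' : K).

Definition wronskian k := b k * (phi k * psi k.+1 - psi k * phi k.+1).

Hypothesis phi_rec : forall k,
  l * phi k.+1 = b k * phi k + a k * phi k.+1 + b k.+1 * phi k.+2.
Hypothesis psi_rec : forall k,
  l' * psi k.+1 = b k * psi k + a k * psi k.+1 + b k.+1 * psi k.+2.

(** Green's summation by parts. It is stated over a commutative ring so that it also applies with
    polynomials as solutions and ['X] as spectral parameter, which yields the Christoffel-Darboux
    formula. *)
Lemma wronskian_sum N :
  (l - l') * \sum_(k < N) phi k.+1 * psi k.+1 = wronskian 0 - wronskian N.
Proof.
elim: N => [|N IH]; first by rewrite big_ord0 mulr0 subrr.
rewrite big_ord_recr /= mulrDr {}IH.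
have -> : (l - l') * (phi N.+1 * psi N.+1) =
  (l * phi N.+1) * psi N.+1 - (l' * psi N.+1) * phi N.+1 by ring.
by rewrite phi_rec psi_rec /wronskian; ring.
Qed.

End Wronskian.

Lemma wronskian_const (K : comRingType) (a b phi psi : nat -> K) (l : K) :
  (forall k, l * phi k.+1 = b k * phi k + a k * phi k.+1 + b k.+1 * phi k.+2) ->
  (forall k, l * psi k.+1 = b k * psi k + a k * psi k.+1 + b k.+1 * psi k.+2) ->
  forall N, wronskian b phi psi N = wronskian b phi psi 0.
Proof.
move=> h1 h2 N; have := wronskian_sum h1 h2 N.
by rewrite subrr mul0r => /esym/eqP; rewrite subr_eq0 => /eqP.
Qed.
(* The coefficient of the dummy solution index -1 in the three-term recurrence,
   taken to be the free value. *)
Definition offdiag (R : realType) (beta : nat -> R) (k : nat) : R :=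
  if k is j.+1 then beta j else 2^-1.

(** The Joukowski map is injective on z > 1, since equal images of x and y force x = y or x y = 1;
    so it yields more zeros than the degree allows. *)
Lemma poly_eq0_joukowski (R : realType) (p : {poly R}) :
  (forall z, 1 < z -> p.[joukowski z] = 0) -> p = 0.
Proof.
move=> p0; pose s := [seq joukowski (i.+2%:R : R) | i <- iota 0 (size p)].
apply: (@roots_geq_poly_eq0 _ p s).
- apply/allP => _ /mapP[i _ ->]; apply/eqP/p0.
  by rewrite (ltr_nat _ 1).
- rewrite map_inj_uniq ?iota_uniq// => i j; rewrite /joukowski.
  move/mulfI => /(_ ltac:(by rewrite invr_neq0 ?pnatr_eq0)) e.
  have i0 : 1 < (i.+2%:R : R) by rewrite (ltr_nat _ 1).
  have j0 : 1 < (j.+2%:R : R) by rewrite (ltr_nat _ 1).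
  suff : (i.+2%:R : R) == j.+2%:R by rewrite eqr_nat => /eqP[].
  move: e i0 j0; move: (i.+2%:R : R) (j.+2%:R : R) => x y e x1 y1.
  have x0 : x != 0 by rewrite gt_eqF// (lt_trans _ x1).
  have y0 : y != 0 by rewrite gt_eqF// (lt_trans _ y1).
  have : (x - y) * (x * y - 1) = 0.
    transitivity (x * y * ((x + x^-1) - (y + y^-1))); last first.
      by rewrite e subrr mulr0.
    by field; rewrite x0 y0.
  move/eqP; rewrite mulf_eq0 => /orP[|]; first by rewrite subr_eq0.
  by move=> /eqP; nra.
- by rewrite size_map size_iota.
Qed.

(** * Degrees and linear independence of the orthonormal polynomials *)

Section OrthoPoly.
Variables (R : realType) (alpha beta : nat -> R).
Hypothesis beta_gt0 : forall k, 0 < beta k.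
Local Notation P := (orthopoly alpha beta).

Lemma orthopoly0 : P 0 = 1. Proof. by []. Qed.

Lemma horner_orthopoly_rec0 s :
  s * (P 0).[s] = alpha 0 * (P 0).[s] + beta 0 * (P 1).[s].
Proof.
have := congr1 (horner^~ s) (orthopoly_rec0 alpha (lt0r_neq0 (beta_gt0 0))).
by rewrite hornerM hornerX hornerD !hornerZ.
Qed.

Lemma horner_orthopoly_recS s k :
  s * (P k.+1).[s] =
  beta k * (P k).[s] + alpha k.+1 * (P k.+1).[s] + beta k.+1 * (P k.+2).[s].
Proof.
have := congr1 (horner^~ s) (orthopoly_recS alpha (lt0r_neq0 (beta_gt0 k.+1))).
by rewrite hornerM hornerX !hornerD !hornerZ.
Qed.

Lemma size_orthopoly_aux k :
  [/\ (size (P k) <= k.+1)%N, (P k)`_k != 0,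
      (size (P k.+1) <= k.+2)%N & (P k.+1)`_k.+1 != 0].
Proof.
elim: k => [|k [IH1 IH2 IH3 IH4]].
  have b0 := lt0r_neq0 (beta_gt0 0); have e := orthopoly_rec0 alpha b0.
  have {}e : P 1 = (beta 0)^-1 *: ('X * P 0 - alpha 0 *: P 0).
    by rewrite e addrAC subrr add0r scalerA mulVf// scale1r.
  rewrite e orthopoly0 mulr1 size_poly1 coef1 oner_neq0; split=> //.
    rewrite (leq_trans (size_scale_leq _ _))//.
    rewrite (leq_trans (size_polyD _ _))// geq_max size_polyX size_polyN.
    by rewrite (leq_trans (size_scale_leq _ _))// size_poly1.
  by rewrite coefZ coefB coefX coefZ coef1 /= mulr0 subr0 mulr1 invr_neq0.
split=> //; have b0 := lt0r_neq0 (beta_gt0 k.+1).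
  have e := orthopoly_recS alpha b0.
  have {}e : P k.+2 =
      (beta k.+1)^-1 *: ('X * P k.+1 - (beta k *: P k + alpha k.+1 *: P k.+1)).
    by rewrite e addrAC subrr add0r scalerA mulVf// scale1r.
  have sZ (x : R) (p : {poly R}) m : (size p <= m)%N -> (size (x *: p) <= m)%N.
    by move=> pm; rewrite (leq_trans (size_scale_leq _ _)).
  have sD (p q : {poly R}) m : (size p <= m)%N -> (size q <= m)%N ->
      (size (p + q)%R <= m)%N.
    by move=> pm qm; rewrite (leq_trans (size_polyD _ _))// geq_max pm.
  rewrite e; apply/sZ/sD.
    by rewrite (leq_trans (size_polyMleq _ _))// size_polyX.
  rewrite size_polyN; apply: sD; apply: sZ; last by rewrite (leq_trans IH3).
  by rewrite (leq_trans IH1)// ltnW.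
have /(congr1 (fun p : {poly R} => p`_k.+2)) := orthopoly_recS alpha b0.
rewrite coefXM /= !coefD !coefZ.
rewrite (nth_default _ (leq_trans IH1 _))// (nth_default _ IH3) !mulr0 !add0r.
by move=> e; move: IH4; rewrite e mulf_eq0 negb_or => /andP[].
Qed.

Lemma size_orthopoly k : (size (P k) <= k.+1)%N.
Proof. by have [] := size_orthopoly_aux k. Qed.

Lemma orthopoly_free m (d : nat -> R) :
  \sum_(i < m) d i *: P i = 0 -> forall i, (i < m)%N -> d i = 0.
Proof.
elim: m => // m IH; rewrite big_ord_recr /= => e.
have dm : d m = 0.
  have := congr1 (fun p : {poly R} => p`_m) e.
  rewrite coefD coef0 coefZ coef_sum big1 ?add0r => [|i _]; last first.
    by rewrite coefZ nth_default ?mulr0// (leq_trans (size_orthopoly i)).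
  by have [_ h _ _] := size_orthopoly_aux m => /eqP; rewrite mulf_eq0 (negbTE h) orbF => /eqP.
move: e; rewrite dm scale0r addr0 => /IH h i; rewrite ltnS leq_eqVlt.
by case/predU1P => [->//|]; exact: h.
Qed.

End OrthoPoly.

(** * Orthonormal polynomials in terms of the two Jost solutions *)

Section JostReal.
Variables (R : realType) (alpha beta : nat -> R) (n : nat).
Hypothesis beta_gt0 : forall k, 0 < beta k.
Hypothesis free_ge : forall k, (n <= k)%N -> alpha k = 0 /\ offdiag beta k = 2^-1.
Local Notation P := (orthopoly alpha beta).
Local Notation b := (offdiag beta).
Local Notation G := (jost alpha b n).
Local Notation F := (jost_sol alpha b n).

Lemma offdiag_gt0 k : 0 < b k.
Proof. by case: k => [|k] /=; rewrite ?beta_gt0// invr_gt0. Qed.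

Lemma offdiag_neq0 k : b k != 0.
Proof. exact/lt0r_neq0/offdiag_gt0. Qed.

Lemma jost_solR_rec z k : z != 0 ->
  joukowski z * F z k.+1 =
  b k * F z k + alpha k * F z k.+1 + b k.+1 * F z k.+2.
Proof. by move=> z0; exact: (jost_sol_rec offdiag_neq0 free_ge). Qed.

Lemma joukowskiV (z : R) : joukowski z^-1 = joukowski z.
Proof. by rewrite /joukowski invrK addrC. Qed.

(** The Wronskian of F(z) and F(1/z) does not depend on the index: the left side comes from index 0,
    the right side from index n, where the solutions are z^k and z^-k. *)
Lemma jost_sol_wronskian z : z != 0 ->
  F z 1 * (G 0).[z^-1] - F z^-1 1 * (G 0).[z] = z - z^-1.
Proof.
move=> z0; have zV0 : z^-1 != 0 by rewrite invr_eq0.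
have := wronskian_const (fun k => jost_solR_rec k z0)
  (fun k => _ : joukowski z * F z^-1 k.+1 = _) n.
rewrite -{1}joukowskiV => /(_ (fun k => jost_solR_rec k zV0)).
rewrite /wronskian !(jost_sol_ge _ _ _ (leqnn n)) !(jost_sol_ge _ _ _ (leqnSn n)).
rewrite !jost_sol0 -[b 0]/(2^-1).
have [_ ->] := free_ge (leqnn n).
have A0 : z ^+ n != 0 by rewrite expf_neq0.
rewrite !exprS !exprVn; move: (z ^+ n) A0 => A A0.
rewrite (_ : A * (z^-1 * A^-1) - A^-1 * (z * A) = z^-1 - z); last first.
  by field; rewrite z0.
move/mulfI => /(_ ltac:(by rewrite invr_neq0 ?pnatr_eq0)) e.
by rewrite -(opprB z^-1) e; ring.
Qed.

(** The right side solves the recurrence and, with k + 1 replaced by 0, vanishes like P_{-1}; the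
    Wronskian identity fixes the normalisation at P_0 = 1. *)
Lemma orthopoly_jost z k : z != 0 ->
  (z - z^-1) * (P k).[joukowski z] =
  F z k.+1 * (G 0).[z^-1] - F z^-1 k.+1 * (G 0).[z].
Proof.
move=> z0; have zV0 : z^-1 != 0 by rewrite invr_eq0.
suff : (z - z^-1) * (P k).[joukowski z] =
     F z k.+1 * (G 0).[z^-1] - F z^-1 k.+1 * (G 0).[z] /\
  (z - z^-1) * (P k.+1).[joukowski z] =
     F z k.+2 * (G 0).[z^-1] - F z^-1 k.+2 * (G 0).[z] by case.
elim: k => [|k [IH1 IH2]]; split=> //.
- by rewrite orthopoly0 hornerC mulr1 jost_sol_wronskian.
- apply: (mulfI (lt0r_neq0 (beta_gt0 0))).
  have := horner_orthopoly_rec0 alpha beta_gt0 (joukowski z).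
  rewrite orthopoly0 hornerC !mulr1 => e.
  rewrite mulrCA (_ : beta 0 * _ = joukowski z - alpha 0); last by rewrite [X in _ = X - _]e; ring.
  have := jost_solR_rec 0 z0; have := jost_solR_rec 0 zV0.
  rewrite joukowskiV /= !jost_sol0 => e1 e2.
  rewrite [RHS]mulrBr [beta 0 * (F z _ * _)]mulrA [beta 0 * (F z^-1 _ * _)]mulrA.
  rewrite (_ : beta 0 * F z 2 = (joukowski z - alpha 0) * F z 1 - 2^-1 * (G 0).[z]);
    last by rewrite mulrBl e2; ring.
  rewrite (_ : beta 0 * F z^-1 2 =
    (joukowski z - alpha 0) * F z^-1 1 - 2^-1 * (G 0).[z^-1]);
    last by rewrite mulrBl e1; ring.
  by rewrite -(jost_sol_wronskian z0); ring.
- apply: (mulfI (lt0r_neq0 (beta_gt0 k.+1))).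
  have e := horner_orthopoly_recS alpha beta_gt0 (joukowski z) k.
  have := jost_solR_rec k.+1 z0; have := jost_solR_rec k.+1 zV0.
  rewrite joukowskiV /= => e1 e2.
  rewrite mulrCA (_ : beta k.+1 * _ = (joukowski z - alpha k.+1) * (P k.+1).[joukowski z]
    - beta k * (P k).[joukowski z]); last by rewrite mulrBl e; ring.
  rewrite mulrBr mulrCA IH2 mulrCA IH1.
  rewrite [RHS]mulrBr [beta k.+1 * (F z _ * _)]mulrA [beta k.+1 * (F z^-1 _ * _)]mulrA.
  rewrite (_ : beta k.+1 * F z k.+3 =
    (joukowski z - alpha k.+1) * F z k.+2 - beta k * F z k.+1);
    last by rewrite mulrBl e2; ring.
  rewrite (_ : beta k.+1 * F z^-1 k.+3 =
    (joukowski z - alpha k.+1) * F z^-1 k.+2 - beta k * F z^-1 k.+1);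
    last by rewrite mulrBl e1; ring.
  by ring.
Qed.

End JostReal.

(** * The Toeplitz symbol is the Jost polynomial of index 0 *)

Section Connection.
Variable R : realType.

(** The free operator is the case n = 0, in which all Jost polynomials are 1. *)
Lemma chebyU_joukowski (z : R) k : z != 0 ->
  (z - z^-1) * (chebyU R k).[joukowski z] = z ^+ k.+1 - z ^- k.+1.
Proof.
move=> z0; have b2 (i : nat) : 0 < (2^-1 : R) by rewrite invr_gt0.
have f0 i : (0 <= i)%N -> (0 : R) = 0 /\ offdiag (fun=> (2^-1 : R)) i = 2^-1.
  by case: i.
rewrite /chebyU (orthopoly_jost b2 f0)//.
by rewrite !jost_sol_ge// jost_ge// !hornerE exprVn.
Qed.

Variables (alpha beta : nat -> R) (n : nat) (C : nat -> nat -> R).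
Hypothesis beta_gt0 : forall k, 0 < beta k.
Hypothesis n_gt0 : (0 < n)%N.
Hypothesis free_ge : forall k, (n <= k)%N -> alpha k = 0 /\ offdiag beta k = 2^-1.
Hypothesis C_conn : is_connection alpha beta C.
Local Notation P := (orthopoly alpha beta).
Local Notation G := (jost alpha (offdiag beta) n).

(** For such k the Jost solutions at index k + 1 are pure powers, so (z - 1/z) P_k(lambda(z)) =
    z^(k+1) G_0(1/z) - z^-(k+1) G_0(z). Each coefficient of G_0 then contributes one Chebyshev
    polynomial; the bound on k keeps all their indices nonnegative. *)
Lemma orthopoly_chebyU k : (n.*2 <= k.+1)%N ->
  P k = \sum_(i < k.+1) (G 0)`_(k - i) *: chebyU R i.
Proof.
move=> nk; apply/eqP; rewrite -subr_eq0; apply/eqP/poly_eq0_joukowski => z z1.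
have z0 : z != 0 by rewrite gt_eqF// (lt_trans _ z1).
have zz0 : z - z^-1 != 0.
  rewrite subr_eq0; apply/eqP => e; have := mulfV z0; rewrite -e; nra.
apply: (mulfI zz0); rewrite mulr0 hornerD hornerN mulrBr.
rewrite (orthopoly_jost beta_gt0 free_ge)//.
have sG : (size (G 0) <= k.+1)%N.
  by rewrite (leq_trans _ nk)// (size_jost0 (offdiag_neq0 beta_gt0)).
rewrite !jost_sol_ge ?(horner_coef_wide _ sG); try lia.
rewrite !mulr_sumr horner_sum -sumrB mulr_sumr.
rewrite [X in _ - X](reindex_inj rev_ord_inj) /= -sumrB big1// => i _.
rewrite hornerZ [(z - z^-1) * _]mulrCA chebyU_joukowski// subSS.
have ik := ltn_ord i; have -> : (k - (k - i))%N = i by lia.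
have -> : (k - i).+1 = (k.+1 - i)%N by lia.
rewrite exprB ?unitfE//; last lia.
by rewrite invf_div !exprVn; ring.
Qed.

Lemma connection_jost i k : (n.*2 <= k.+1)%N -> (i <= k)%N ->
  C i k = (G 0)`_(k - i).
Proof.
move=> nk ik; have [_ /(_ k)] := C_conn.
rewrite orthopoly_chebyU// => /eqP; rewrite -subr_eq0 -sumrB => /eqP e.
apply/eqP; rewrite eq_sym -subr_eq0; apply/eqP.
have b2 (l : nat) : 0 < (2^-1 : R) by rewrite invr_gt0.
apply: (@orthopoly_free R (fun=> 0) _ b2 k.+1
  (fun i => (G 0)`_(k - i) - C i k)) => //.
by rewrite -[RHS]e; apply: eq_bigr => j _; rewrite scalerBl.
Qed.

Lemma connection0_eq0 k : (n.*2 <= k)%N -> C 0 k = 0.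
Proof.
move=> nk; rewrite connection_jost ?leqW// subn0 nth_default//.
by rewrite (leq_trans _ nk)// (size_jost0 (offdiag_neq0 beta_gt0)).
Qed.

Lemma toeplitz_symbolE t : is_toeplitz_part C t -> toeplitz_symbol n t = G 0.
Proof.
move=> Ct; apply/polyP => k; rewrite coef_poly; case: ltnP => kn; last first.
  by rewrite nth_default// (leq_trans _ kn)// (size_jost0 (offdiag_neq0 beta_gt0)).
have [N _ /(_ (N + n.*2)%N)] := Ct k.
rewrite /= leq_addr => /(_ isT) <-; rewrite connection_jost ?leq_addr//; last lia.
by congr (_ `_ _); lia.
Qed.

End Connection.

(** * The Bezout form of the Jost polynomials *)

Lemma poly_eq0_horner (R : realType) (p : {poly R}) :
  (forall z, p.[z] = 0) -> p = 0.
Proof. by move=> p0; apply: poly_eq0_joukowski => z _; exact: p0. Qed.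

Section BezoutForm.
Variables (K : numFieldType) (a b : nat -> K) (n : nat).
Local Notation G := (jost a b n).

(* For distinct zeros [z] and [w] of [jost 0] the form vanishes, while it is
   positive for [w] the conjugate of [z] in the unit disc. *)
Definition bezout_form (z w : K) : K :=
  (z * w) ^+ n +
  (1 - z * w) * \sum_(k < n) (z * w) ^+ k * ((G k.+1).[z] * (G k.+1).[w]).

Hypothesis n_gt0 : (0 < n)%N.
Hypothesis b_neq0 : forall k, b k != 0.
Hypothesis b0E : b 0 = 2^-1.
Hypothesis free_ge : forall k, (n <= k)%N -> a k = 0 /\ b k = 2^-1.

Lemma bezout_formC z w : bezout_form z w = bezout_form w z.
Proof.
rewrite /bezout_form [w * z]mulrC; congr (_ + _ * _).
by apply: eq_bigr => k _; rewrite [X in _ * X]mulrC.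
Qed.

(** Green's identity between the indices 0 and n, where lambda(z) - lambda(w) = (z - w)(1 - 1/(zw))
    / 2 supplies the factor z - w. *)
Lemma bezout_form_jost z w : (z - w) * bezout_form z w =
  (G 0).[w] * (z * (G 1).[z]) - (G 0).[z] * (w * (G 1).[w]).
Proof.
(* The Jost recurrence needs a nonzero parameter. At 0 only the first term of the sum survives, and
   it matches because G_0 and G_1 agree at 0. *)
have B0 u : bezout_form 0 u = (G 0).[0] * (G 1).[u].
  rewrite /bezout_form mul0r expr0n gtn_eqF// add0r subr0 mul1r.
  case: n n_gt0 (@horner0_jost01 K a b n b_neq0 b0E free_ge) => // m _ e.
  rewrite big_ord_recl mul1r big1 => [|i _]; last by rewrite expr0n /= mul0r.
  by rewrite addr0 /= e.
have [->|z0] := eqVneq z 0; first by rewrite B0; ring.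
have [->|w0] := eqVneq w 0; first by rewrite bezout_formC B0; ring.
have := wronskian_sum (fun k => jost_sol_rec b_neq0 free_ge k z0)
   (fun k => jost_sol_rec b_neq0 free_ge k w0) n.
rewrite /wronskian !(jost_sol_ge _ _ _ (leqnn n)) !(jost_sol_ge _ _ _ (leqnSn n)).
rewrite !jost_sol0 b0E (proj2 (free_ge (leqnn n))).
set S := (X in _ * X = _) => e.
have SE : S = z * w *
    \sum_(k < n) (z * w) ^+ k * ((G k.+1).[z] * (G k.+1).[w]).
  rewrite /S mulr_sumr; apply: eq_bigr => k _.
  by rewrite /jost_sol !exprS exprMn; ring.
rewrite /bezout_form; move: e; rewrite SE.
set T := (X in z * w * X); rewrite /jost_sol !expr1 !exprS exprMn => e.
apply: (@mulfI _ 2^-1); first by rewrite invr_neq0 ?pnatr_eq0.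
have -> : 2^-1 * ((z - w) * (z ^+ n * w ^+ n + (1 - z * w) * T)) =
    2^-1 * (z ^+ n * w ^+ n * (z - w)) -
    (2^-1 * (z + z^-1) - 2^-1 * (w + w^-1)) * (z * w * T).
  by field; rewrite z0 w0.
by rewrite e; ring.
Qed.

(** Multiplying out 1 - zw, the last subtracted term is (zw)^n because G_n = 1, and it cancels. On
    the diagonal this leaves n positive and n - 1 negative squares, the signature behind the bound
    on the number of roots. *)
Lemma bezout_form_sqr z w : bezout_form z w =
  \sum_(k < n) (z ^+ k * (G k.+1).[z]) * (w ^+ k * (G k.+1).[w]) -
  \sum_(k < n.-1) (z ^+ k.+1 * (G k.+1).[z]) * (w ^+ k.+1 * (G k.+1).[w]).
Proof.
rewrite /bezout_form mulrBl mul1r addrCA; congr (_ + _).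
  by apply: eq_bigr => k _; rewrite exprMn; ring.
rewrite mulr_sumr; case: n n_gt0 (@jost_ge _ a b n) => // m _ jge.
rewrite big_ord_recr /= jge// !hornerC !mulr1 -exprS opprD addrCA subrr addr0.
by congr (- _); apply: eq_bigr => k _; rewrite !exprS exprMn; ring.
Qed.

End BezoutForm.

(** * Reality, simplicity and number of the roots in the disc *)

Section JostRoots.
Variables (R : realType) (alpha beta : nat -> R) (n : nat).
Hypothesis beta_gt0 : forall k, 0 < beta k.
Hypothesis n_gt0 : (0 < n)%N.
Hypothesis free_ge : forall k, (n <= k)%N -> alpha k = 0 /\ offdiag beta k = 2^-1.
Local Notation G := (jost alpha (offdiag beta) n).
Local Notation B := (bezout_form alpha (offdiag beta) n).
Local Notation rc := (real_complex R).
Local Notation b_neq0 := (offdiag_neq0 beta_gt0).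

Lemma jost_complex k : jost (rc \o alpha) (rc \o offdiag beta) n k = map_poly rc (G k).
Proof.
rewrite /jost.
suff [h1 h2] : (jost_pair (rc \o alpha) (rc \o offdiag beta) n (n - k)).1 =
    map_poly rc (jost_pair alpha (offdiag beta) n (n - k)).1 /\
  (jost_pair (rc \o alpha) (rc \o offdiag beta) n (n - k)).2 =
    map_poly rc (jost_pair alpha (offdiag beta) n (n - k)).2 by [].
elim: (n - k)%N => [|m [IH1 IH2]] /=; first by rewrite rmorph1.
move: IH1 IH2; case: jost_pair => p1 q1 /= -> ->.
case: jost_pair => p2 q2 /=; split=> //.
rewrite map_polyZ rmorphB rmorphM rmorphB /= !map_polyZ rmorphM rmorphD /=.
by rewrite map_polyXn map_polyX rmorph1 !fmorphV rmorph_nat.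
Qed.

Lemma bezout_form_gt0 x : x != 0 -> `|x| <= 1 -> 0 < B x x.
Proof.
move=> x0 x1; have xx : 0 < x * x by rewrite -expr2 exprn_even_gt0.
rewrite /bezout_form ltr_pwDl// ?exprn_gt0// mulr_ge0//.
  by rewrite subr_ge0 -expr2 -real_normK ?num_real// expr_le1.
apply: sumr_ge0 => k _; rewrite mulr_ge0 ?exprn_ge0 ?(ltW xx)//.
by rewrite -expr2 sqr_ge0.
Qed.

Lemma jost_root_neq0 x : root (G 0) x -> x != 0.
Proof.
move=> r; apply: contraTneq r => ->.
exact: (horner0_jost_neq0 b_neq0 free_ge).
Qed.

(** The identity for (z - x) B(z,x) is divided by z - x and evaluated at z = x; the quotient of G_0
    by this factor takes the value of the derivative there. *)
Lemma bezout_form_diag_root x : root (G 0) x ->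
  B x x = - ((G 0)^`().[x] * (x * (G 1).[x])).
Proof.
move=> rx; have /factor_theorem[q qE] := rx.
have dq : (G 0)^`().[x] = q.[x].
  by rewrite qE derivM derivXsubC mulr1 !hornerE subrr mulr0 add0r.
(* The polynomial in z equal to B(x,z) plus the quotient term. Its product with ['X - x%:P]
   vanishes, so it is zero and may be evaluated at x itself. *)
pose p : {poly R} := x ^+ n *: 'X^n +
  (1 - x *: 'X) * \sum_(k < n) ((x ^+ k * (G k.+1).[x]) *: ('X^k * G k.+1)) +
  (x * (G 1).[x]) *: q.
have pE z : p.[z] = B x z + q.[z] * (x * (G 1).[x]).
  rewrite /p /bezout_form !hornerD hornerM hornerD hornerN !hornerZ hornerXn.
  rewrite hornerX hornerC horner_sum exprMn [q.[z] * _]mulrC.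
  congr (_ + _ * _ + _); apply: eq_bigr => k _.
  by rewrite hornerZ hornerM hornerXn exprMn; ring.
have p0 : ('X - x%:P) * p = 0.
  apply: poly_eq0_horner => z; rewrite hornerM hornerXsubC pE mulrDr.
  rewrite bezout_formC (bezout_form_jost n_gt0 b_neq0 erefl free_ge).
  by rewrite (eqP rx : (G 0).[x] = 0) qE hornerM hornerXsubC; ring.
have := pE x; move/eqP: p0; rewrite mulf_eq0 polyXsubC_eq0 /= => /eqP ->.
by rewrite horner0 dq => /eqP; rewrite eq_sym addr_eq0 => /eqP.
Qed.

Lemma jost_root_deriv x : root (G 0) x -> `|x| <= 1 -> (G 0)^`().[x] != 0.
Proof.
move=> rx x1; have := bezout_form_gt0 (jost_root_neq0 rx) x1.
rewrite bezout_form_diag_root//; apply: contraTneq => ->.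
by rewrite mul0r oppr0 ltxx.
Qed.

(** If 1/x were a root as well, the Wronskian identity would give x = 1/x, which is impossible for
    |x| < 1. This keeps the denominator of the mass formula nonzero. *)
Lemma jost_root_inv x : root (G 0) x -> `|x| < 1 -> (G 0).[x^-1] != 0.
Proof.
move=> rx x1; have x0 := jost_root_neq0 rx.
have := jost_sol_wronskian beta_gt0 free_ge x0.
rewrite (eqP rx : (G 0).[x] = 0) mulr0 subr0 => e.
apply/eqP => c0; move/eqP: e; rewrite c0 mulr0 eq_sym subr_eq0 => /eqP xV.
have : `|x * x| < 1 by rewrite normrM mulr_ilt1.
by rewrite {2}xV mulfV// normr1 ltxx.
Qed.

(** The coefficients are real, so the conjugate of w is a root too. At this pair the form is
    |w|^(2n) plus a nonnegative term, so the factor w - conj w has to vanish. *)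
Lemma complex_root_real w : root (map_poly rc (G 0)) w -> `|w| <= 1 ->
  exists2 x : R, w = x%:C & root (G 0) x.
Proof.
move=> rw w1.
have bC k : (rc \o offdiag beta) k != 0 by rewrite /= fmorph_eq0 b_neq0.
have b0C : (rc \o offdiag beta) 0 = 2^-1 by rewrite /= fmorphV rmorph_nat.
have fC k : (n <= k)%N -> (rc \o alpha) k = 0 /\ (rc \o offdiag beta) k = 2^-1.
  by move=> /free_ge /= [-> ->]; rewrite fmorphV rmorph_nat.
have conjG (p : {poly R}) u :
    (map_poly rc p).[u^*%C] = ((map_poly rc p).[u])^*%C.
  rewrite -(horner_map (@conjc R)) -map_poly_comp; congr horner.
  by apply: eq_map_poly => x /=; rewrite oppr0.
suff : w \is Num.real.
  case/complex_realP => x wx; exists x => //; move: rw.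
  by rewrite wx fmorph_root.
have rw' : root (map_poly rc (G 0)) w^*%C.
  by rewrite /root conjG (eqP rw) rmorph0.
have w0 : w != 0.
  apply: contraTneq rw => ->; rewrite /root -{1}(rmorph0 rc) horner_map fmorph_eq0.
  exact: (horner0_jost_neq0 b_neq0 free_ge).
have := bezout_form_jost n_gt0 bC b0C fC w w^*%C.
rewrite !jost_complex (eqP rw) (eqP rw') !mul0r subr0 => /eqP.
have ww : 0 < w * w^*%C by rewrite -sqr_normc exprn_gt0// normr_gt0.
rewrite mulf_eq0 => /orP[|]; last first.
  rewrite gt_eqF// /bezout_form ltr_pwDl// ?exprn_gt0// mulr_ge0//.
    by rewrite subr_ge0 -sqr_normc expr_le1.
  apply: sumr_ge0 => k _; rewrite mulr_ge0 ?exprn_ge0 ?(ltW ww)//.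
  by rewrite jost_complex conjG mulcJ_ge0.
rewrite subr_eq0; case: w {rw w1 rw' w0 ww} => u v /=.
by rewrite eq_complex complex_real /= => /andP[_ /eqP]; lra.
Qed.

Lemma mup_jost_root w : root (map_poly rc (G 0)) w -> `|w| <= 1 ->
  mup w (map_poly rc (G 0)) = 1%N.
Proof.
move=> rw w1; have [x wx rx] := complex_root_real rw w1.
have c0 : map_poly rc (G 0) != 0.
  rewrite map_poly_eq0; apply/eqP => G0.
  by have := horner0_jost_neq0 b_neq0 free_ge 0; rewrite G0 horner0 eqxx.
apply/eqP; rewrite eqn_leq mup_leq// -XsubC_dvd// dvdp_XsubCl rw andbT.
apply/negP => /dvdpP[q qE].
have x1 : `|x| <= 1.
  by move: w1; rewrite wx normc_def /= expr0n addr0 sqrtr_sqr lecR.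
have /eqP[] := jost_root_deriv rx x1.
apply: (@complexI R); rewrite -[LHS](horner_map rc) -deriv_map qE.
suff : (q * ('X - w%:P) ^+ 2)^`().[w] = 0 by move=> h; rewrite -[RHS]h; congr horner; rewrite wx.
rewrite derivM deriv_exp derivXsubC !hornerE subrr.
by rewrite expr0n /= !(mulr0, mul0r, mul0rn, add0r, subrr).
Qed.

(** An inertia argument: the matrix of the form at distinct roots is diagonal with positive entries,
    while on vectors annihilated by the n positive squares the form is nonpositive. More than n
    roots would leave a nonzero vector of the latter kind. *)
Lemma jost_root_count (s : seq R) : uniq s ->
  (forall x, x \in s -> root (G 0) x /\ `|x| < 1) -> (size s <= n)%N.
Proof.
move=> us rs; rewrite leqNgt; apply/negP => ns.
pose x (i : 'I_(size s)) := s`_i.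
have xs i : x i \in s by exact: mem_nth.
pose V := \matrix_(i < size s, k < n) (x i ^+ k * (G k.+1).[x i]).
have : kermx V != 0.
  rewrite -mxrank_eq0 mxrank_ker subn_eq0 -ltnNge.
  by rewrite (leq_ltn_trans (rank_leq_col V)).
case/rowV0Pn => v /sub_kermxP vV v0.
(* The kernel vector [v] kills all n positive squares; the second alternative only serves to state
   this for an unbounded index. *)
have vk k : \sum_i v 0 i * (x i ^+ k * (G k.+1).[x i]) = 0 \/ (n <= k)%N.
  case: (ltnP k n) => kn; [left|by right].
  have := congr1 (fun A : 'rV_n => A 0 (Ordinal kn)) vV.
  by rewrite !mxE => e; rewrite -[RHS]e; apply: eq_bigr => i _; rewrite !mxE.
pose Q := \sum_i \sum_j v 0 i * v 0 j * B (x i) (x j).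
have QE : Q = \sum_i v 0 i ^+ 2 * B (x i) (x i).
  apply: eq_bigr => i _; rewrite (bigD1 i)//= big1 ?addr0 ?expr2// => j ji.
  have [ri _] := rs _ (xs i); have [rj _] := rs _ (xs j).
  have := bezout_form_jost n_gt0 b_neq0 erefl free_ge (x i) (x j).
  rewrite (eqP ri : (G 0).[x i] = 0) (eqP rj : (G 0).[x j] = 0) !mul0r subr0.
  move/eqP; rewrite mulf_eq0 subr_eq0 nth_uniq// => /orP[|/eqP->]; last first.
    by rewrite mulr0.
  by rewrite eq_sym => /eqP/val_inj/eqP; rewrite (negbTE ji).
have Qgt0 : 0 < Q.
  rewrite QE; have [i vi] : exists i, v 0 i != 0.
    by apply/existsP; apply: contraNT v0; rewrite negb_exists => /forallP h;
       apply/eqP/rowP => i; rewrite mxE; apply/eqP; have := h i; rewrite negbK.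
  have Bp j : 0 < B (x j) (x j).
    have [rj xj] := rs _ (xs j).
    exact: bezout_form_gt0 (jost_root_neq0 rj) (ltW xj).
  rewrite (bigD1 i)//=; apply: ltr_pwDl.
    by rewrite mulr_gt0 ?exprn_even_gt0.
  by apply: sumr_ge0 => j _; rewrite mulr_ge0 ?sqr_ge0// ltW.
have sumsq m (f : 'I_(size s) -> nat -> R) :
    \sum_i \sum_j v 0 i * v 0 j * \sum_(k < m) f i k * f j k =
    \sum_(k < m) (\sum_i v 0 i * f i k) ^+ 2.
  under eq_bigr => i _ do under eq_bigr => j _ do rewrite mulr_sumr.
  under eq_bigr => i _ do rewrite exchange_big.
  rewrite exchange_big /=; apply: eq_bigr => k _.
  rewrite expr2 mulr_suml; apply: eq_bigr => i _; rewrite mulr_sumr.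
  by apply: eq_bigr => j _; ring.
have : Q <= 0.
  rewrite /Q; under eq_bigr => i _ do under eq_bigr => j _ do
    rewrite bezout_form_sqr// mulrBr.
  under eq_bigr => i _ do rewrite sumrB.
  rewrite sumrB (sumsq n (fun i k => x i ^+ k * (G k.+1).[x i])).
  rewrite (sumsq n.-1 (fun i k => x i ^+ k.+1 * (G k.+1).[x i])) big1 => [|k _].
    by rewrite sub0r oppr_le0 sumr_ge0// => k _; rewrite sqr_ge0.
  have [->|] := vk k; first by rewrite expr0n.
  by rewrite leqNgt ltn_ord.
by rewrite leNgt Qgt0.
Qed.

End JostRoots.

(** * Square-summable real sequences through bounds on partial sums *)

Section SquareBounds.
Variable R : realType.
Implicit Types (u v : nat -> R) (A B : R).

Definition sqbnd u B := forall N, \sum_(k < N) u k ^+ 2 <= B.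

Lemma sqbnd_ge0 u B : sqbnd u B -> 0 <= B.
Proof. by move/(_ 0%N); rewrite big_ord0. Qed.

Lemma le_sqbnd u A B : A <= B -> sqbnd u A -> sqbnd u B.
Proof. by move=> AB uA N; rewrite (le_trans (uA N)). Qed.

Lemma sqbnd_entry u B k : sqbnd u B -> u k ^+ 2 <= B.
Proof.
move/(_ k.+1); rewrite big_ord_recr /=; apply: le_trans.
by rewrite lerDr sumr_ge0// => i _; exact: sqr_ge0.
Qed.

Lemma sqbndM u (d : nat -> R) D B : (forall k, d k ^+ 2 <= D) ->
  sqbnd u B -> sqbnd (fun k => d k * u k) (D * B).
Proof.
move=> dD uB N; have D0 : 0 <= D by rewrite (le_trans _ (dD 0%N)) ?sqr_ge0.
rewrite (@le_trans _ _ (D * \sum_(k < N) u k ^+ 2)) ?ler_wpM2l//.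
by rewrite mulr_sumr; apply: ler_sum => k _; rewrite exprMn ler_wpM2r ?sqr_ge0.
Qed.

Lemma sqbndZ u d B : sqbnd u B -> sqbnd (fun k => d * u k) (d ^+ 2 * B).
Proof. exact: sqbndM. Qed.

Lemma sqbndD u v A B : sqbnd u A -> sqbnd v B ->
  sqbnd (fun k => u k + v k) (2 * A + 2 * B).
Proof.
move=> uA vB N.
rewrite (@le_trans _ _ (\sum_(k < N) (2 * u k ^+ 2 + 2 * v k ^+ 2)))//.
  apply: ler_sum => k _; have := sqr_ge0 (u k - v k); nra.
rewrite big_split /= -!mulr_sumr.
by apply: lerD; apply: ler_wpM2l => //; [exact: uA|exact: vB].
Qed.

Lemma sqbndS u B : sqbnd u B -> sqbnd (fun k => u k.+1) B.
Proof.
move=> uB N; have := uB N.+1; rewrite big_ord_recl; apply: le_trans.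
by rewrite lerDr sqr_ge0.
Qed.

Lemma sqbnd_shift u B : sqbnd u B -> sqbnd (fun k => if k is j.+1 then u j else 0) B.
Proof.
move=> uB [|N]; first by rewrite big_ord0 (sqbnd_ge0 uB).
by rewrite big_ord_recl expr0n /= add0r; exact: uB.
Qed.

Lemma cvg_sumsqr (f : nat -> nat -> R) (l : nat -> R) N :
  (forall k, f ^~ k @ \oo --> l k) ->
  (fun m => \sum_(k < N) f m k ^+ 2) @ \oo --> \sum_(k < N) l k ^+ 2.
Proof.
move=> fl; elim: N => [|N IH].
  by rewrite big_ord0 (_ : (fun=> _) = cst 0) ?cst0; [exact: cvg_cst|
     apply/funext => m; rewrite big_ord0].
rewrite big_ord_recr (_ : (fun=> _) =
    (fun m => \sum_(k < N) f m k ^+ 2 + f m N * f m N)); last first.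
  by apply/funext => m; rewrite big_ord_recr expr2.
by apply: cvgD => //=; rewrite expr2; exact: cvgM.
Qed.

(** A Fatou-type statement: finite partial sums pass to the limit entry by entry, so no convergence
    in norm is needed. *)
Lemma sqbnd_cvg (f : nat -> nat -> R) (l : nat -> R) B :
  (forall k, f ^~ k @ \oo --> l k) -> (forall m, sqbnd (f m) B) -> sqbnd l B.
Proof.
move=> fl fB N; have h := @cvg_sumsqr f l N fl.
rewrite -(cvg_lim _ h)//; apply: limr_le; first by apply/cvg_ex; eexists; exact: h.
by near=> m; exact: fB.
Unshelve. all: by end_near. Qed.

End SquareBounds.

(** * Neumann iteration for the resolvent at large real parameters *)

Section RealJacobi.
Variables (R : realType) (alpha beta : nat -> R) (K : R).
Hypothesis alpha_le : forall k, `|alpha k| <= K.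
Hypothesis beta_le : forall k, `|beta k| <= K.
Implicit Types (u v : nat -> R).

Definition jacobiR u k : R :=
  (if k is j.+1 then beta j * u j else 0) + alpha k * u k + beta k * u k.+1.

Lemma jacobiR_lin a u v k :
  jacobiR (fun k => a * u k + v k) k = a * jacobiR u k + jacobiR v k.
Proof. by case: k => [|k]; rewrite /jacobiR; ring. Qed.

(** Two uses of (a + b)^2 <= 2 a^2 + 2 b^2 give the constant 10; 16 is a convenient larger one that
    turns [lam_large] into a contraction by 1/4 of the squared norm. *)
Lemma sqbnd_jacobiR u B : sqbnd u B -> sqbnd (jacobiR u) (16 * K ^+ 2 * B).
Proof.
move=> uB; have B0 := sqbnd_ge0 uB.
have a2 k : alpha k ^+ 2 <= K ^+ 2.
  by rewrite -[leLHS]real_normK ?num_real// ler_sqr ?nnegrE// (le_trans _ (alpha_le 0)).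
have b2 k : beta k ^+ 2 <= K ^+ 2.
  by rewrite -[leLHS]real_normK ?num_real// ler_sqr ?nnegrE// (le_trans _ (alpha_le 0)).
have := sqbndD (sqbndD (sqbnd_shift (sqbndM b2 uB)) (sqbndM a2 uB))
  (sqbndM b2 (sqbndS uB)).
apply: le_sqbnd; have := mulr_ge0 (sqr_ge0 K) B0; lra.
Qed.

Variables (lam : R).
Hypothesis lam_neq0 : lam != 0.
Hypothesis lam_large : 64 * K ^+ 2 <= lam ^+ 2.

Let q u : nat -> R := fun k => lam^-1 * jacobiR u k.

Lemma sqbnd_neumann u B : sqbnd u B -> sqbnd (q u) (B / 4).
Proof.
move=> uB; have := sqbndZ lam^-1 (sqbnd_jacobiR uB); apply: le_sqbnd.
have B0 := sqbnd_ge0 uB.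
have l2 : 0 < lam ^+ 2 by rewrite exprn_even_gt0.
rewrite exprVn ler_pdivrMl//.
have -> : lam ^+ 2 * (B / 4) = lam ^+ 2 * 4^-1 * B by ring.
by apply: ler_wpM2r => //; rewrite -(ler_pM2r (ltr0n R 4 : 0 < 4)) divfK ?pnatr_eq0// mulrAC -natrM.
Qed.

(** Such a u is fixed by the contraction, so its squared norm is below B / 4^m for every m. *)
Lemma jacobiR_inj u B : sqbnd u B -> (forall k, jacobiR u k - lam * u k = 0) ->
  u = fun=> 0.
Proof.
move=> uB Ju; apply/funext => k.
have qu : q u = u.
  apply/funext => j; have /eqP := Ju j; rewrite subr_eq0 => /eqP e.
  by rewrite /q e mulKf.
have h m : sqbnd u (B * 4^-1 ^+ m).
  elim: m => [|m /sqbnd_neumann]; first by rewrite mulr1.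
  by rewrite qu exprSr mulrA.
have c : (fun m => B * 4^-1 ^+ m) @ \oo --> (0 : R).
  by apply: cvg_geometric; rewrite ger0_norm ?invr_ge0// invf_lt1// ltr1n.
apply/eqP; rewrite -sqrf_eq0 eq_le sqr_ge0 andbT.
rewrite -(cvg_lim _ c)//; apply: limr_ge; first by apply/cvg_ex; eexists; exact: c.
by near=> m; exact: (sqbnd_entry _ (h m)).
Unshelve. all: by end_near. Qed.

(** The equation (J - lambda) v = u is the fixed-point equation v = (J v - u) / lambda, iterated
    here from 0. *)
Let it u m : nat -> R := iter m (fun v k => q v k - lam^-1 * u k) (fun=> 0).

Let itS u m k : it u m.+1 k = q (it u m) k - lam^-1 * u k. Proof. by []. Qed.

Lemma sqbnd_iter_diff u B m : sqbnd u B ->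
  sqbnd (fun k => it u m.+1 k - it u m k) (lam ^- 2 * B * 4^-1 ^+ m).
Proof.
move=> uB; elim: m => [|m /sqbnd_neumann IH].
  rewrite mulr1 (_ : (fun=> _) = (fun k => (- lam^-1) * u k)).
    by rewrite -exprVn -sqrrN; exact: sqbndZ.
  apply/funext => k; rewrite itS /it /= /q /jacobiR.
  by case: k => [|k]; ring.
rewrite [4^-1 ^+ _]exprSr mulrA (_ : (fun=> _) = q (fun k => it u m.+1 k - it u m k))//.
apply/funext => k; set f := it u m.+1; set g := it u m.
rewrite -[LHS]/((q f k - lam^-1 * u k) - (q g k - lam^-1 * u k)).
by rewrite /q /jacobiR; case: k => [|k]; ring.
Qed.

Lemma cvg_iter u B k : sqbnd u B -> cvgn (fun m => it u m k).
Proof.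
move=> uB; pose d := telescope (fun m => it u m k).
suff cd : cvgn (series d).
  rewrite (_ : (fun m => it u m k) = (fun m => it u 0 k + series d m)).
    by apply: is_cvgD => //; exact: is_cvg_cst.
  by apply/funext => m; rewrite -eq_sum_telescope.
apply: normed_cvg.
set D := Num.sqrt (lam ^- 2 * B).
apply: (@series_le_cvg _ _ (geometric D 2^-1)) => [m|m|m|].
- exact: normr_ge0.
- by rewrite mulr_ge0 ?sqrtr_ge0// exprn_ge0// invr_ge0.
- have B0 : 0 <= lam ^- 2 * B by rewrite mulr_ge0 ?(sqbnd_ge0 uB)// invr_ge0 sqr_ge0.
  have D0 : 0 <= D * 2^-1 ^+ m by rewrite mulr_ge0 ?sqrtr_ge0 ?exprn_ge0 ?invr_ge0.
  rewrite -ler_sqr ?nnegrE//= real_normK ?num_real// exprMn sqr_sqrtr//.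
  rewrite -exprM mulnC exprM (_ : 2^-1 ^+ 2 = 4^-1 :> R); last by field.
  exact: (sqbnd_entry k (sqbnd_iter_diff m uB)).
- by apply: is_cvg_geometric_series; rewrite ger0_norm ?invr_ge0// invf_lt1// ltr1n.
Qed.

(** Entrywise convergence suffices, since each entry of J v involves at most three entries of v. The
    bound 4 lambda^-2 B is the fixed point of x |-> 2 (x/4) + 2 lambda^-2 B, the estimate for one
    iteration. *)
Lemma jacobiR_solve u B : sqbnd u B ->
  exists2 v, sqbnd v (4 * lam ^- 2 * B) & forall k, jacobiR v k - lam * v k = u k.
Proof.
move=> uB; have B0 := sqbnd_ge0 uB.
pose v k := limn (fun m => it u m k).
have cv k : (fun m => it u m k) @ \oo --> v k by apply: cvg_iter uB.
exists v.
  apply: (sqbnd_cvg cv) => m; elim: m => [|m IH].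
    move=> N; rewrite big1 ?mulr_ge0 ?invr_ge0 ?sqr_ge0// => i _.
    by rewrite expr0n.
  have := sqbndD (sqbnd_neumann IH) (sqbndZ (- lam^-1) uB).
  rewrite sqrrN exprVn (_ : (fun k => q (it u m) k + - lam^-1 * u k) = it u m.+1).
    by apply: le_sqbnd; lra.
  by apply/funext => k; rewrite itS mulNr.
move=> k; suff e : v k = lam^-1 * jacobiR v k - lam^-1 * u k.
  by rewrite [X in _ * X]e -mulrBr mulVKf// opprB addrC subrK.
have : (fun m => it u m.+1 k) @ \oo --> lam^-1 * jacobiR v k - lam^-1 * u k.
  apply: cvgB; last exact: cvg_cst.
  apply: cvgM; first exact: cvg_cst.
  rewrite /jacobiR; apply: cvgD; [apply: cvgD|]; last first.
  - by apply: cvgM; [exact: cvg_cst|exact: cv].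
  - by apply: cvgM; [exact: cvg_cst|exact: cv].
  - by case: k => [|k]; [exact: cvg_cst|apply: cvgM; [exact: cvg_cst|exact: cv]].
have cvS : (fun m => it u m.+1 k) @ \oo --> v k by rewrite (cvg_shiftS (fun m => it u m k)).
by move=> h; rewrite -(cvg_lim _ h)// -(cvg_lim _ cvS).
Qed.

End RealJacobi.

(** * The complex resolvent, assembled from real and imaginary parts *)

Section Resolvent.
Variables (R : realType) (alpha beta : nat -> R) (K : R).
Hypothesis alpha_le : forall k, `|alpha k| <= K.
Hypothesis beta_le : forall k, `|beta k| <= K.
Implicit Types (u v : nat -> R[i]).
Local Notation J := (jacobi_op alpha beta).
Local Notation JR := (jacobiR alpha beta).
Local Notation re u := (fun k => complex.Re (u k)).
Local Notation im u := (fun k => complex.Im (u k)).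

Lemma sqnorm_leP u (B : R) :
  (sqnorm u <= B%:E)%E <->
  forall N, \sum_(k < N) (complex.Re (u k) ^+ 2 + complex.Im (u k) ^+ 2) <= B.
Proof.
have e k : Normc.normc (u k) ^+ 2 = complex.Re (u k) ^+ 2 + complex.Im (u k) ^+ 2.
  by case: (u k) => a b /=; rewrite sqr_sqrtr// addr_ge0 ?sqr_ge0.
have ge0 k : (0 <= (Normc.normc (u k) ^+ 2)%:E)%E by rewrite lee_fin sqr_ge0.
have sE N : (\sum_(0 <= k < N) (Normc.normc (u k) ^+ 2)%:E =
    (\sum_(k < N) (complex.Re (u k) ^+ 2 + complex.Im (u k) ^+ 2))%:E)%E.
  by rewrite big_mkord -sumEFin; apply: eq_bigr => k _; rewrite e.
split=> [h N|h].
  rewrite -lee_fin -sE (le_trans _ h)//.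
  by apply: nneseries_lim_ge => k _ _; exact: ge0.
apply: lime_le; first by apply: is_cvg_nneseries => k _ _; exact: ge0.
by near=> N; rewrite sE lee_fin.
Unshelve. all: by end_near. Qed.

Lemma sqnorm_sqbnd u (B : R) : (sqnorm u <= B%:E)%E ->
  sqbnd (re u) B /\ sqbnd (im u) B.
Proof.
move=> /sqnorm_leP h; split=> N; rewrite (le_trans _ (h N))//.
  by apply: ler_sum => k _; rewrite lerDl sqr_ge0.
by apply: ler_sum => k _; rewrite lerDr sqr_ge0.
Qed.

Lemma sqbnd_sqnorm u (A B : R) : sqbnd (re u) A -> sqbnd (im u) B ->
  (sqnorm u <= (A + B)%:E)%E.
Proof. by move=> uA uB; apply/sqnorm_leP => N; rewrite big_split lerD. Qed.

Lemma l2_sqbnd u : l2 u ->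
  exists B, [/\ sqnorm u = B%:E, sqbnd (re u) B & sqbnd (im u) B].
Proof.
rewrite /l2; have : (0 <= sqnorm u)%E.
  by apply: nneseries_ge0 => k _ _; rewrite lee_fin sqr_ge0.
case E : (sqnorm u) => [B| |]// _ _; exists B.
by have [] := @sqnorm_sqbnd u B; rewrite ?E.
Qed.

Lemma sqbnd_l2 u A B : sqbnd (re u) A -> sqbnd (im u) B -> l2 u.
Proof. by move=> uA uB; exact: le_lt_trans (sqbnd_sqnorm uA uB) (ltry _). Qed.

Lemma re_jacobi_op u : re (J u) = JR (re u).
Proof.
apply/funext => -[|k]; rewrite /jacobi_op /jacobiR; case: (u _) => ? ? /=;
  [case: (u 1%N)|case: (u k.+1) => ? ?; case: (u k.+2)] => ? ? /=; ring.
Qed.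

Lemma im_jacobi_op u : im (J u) = JR (im u).
Proof.
apply/funext => -[|k]; rewrite /jacobi_op /jacobiR; case: (u _) => ? ? /=;
  [case: (u 1%N)|case: (u k.+1) => ? ?; case: (u k.+2)] => ? ? /=; ring.
Qed.

Lemma jacobi_op_lin (a : R[i]) u v k :
  J (fun k => a * u k + v k) k = a * J u k + J v k.
Proof. by case: k => [|k]; rewrite /jacobi_op; ring. Qed.

Lemma re_lin (a : R[i]) u v : re (fun k => a * u k + v k) =
  fun k => (complex.Re a * complex.Re (u k) + (- complex.Im a) * complex.Im (u k))
           + complex.Re (v k).
Proof.
by apply/funext => k; case: a (u k) (v k) => ? ? [? ?] [? ?] /=; ring.
Qed.

Lemma im_lin (a : R[i]) u v : im (fun k => a * u k + v k) =
  fun k => (complex.Re a * complex.Im (u k) + complex.Im a * complex.Re (u k))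
           + complex.Im (v k).
Proof.
by apply/funext => k; case: a (u k) (v k) => ? ? [? ?] [? ?] /=; ring.
Qed.

Lemma l2_lin (a : R[i]) u v : l2 u -> l2 v -> l2 (fun k => a * u k + v k).
Proof.
move=> /l2_sqbnd[A [_ u1 u2]] /l2_sqbnd[B [_ v1 v2]].
apply: sqbnd_l2; rewrite ?re_lin ?im_lin; apply: sqbndD; try eassumption;
  apply: sqbndD; apply: sqbndZ; eassumption.
Qed.

Lemma l2_jacobi_op u : l2 u -> l2 (J u).
Proof.
move=> /l2_sqbnd[A [_ u1 u2]]; apply: sqbnd_l2.
  by rewrite re_jacobi_op; apply: sqbnd_jacobiR u1.
by rewrite im_jacobi_op; apply: sqbnd_jacobiR u2.
Qed.

Variables (lam : R).
Hypothesis lam_neq0 : lam != 0.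
Hypothesis lam_large : 64 * K ^+ 2 <= lam ^+ 2.
Local Notation S u := (fun k => J u k - lam%:C * u k).

Lemma re_shift u k : complex.Re (S u k) = JR (re u) k - lam * complex.Re (u k).
Proof.
rewrite -re_jacobi_op; case: (J u k) (u k) => ? ? [? ?] /=; ring.
Qed.

Lemma im_shift u k : complex.Im (S u k) = JR (im u) k - lam * complex.Im (u k).
Proof.
rewrite -im_jacobi_op; case: (J u k) (u k) => ? ? [? ?] /=; ring.
Qed.

Lemma shift_inj u v : l2 u -> l2 v -> S u = S v -> u = v.
Proof.
move=> lu lv e; pose w := fun k => (-1) * v k + u k.
have /l2_sqbnd[B [_ w1 w2]] : l2 w by exact: l2_lin.
have Sw k : S w k = 0.
  have /(congr1 (fun f => f k)) /= ek := e.
  rewrite /w jacobi_op_lin; apply/eqP; rewrite -subr_eq0.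
  by apply/eqP; transitivity (S u k - S v k); [ring|rewrite ek subrr].
have r0 : re w = fun=> 0.
  apply: (jacobiR_inj alpha_le beta_le lam_neq0 lam_large w1) => k.
  by rewrite -re_shift Sw.
have i0 : im w = fun=> 0.
  apply: (jacobiR_inj alpha_le beta_le lam_neq0 lam_large w2) => k.
  by rewrite -im_shift Sw.
apply/funext => k; apply/eqP; rewrite -subr_eq0; apply/eqP.
have -> : u k - v k = w k by rewrite /w; ring.
have := congr1 (fun f => f k) r0; have := congr1 (fun f => f k) i0.
by case: (w k) => ? ? /= -> ->.
Qed.

Lemma shift_solve u : l2 u -> exists v,
  S v = u /\ (sqnorm v <= (8 * lam ^- 2)%:E * sqnorm u)%E.
Proof.
move=> /l2_sqbnd[B [-> u1 u2]].
have [v1 v1B v1E] := jacobiR_solve alpha_le beta_le lam_neq0 lam_large u1.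
have [v2 v2B v2E] := jacobiR_solve alpha_le beta_le lam_neq0 lam_large u2.
exists (fun k => v1 k +i* v2 k); split.
  apply/funext => k; have := v1E k; have := v2E k.
  set v := (fun k => v1 k +i* v2 k).
  rewrite -[jacobiR _ _ v1 k - _](re_shift v) -[jacobiR _ _ v2 k - _](im_shift v).
  by case: (S v k) (u k) => ? ? [? ?] /= -> ->.
rewrite -EFinM (le_trans (@sqbnd_sqnorm (fun k => v1 k +i* v2 k) _ _ v1B v2B))// lee_fin; lra.
Qed.

(** The definition of the spectral measure speaks only about points where a resolvent exists; this
    provides enough of them, namely all large real ones. *)
Lemma resolvent_exists : exists T, is_resolvent alpha beta lam%:C T.
Proof.
have /choice[T TE] : forall u, exists v, l2 u ->
    S v = u /\ (sqnorm v <= (8 * lam ^- 2)%:E * sqnorm u)%E.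
  move=> u; have [/shift_solve[v vE]|nu] := pselect (l2 u).
    by exists v.
  by exists (fun=> 0).
have Tl2 u : l2 u -> l2 (T u).
  move=> lu; have [_ h] := TE u lu; have [B [uB _ _]] := l2_sqbnd lu.
  by rewrite /l2 (le_lt_trans h)// uB -EFinM ltry.
have l2S u : l2 u -> l2 (S u).
  move=> lu; rewrite (_ : S u = fun k => (- lam%:C) * u k + J u k).
    by apply: l2_lin => //; exact: l2_jacobi_op.
  by apply/funext => k; rewrite mulNr addrC.
exists T; split; last first.
  move=> u lu; split; last by have [] := TE u lu.
  apply: shift_inj => //; first exact/Tl2/l2S.
  by have [] := TE _ (l2S u lu).
split; last by exists (8 * lam ^- 2) => u lu; have [] := TE u lu.
move=> a u v lu lv; apply: shift_inj.
- exact/Tl2/l2_lin.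
- by apply: l2_lin; exact: Tl2.
have [-> _] := TE _ (l2_lin a lu lv).
have [eu _] := TE u lu; have [ev _] := TE v lv.
apply/funext => k; rewrite jacobi_op_lin -[X in a * X + _](congr1 (fun f => f k) eu).
by rewrite -[X in _ + X = _](congr1 (fun f => f k) ev) /=; ring.
Qed.

End Resolvent.

(** * Integrals of polynomials against a bounded weight *)

Section WeightedIntegrals.
Variable R : realType.
Local Notation TR := (measurableTypeR R).

Lemma horner_bounded (p : {poly R}) (L : R) :
  exists2 M, 0 <= M & forall x, `|x| <= L -> `|p.[x]| <= M.
Proof.
exists (\sum_(i < size p) `|p`_i| * `|L| ^+ i) => [|x xL].
  by apply: sumr_ge0 => i _; rewrite mulr_ge0 ?exprn_ge0.
rewrite horner_coef (le_trans (ler_norm_sum _ _ _))//; apply: ler_sum => i _.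
by rewrite normrM normrX ler_wpM2l// lerXn2r ?nnegrE// (le_trans xL) ?ler_norm.
Qed.

Lemma measurable_horner (p : {poly R}) (D : set TR) : measurable_fun D (horner p : TR -> TR).
Proof.
apply: measurable_funTS; apply: continuous_measurable_fun; exact: continuous_horner.
Qed.

Lemma measurable_invr : measurable_fun setT (fun x : TR => x^-1 : TR).
Proof.
rewrite -(setUv [set (0 : R)]); apply/measurable_funU => //.
- exact: measurableC.
- split; first exact: measurable_fun_set1.
  apply: open_continuous_measurable_fun.
    by rewrite openC; exact/accessible_closed_set1/hausdorff_accessible/Rhausdorff.
  by move=> x; rewrite inE /= => /eqP x0; apply: inv_continuous.
Qed.

Lemma norm_itv (L x : R) : (x \in `[- L, L]) = (`|x| <= L).
Proof. by rewrite in_itv /= ler_norml. Qed.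

Variable mu : {measure set TR -> \bar R}.
Variable L : R.
Local Notation D := (`[- L, L]%classic : set TR).
Hypothesis muD : (mu D < +oo)%E.

Lemma bounded_integrable (f : R -> R) M : measurable_fun D (f : TR -> TR) ->
  (forall x, `|x| <= L -> `|f x| <= M) -> mu.-integrable D (EFin \o f).
Proof.
move=> mf fM; apply: measurable_bounded_integrable => //.
exists M; split; first exact: num_real.
move=> N MN x /=; rewrite norm_itv => xL.
by rewrite (le_trans (fM x xL))// ltW.
Qed.

(** A linear functional of the polynomial. The weight 1 gives moments, the Cauchy kernel gives
    Stieltjes transforms, and p_C and the semicircle density give the two sides of the final
    comparison. *)
Definition wint (w : R -> R) (p : {poly R}) : R :=
  \int[mu]_(s in D) (p.[s] * w s).

Variable w : R -> R.
Hypothesis mw : measurable_fun D (w : TR -> TR).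
Hypothesis w_bounded : exists M, forall x, `|x| <= L -> `|w x| <= M.

Lemma wint_integrable p : mu.-integrable D (EFin \o (fun s => p.[s] * w s)).
Proof.
have [Mp Mp0 pM] := horner_bounded p L; have [M wM] := w_bounded.
apply: (@bounded_integrable _ (Mp * M)) => [|x xL].
  by apply: measurable_funM => //; exact: measurable_horner.
by rewrite normrM ler_pM ?pM ?wM.
Qed.

Lemma wint_lin a p q : wint w (a *: p + q) = a * wint w p + wint w q.
Proof.
have mD : measurable D by exact: measurable_itv.
rewrite /wint -RintegralZl -?RintegralD//; first 1 last.
- rewrite (_ : EFin \o _ = EFin \o (fun s => (a *: p).[s] * w s)).
    exact: wint_integrable.
  by apply/funext => s /=; rewrite hornerZ mulrA.
- exact: wint_integrable.
- exact: wint_integrable.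
by apply: eq_Rintegral => s _; rewrite hornerD hornerZ mulrDl mulrA.
Qed.

Lemma wint0 : wint w 0 = 0.
Proof.
by have := wint_lin (-1) 0 0; rewrite scaler0 addr0 mulN1r addNr.
Qed.

Lemma wintD p q : wint w (p + q) = wint w p + wint w q.
Proof. by rewrite -{1}(scale1r p) wint_lin mul1r. Qed.

Lemma wintZ a p : wint w (a *: p) = a * wint w p.
Proof. by rewrite -[a *: p]addr0 wint_lin wint0 addr0. Qed.

Lemma wint_sum m (f : nat -> {poly R}) :
  wint w (\sum_(k < m) f k) = \sum_(k < m) wint w (f k).
Proof.
by elim: m => [|m IH]; rewrite ?big_ord0 ?wint0// !big_ord_recr wintD IH.
Qed.

Lemma norm_wint_le p M : (forall x, `|x| <= L -> `|p.[x] * w x| <= M) ->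
  `|wint w p| <= M * fine (mu D).
Proof.
have mD : measurable D by exact: measurable_itv.
move=> pM; rewrite (le_trans (le_normr_Rintegral _ _))//.
  exact: wint_integrable.
rewrite -Rintegral_cst//; apply: le_Rintegral => //.
- exact/integrable_norm/wint_integrable.
- have [M1 wM1] := w_bounded; apply: (@bounded_integrable _ `|M|) => // x _.
- by move=> x /=; rewrite norm_itv => xL; exact: pM.
Qed.

End WeightedIntegrals.

(** * Orthonormality from the integrals of the polynomials alone *)

Section Orthonormality.
Variables (R : realType) (alpha beta : nat -> R).
Hypothesis beta_gt0 : forall k, 0 < beta k.
Local Notation P := (orthopoly alpha beta).
Local Notation Q k := (orthopoly_pair alpha beta k).1.
Local Notation b := (offdiag beta).

Lemma orthopoly_shift_rec k :
  'X * Q k.+1 = b k *: Q k + alpha k *: Q k.+1 + b k.+1 *: Q k.+2.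
Proof.
rewrite !orthopoly_pair1; case: k => [|k].
  by rewrite scaler0 add0r; apply: orthopoly_rec0; rewrite gt_eqF.
by rewrite orthopoly_pair1; apply: orthopoly_recS; rewrite gt_eqF.
Qed.

Lemma orthopoly_span (V : {poly R} -> Prop) :
  (forall a p q, V p -> V q -> V (a *: p + q)) -> (forall k, V (P k)) ->
  forall p, V p.
Proof.
move=> Vlin VP p.
have V0 : V 0 by rewrite -(subrr (P 0)) addrC -scaleN1r; exact: Vlin.
have [m] := ubnP (size p); elim: m p => // m IH p; rewrite ltnS => pm.
have [_ Pm _ _] := size_orthopoly_aux alpha beta_gt0 m.
case: m => [|m] in IH pm Pm *.
  by move: pm; rewrite leqn0 size_poly_eq0 => /eqP ->.
have {Pm} [_ Pm _ _] := size_orthopoly_aux alpha beta_gt0 m.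
pose a := p`_m / (P m)`_m.
rewrite -(subrK (a *: P m) p) addrC; apply: Vlin => //; apply: IH.
rewrite ltnS; apply/leq_sizeP => j; rewrite leq_eqVlt => /predU1P[<-|mj].
  by rewrite coefB coefZ /a divfK// subrr.
rewrite coefB coefZ (nth_default _ (leq_trans pm mj)) nth_default.
  by rewrite mulr0 subrr.
by rewrite (leq_trans (size_orthopoly alpha beta_gt0 m)).
Qed.

Variable L : {poly R} -> R.
Hypothesis L_lin : forall a p q, L (a *: p + q) = a * L p + L q.
Hypothesis LP : forall k, L (P k) = (k == 0%N)%:R.

Let L0 : L 0 = 0.
Proof. by have := L_lin (-1) 0 0; rewrite scaler0 addr0 mulN1r addNr. Qed.

Let LZ a p : L (a *: p) = a * L p.
Proof. by rewrite -[a *: p]addr0 L_lin L0 addr0. Qed.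

Let LD p q : L (p + q) = L p + L q.
Proof. by rewrite -{1}(scale1r p) L_lin mul1r. Qed.

(** By induction on j: the recurrence for the first factor introduces ['X], which is moved to the
    second factor and expanded again. This is the symmetry of J, and it reduces everything to
    [LP]. *)
Lemma orthopoly_orthonormal j k : L (P j * P k) = (j == k)%:R.
Proof.
rewrite -[P j]orthopoly_pair1 -[P k]orthopoly_pair1 -eqSS.
suff : forall k, L (Q j * Q k.+1) = (j == k.+1)%:R /\
                 L (Q j.+1 * Q k.+1) = (j.+1 == k.+1)%:R by move=> /(_ k)[].
elim: j {k} => [|j IH] k.
  rewrite mul0r L0 -[Q 1]/(1 : {poly R}) mul1r orthopoly_pair1 LP.
  by split=> //; rewrite eqSS eq_sym.
split; first by have [] := IH k.
have b0 : b j.+1 != 0 by exact: offdiag_neq0.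
apply: (mulfI b0); rewrite -LZ scalerAl.
have -> : b j.+1 *: Q j.+2 = 'X * Q j.+1 - (b j *: Q j + alpha j *: Q j.+1).
  by rewrite orthopoly_shift_rec addrAC subrr add0r.
rewrite mulrBl -mulrA [Q j.+1 * Q k.+1]mulrC mulrA orthopoly_shift_rec.
rewrite !mulrDl -!scalerAl.
rewrite LD -scaleN1r !LZ !LD !LZ ![_ * Q j.+1]mulrC.
have Qk : L (Q j.+1 * Q k) = (j.+1 == k)%:R.
  by case: k => [|k]; [rewrite mulr0 L0|have [] := IH k].
have [-> ->] := IH k; have [_ ->] := IH k.+1; rewrite Qk !eqSS.
have [->|jk] := eqVneq j k.
  rewrite !(gtn_eqF (ltnSn _)) !(ltn_eqF (ltnSn _)).
  by ring.
have [->|jk1] := eqVneq j k.+1.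
  have -> : (k.+2 == k)%N = false by apply/negbTE/eqP; lia.
  by rewrite ?eqxx /=; ring.
by have [<-|_] := eqVneq j.+1 k => /=; ring.
Qed.

End Orthonormality.

(** * Moments of the spectral measure from the explicit resolvent *)

Lemma bounded_eventually_cst (R : realType) (f : nat -> R) n c :
  (forall k, (n <= k)%N -> f k = c) -> exists K, forall k, `|f k| <= K.
Proof.
move=> fc; exists (\sum_(k < n) `|f k| + `|c|) => k.
have [/fc ->|kn] := leqP n k; first by rewrite lerDr sumr_ge0.
rewrite (bigD1 (Ordinal kn))//= -addrA lerDl addr_ge0// sumr_ge0//.
Qed.

Lemma sqbnd_geometric (R : realType) (y : R) : `|y| < 1 ->
  sqbnd (fun k => y ^+ k.+1) (1 - y ^+ 2)^-1.
Proof.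
move=> y1 N; have q1 : y ^+ 2 < 1.
  by rewrite -real_normK ?num_real// expr_lt1.
have d0 : 0 < 1 - y ^+ 2 by rewrite subr_gt0.
rewrite -[leRHS]mul1r ler_pdivlMr//.
have -> : (\sum_(k < N) (y ^+ k.+1) ^+ 2) * (1 - y ^+ 2) = y ^+ 2 - (y ^+ N.+1) ^+ 2.
  elim: N => [|N IH]; first by rewrite big_ord0 mul0r expr1 subrr.
  by rewrite big_ord_recr mulrDl IH /= !exprS; ring.
by have := sqr_ge0 (y ^+ N.+1); lra.
Qed.

Lemma le0_of_le_linear (R : realType) (a M y0 : R) : 0 < y0 ->
  (forall y, 0 < y -> y < y0 -> a <= M * y) -> a <= 0.
Proof.
move=> y00 h; rewrite leNgt; apply/negP => a0.
have M1 : 0 < `|M| + 1 by rewrite ltr_pwDr.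
pose y := Num.min (y0 / 2) (a / 2 / (`|M| + 1)).
have y_gt0 : 0 < y by rewrite lt_min !divr_gt0.
have yy0 : y < y0 by rewrite gt_min ltr_pdivrMr// mulr_natr mulr2n ltrDl y00.
have := h y y_gt0 yy0; apply/negP; rewrite -ltNge.
have : y * (`|M| + 1) <= a / 2 by rewrite -ler_pdivlMr// ge_min lexx orbT.
have := ler_norm M; nra.
Qed.

Lemma horner0_eq0_of_linear (R : realType) (q : {poly R}) (M y0 : R) : 0 < y0 ->
  (forall y, 0 < y -> y < y0 -> `|q.[y]| <= M * y) -> q.[0] = 0.
Proof.
move=> y00 h; apply/eqP; rewrite -normr_eq0 eq_le normr_ge0 andbT.
have : root (q - q.[0]%:P) 0 by rewrite /root !hornerE subrr.
case/factor_theorem => r rE; have [Mr Mr0 rM] := horner_bounded r y0.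
apply: (@le0_of_le_linear _ _ (M + Mr) y0) => // y y1 y2.
have -> : q.[0] = q.[y] - r.[y] * y.
  have := congr1 (horner^~ y) rE; rewrite hornerD hornerN hornerC hornerM.
  by rewrite hornerXsubC subr0 => <-; ring.
rewrite (le_trans (ler_normB _ _))// mulrDl lerD ?h//.
by rewrite normrM (gtr0_norm y1) ler_wpM2r ?(ltW y1)// rM// gtr0_norm// ltW.
Qed.

Section Moments.
Variables (R : realType) (alpha beta : nat -> R) (n : nat).
Local Notation TR := (measurableTypeR R).
Hypothesis beta_gt0 : forall k, 0 < beta k.
Hypothesis n_gt0 : (0 < n)%N.
Hypothesis free_ge : forall k, (n <= k)%N -> alpha k = 0 /\ offdiag beta k = 2^-1.
Local Notation P := (orthopoly alpha beta).
Local Notation G := (jost alpha (offdiag beta) n).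
Local Notation F := (jost_sol alpha (offdiag beta) n).
Local Notation b_neq0 := (offdiag_neq0 beta_gt0).

Lemma coefficients_bounded : exists2 K, 0 <= K &
  forall k, `|alpha k| <= K /\ `|beta k| <= K.
Proof.
have [K1 h1] := @bounded_eventually_cst _ alpha n 0 (fun k nk => proj1 (free_ge nk)).
have [K2 h2] := @bounded_eventually_cst _ beta n 2^-1
  (fun k nk => proj2 (free_ge (leqW nk))).
have K10 : 0 <= K1 by rewrite (le_trans _ (h1 0%N)).
have K20 : 0 <= K2 by rewrite (le_trans _ (h2 0%N)).
exists (K1 + K2) => [|k]; first exact: addr_ge0.
by have := h1 k; have := h2 k; split; lra.
Qed.

Lemma sqbnd_jost_sol y : `|y| < 1 -> exists B, sqbnd (fun k => F y k.+1) B.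
Proof.
move=> y1.
have G1 k : (n <= k)%N -> (G k).[y] = 1 by move=> nk; rewrite jost_ge// hornerC.
have [D hD] := bounded_eventually_cst G1.
have {}hD k : (G k.+1).[y] ^+ 2 <= D ^+ 2.
  rewrite -[leLHS]real_normK ?num_real// ler_sqr ?nnegrE// (le_trans _ (hD 0%N))//.
exists (D ^+ 2 * (1 - y ^+ 2)^-1).
have := sqbndM hD (sqbnd_geometric y1); congr (sqbnd _ _).
by apply/funext => k; rewrite /jost_sol mulrC.
Qed.

Variables (mu : probability TR R) (L : R).
Hypothesis L_gt0 : 0 < L.
Local Notation D := (`[- L, L]%classic : set TR).
Hypothesis mu_supp : mu (~` D) = 0%E.
Hypothesis mu_res : forall lam T, is_resolvent alpha beta lam T ->
  cintegrable mu (cauchy_kernel lam) /\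
  T (@e0 R) 0%N = cintegral mu (cauchy_kernel lam).
Variable K : R.
Hypothesis K_ge0 : 0 <= K.
Hypothesis K_bound : forall k, `|alpha k| <= K /\ `|beta k| <= K.

Let alpha_le k : `|alpha k| <= K. Proof. by have [] := K_bound k. Qed.
Let beta_le k : `|beta k| <= K. Proof. by have [] := K_bound k. Qed.

Lemma measurable_D : measurable D. Proof. exact: measurable_itv. Qed.

Lemma mu_D_lty : (mu D < +oo)%E.
Proof. by rewrite (le_lt_trans (probability_le1 mu _)) ?ltry//; exact: measurable_D. Qed.

Lemma integral_restrict_support (f : R -> R) : mu.-integrable setT (EFin \o f) ->
  \int[mu]_s f s = \int[mu]_(s in D) f s.
Proof.
move=> fi; rewrite /Rintegral; congr fine.
rewrite (@negligible_integral _ _ _ mu setT (~` D))//.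
- by rewrite setTD setCK.
- by apply: measurableC; exact: measurable_D.
Qed.

Lemma mu_D1 : mu D = 1%E.
Proof.
rewrite -[D]setCK probability_setC; last by apply: measurableC; exact: measurable_D.
by rewrite mu_supp sube0.
Qed.

Section OneParameter.
Variable y : R.
Hypothesis y_neq0 : y != 0.
Hypothesis y_lt1 : `|y| < 1.
Local Notation lam := (joukowski y).
Hypothesis lam_neq0 : lam != 0.
Hypothesis lam_large : 64 * K ^+ 2 <= lam ^+ 2.

(** The first row of J lacks the dummy entry F_0 of the extended recurrence, so the eigenvalue
    equation fails there only, by F_0 / 2. *)
Lemma jacobiR_jost_sol k : jacobiR alpha beta (fun k => F y k.+1) k =
  lam * F y k.+1 - (k == 0%N)%:R * (2^-1 * (G 0).[y]).
Proof.
have := jost_solR_rec beta_gt0 free_ge k y_neq0; rewrite /jacobiR => ->.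
by case: k => [|k] /=; rewrite ?jost_sol0; ring.
Qed.

(** Otherwise the Jost solution would be a nonzero square-summable eigenvector at a point where J -
    lambda is injective. *)
Lemma jost_neq0 : (G 0).[y] != 0.
Proof.
apply/eqP => c0; have [B FB] := sqbnd_jost_sol y_lt1.
have : (fun k => F y k.+1) = fun=> 0.
  apply: (jacobiR_inj alpha_le beta_le lam_neq0 lam_large FB) => k.
  by rewrite jacobiR_jost_sol c0; ring.
move/(congr1 (fun f => f n)) => /eqP; rewrite jost_sol_ge ?leqnSn//.
by rewrite expf_eq0 (negbTE y_neq0) andbF.
Qed.

Lemma stieltjes_jost :
  wint mu L (fun s => (s - lam)^-1) 1 = - 2 * F y 1 / (G 0).[y].
Proof.
have c0 := jost_neq0.
have [T HT] := resolvent_exists alpha_le beta_le lam_neq0 lam_large.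
(* This factor turns the defect -G_0(y)/2 in the first row into 1, so (J - lambda) v = e_0; the
   left-inverse property of [T] then identifies [T e_0] with v. *)
pose a := - 2 / (G 0).[y]; pose v k : R[i] := (a * F y k.+1)%:C.
have lv : l2 v.
  have [B FB] := sqbnd_jost_sol y_lt1.
  apply: (@sqbnd_l2 _ v _ 0); first exact: (sqbndZ a FB).
  by move=> N; rewrite big1// => i _; rewrite expr0n.
have Sv : (fun k => jacobi_op alpha beta v k - lam%:C * v k) = @e0 R.
  apply/funext => k.
  transitivity ((a * (jacobiR alpha beta (fun k => F y k.+1) k - lam * F y k.+1))%:C).
    rewrite /jacobi_op /jacobiR /v.
    by case: k => [|k]; rewrite !(rmorphM, rmorphB, rmorphD, rmorph0) /=; ring.
  rewrite jacobiR_jost_sol /e0 /a; case: (k == 0%N) => /=.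
    by rewrite -[RHS](rmorph1 (real_complex R)); congr (_%:C); field.
  by rewrite -[RHS](rmorph0 (real_complex R)); congr (_%:C); ring.
have [_ /(_ v lv)[Tv _]] := HT; rewrite Sv in Tv.
have kE s : cauchy_kernel lam%:C s = ((s - lam)^-1)%:C.
  by rewrite /cauchy_kernel -rmorphB -fmorphV.
have [[i1 _] eT] := mu_res HT; rewrite Tv in eT.
have e : a * F y 1 = \int[mu]_s complex.Re (cauchy_kernel lam%:C s) :=
  congr1 (@complex.Re R) eT.
rewrite mulrAC -/a e integral_restrict_support//.
by apply: eq_Rintegral => s _; rewrite hornerC mul1r kE.
Qed.

End OneParameter.

(** For 0 < y < y0, lambda(y) exceeds 8K + 2L + 1: more than 8K for the Neumann iteration, and more
    than 2L to stay away from the support. *)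
Let y0 : R := (2 * (8 * K + 2 * L + 1))^-1.

Let den_gt0 : 0 < 8 * K + 2 * L + 1.
Proof. by move: K_ge0 L_gt0; lra. Qed.

Let y0_gt0 : 0 < y0. Proof. by rewrite invr_gt0 mulr_gt0. Qed.

Let small y : 0 < y -> y < y0 ->
  [/\ y < 1, 8 * K + 2 * L + 1 < joukowski y & y^-1 <= 2 * joukowski y].
Proof.
move=> y1 y2; have yi : 2 * (8 * K + 2 * L + 1) < y^-1.
  by rewrite -[ltLHS]invrK ltf_pV2 ?posrE ?invr_gt0 ?mulr_gt0.
have yy : y^-1 <= 2 * joukowski y.
  by rewrite /joukowski mulrA divff// mul1r lerDr ltW.
split=> //; last by lra.
rewrite (lt_trans y2)// invf_lt1 ?mulr_gt0//; move: K_ge0 L_gt0; lra.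
Qed.

Lemma measurable_cauchy (lam : R) : measurable_fun D (fun s : TR => (s - lam)^-1 : TR).
Proof.
apply: measurable_funTS.
apply: (@measurableT_comp _ _ _ _ _ _ (fun x : TR => x^-1 : TR)).
  exact: measurable_invr.
by apply: measurable_funB.
Qed.

Lemma norm_cauchy_le (lam s : R) : L < lam -> `|s| <= L ->
  `|(s - lam)^-1| <= (lam - L)^-1.
Proof.
move=> lamL; rewrite ler_norml => /andP[_ sL].
have d : 0 < lam - s by lra.
by rewrite normfV distrC gtr0_norm// lef_pV2 ?posrE//; lra.
Qed.

Let mom := wint mu L (fun=> 1).

Lemma mom_lin a p q : mom (a *: p + q) = a * mom p + mom q.
Proof.
apply: (wint_lin mu_D_lty); first exact: measurable_cst.
by exists 1 => x _; rewrite normr1.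
Qed.

Lemma mom1 : mom 1 = 1.
Proof.
rewrite /mom /wint.
transitivity (\int[mu]_(s in D) (1 : R)).
  by apply: eq_Rintegral => s _; rewrite hornerC mulr1.
rewrite Rintegral_cst; last exact: measurable_itv.
by rewrite mul1r; exact: (congr1 fine mu_D1).
Qed.

Let stj lam := wint mu L (fun s => (s - lam)^-1).

Let stj_lin lam a p q : L < lam -> stj lam (a *: p + q) = a * stj lam p + stj lam q.
Proof.
move=> lamL; apply: (wint_lin mu_D_lty); first exact: measurable_cauchy.
by exists (lam - L)^-1 => x; exact: norm_cauchy_le.
Qed.

Let stj_mul lam p : L < lam -> stj lam (('X - lam%:P) * p) = mom p.
Proof.
move=> lamL; apply: eq_Rintegral => s; rewrite inE /= norm_itv => sL.
rewrite hornerM hornerXsubC mulr1 mulrAC mulfV ?mul1r//.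
rewrite subr_eq0; apply/eqP => e; move: sL; rewrite e => /(le_trans (ler_norm _)).
by rewrite leNgt lamL.
Qed.

Let stjD lam p q : L < lam -> stj lam (p + q) = stj lam p + stj lam q.
Proof. by move=> lamL; rewrite -{1}(scale1r p) stj_lin// mul1r. Qed.

Let stj0 lam : L < lam -> stj lam 0 = 0.
Proof.
move=> lamL; have := stj_lin (-1) 0 0 lamL.
by rewrite scaler0 addr0 mulN1r addNr.
Qed.

Let stjZ lam a p : L < lam -> stj lam (a *: p) = a * stj lam p.
Proof. by move=> lamL; rewrite -[a *: p]addr0 stj_lin// stj0// addr0. Qed.

Let stieltjes_at k := forall y, 0 < y -> y < y0 ->
  stj (joukowski y) (P k) = - 2 * F y k.+1 / (G 0).[y].

Let small_jost_neq0 y : 0 < y -> y < y0 -> (G 0).[y] != 0.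
Proof.
move=> y1 y2; have [h1 h2 _] := small y1 y2.
have lam0 : 0 < joukowski y by rewrite (lt_trans den_gt0).
have y0' : y != 0 by rewrite gt_eqF.
apply: jost_neq0 => //; first by rewrite gtr0_norm.
  by rewrite gt_eqF.
have : 8 * K < joukowski y by move: h2 L_gt0; lra.
by move: K_ge0; nra.
Qed.

Let small_large y : 0 < y -> y < y0 -> L < joukowski y.
Proof. by move=> y1 y2; have [_ h _] := small y1 y2; move: h K_ge0 L_gt0; lra. Qed.

Let stieltjes_at0 : stieltjes_at 0.
Proof.
move=> y y1 y2; have [h1 h2 _] := small y1 y2.
have lam0 : 0 < joukowski y by rewrite (lt_trans den_gt0).
have y0' : y != 0 by rewrite gt_eqF.
rewrite /stj orthopoly0; apply: stieltjes_jost => //; first by rewrite gtr0_norm.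
  by rewrite gt_eqF.
have : 8 * K < joukowski y by move: h2 L_gt0; lra.
by move: K_ge0; nra.
Qed.

(** As y tends to 0, lambda(y) tends to infinity and the Stieltjes transform of X P_k is O(y).
    Writing X = (X - lambda) + lambda, this transform times G_0(y) is the polynomial [q], so q(0) =
    0; there only k = 0 leaves a contribution of G_1(0) = G_0(0). *)
Let mom_of_stieltjes k : stieltjes_at k -> mom (P k) = (k == 0%N)%:R.
Proof.
move=> Sk; pose q := mom (P k) *: G 0 - ('X^2 + 1) * ('X^k * G k.+1).
have [M M0 PM] := horner_bounded (P k) L.
have [Mc Mc0 cM] := horner_bounded (G 0) y0.
have q0 : q.[0] = 0.
  apply: (@horner0_eq0_of_linear _ q (4 * M * L * Mc) y0 y0_gt0) => y y1 y2.
  have lamL := small_large y1 y2; have c0 := small_jost_neq0 y1 y2.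
  have [h1 h2 h3] := small y1 y2.
  set lam := joukowski y in lamL h2 h3 *.
  have lam0 : 0 < lam by rewrite (lt_trans den_gt0).
  have qE : q.[y] = stj lam ('X * P k) * (G 0).[y].
    have -> : 'X * P k = ('X - lam%:P) * P k + lam *: P k.
      by rewrite mulrBl mul_polyC subrK.
    rewrite stjD// stjZ// stj_mul// Sk// mulrDl /q.
    rewrite hornerD hornerN hornerZ !hornerM hornerD !hornerXn hornerC.
    rewrite /lam /joukowski /jost_sol (exprS y k); field.
    by rewrite c0 gt_eqF.
  have sb : `|stj lam ('X * P k)| <= 4 * M * L * y.
    apply: (@le_trans _ _ (L * M * (lam - L)^-1 * fine (mu D))).
      apply: (norm_wint_le mu_D_lty); first exact: measurable_cauchy.
        by exists (lam - L)^-1 => x; exact: norm_cauchy_le.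
      move=> x xL; rewrite hornerM hornerX !normrM.
      by rewrite ler_pM ?mulr_ge0 ?norm_cauchy_le// ler_pM// PM.
    have -> : fine (mu D) = 1 by exact: (congr1 fine mu_D1).
    rewrite mulr1 (_ : 4 * M * L * y = L * M * (4 * y)); last by ring.
    rewrite ler_wpM2l ?mulr_ge0 ?(ltW L_gt0)//.
    have lL : 0 < lam - L by rewrite subr_gt0.
    rewrite -[leRHS]invrK lef_pV2 ?posrE ?invr_gt0 ?mulr_gt0// invfM.
    by move: h2 h3 K_ge0; lra.
  rewrite qE normrM (_ : _ * y = 4 * M * L * y * Mc); last by ring.
  by rewrite ler_pM// cM// gtr0_norm// ltW.
have c0 : (G 0).[0] != 0 by exact: (horner0_jost_neq0 b_neq0 free_ge).
have c01 : (G 0).[0] = (G 1).[0].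
  by apply: (horner0_jost01 b_neq0 _ free_ge).
apply: (mulIf c0); apply/eqP; rewrite -subr_eq0; apply/eqP.
rewrite -[RHS]q0 /q hornerD hornerN hornerZ !hornerM hornerD !hornerXn hornerC.
rewrite !expr0n /= add0r mul1r; congr (_ - _).
by case: k {Sk PM q q0} => [|k]; rewrite ?mul0r// c01.
Qed.

(** The transforms obey the recurrence of J up to the moment of P_k. That moment is 1 for k = 0,
    which makes up for the missing dummy entry, and 0 afterwards. *)
Let stieltjes_rec k : mom (P k) = (k == 0%N)%:R ->
  (0 < k -> stieltjes_at k.-1)%N -> stieltjes_at k -> stieltjes_at k.+1.
Proof.
move=> mk Sk1 Sk y y1 y2; have b0 := lt0r_neq0 (beta_gt0 k).
have lamL := small_large y1 y2; have c0 := small_jost_neq0 y1 y2.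
have yn0 : y != 0 by rewrite gt_eqF.
apply: (mulfI b0); rewrite -(stjZ _ _ lamL).
have := orthopoly_shift_rec alpha beta_gt0 k; rewrite !orthopoly_pair1 /= => e.
have -> : beta k *: P k.+1 = ('X - (joukowski y)%:P) * P k +
    ((joukowski y - alpha k) *: P k - offdiag beta k *: (orthopoly_pair alpha beta k).1).
  rewrite mulrBl e mul_polyC scalerBl.
  move: (_ *: _) (_ *: _) (_ *: _) (_ *: _) => A B C0 D0; by ring.
rewrite stjD// stj_mul// mk -scaleNr addrC stjD// !stjZ// Sk//.
have := jost_solR_rec beta_gt0 free_ge k yn0.
case: k {b0 e mk} Sk Sk1 => [|k] Sk Sk1 /=.
  rewrite stj0// jost_sol0 => e.
  have -> : beta 0 * (- 2 * F y 2 / (G 0).[y]) =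
      (- 2 / (G 0).[y]) * (joukowski y * F y 1 - 2^-1 * (G 0).[y] - alpha 0 * F y 1).
    by rewrite e; ring.
  by field.
rewrite orthopoly_pair1 (Sk1 isT y y1 y2) /= => e.
have -> : beta k.+1 * (- 2 * F y k.+3 / (G 0).[y]) =
  (- 2 / (G 0).[y]) * (beta k.+1 * F y k.+3) by ring.
rewrite (_ : beta k.+1 * F y k.+3 =
  joukowski y * F y k.+2 - beta k * F y k.+1 - alpha k.+1 * F y k.+2).
  by ring.
by rewrite e; ring.
Qed.

Lemma moment_orthopoly k : mom (P k) = (k == 0%N)%:R.
Proof.
suff [h _] : stieltjes_at k /\ stieltjes_at k.+1 by exact: mom_of_stieltjes.
elim: k => [|k [IH1 IH2]].
  split; first exact: stieltjes_at0.
  by apply: stieltjes_rec => //; exact: mom1.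
split=> //; apply: stieltjes_rec => //; exact: mom_of_stieltjes.
Qed.

End Moments.

(** * Chebyshev moments of the semicircle density *)

Section FreeMoments.
Variable R : realType.
Local Notation TR := (measurableTypeR R).
Local Notation leb := (@lebesgue_measure R).
Local Notation U := (@chebyU R).

Lemma integral_derivative (h H : R -> R) (a b : R) : a < b -> continuous h ->
  (forall t : R, is_derive t 1 H (h t)) ->
  (\int[leb]_(t in `[a, b]) (h t)%:E = (H b - H a)%:E)%E.
Proof.
move=> ab ch dH.
have cH : continuous H.
  move=> t; apply/differentiable_continuous/derivable1_diffP.
  by have [] := dH t.
rewrite EFinB; apply: continuous_FTC2 => //.
- exact: continuous_subspaceT.
- split.
  + by move=> t _; have [] := dH t.
  + exact/cvg_at_right_filter/cH.
  + exact/cvg_at_left_filter/cH.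
- by move=> t _; rewrite derive1E; have [] := dH t.
Qed.

Lemma is_derive_sinM (c t : R) : is_derive t 1 (fun t => sin (c * t)) (c * cos (c * t)).
Proof.
have h : is_derive t 1 (fun t => c * t) c.
  by apply: is_derive_eq; rewrite /GRing.scale /=; ring.
have := is_derive1_comp (is_derive_sin (c * t)) h.
by rewrite mulrC.
Qed.

Lemma chebyU_cos k (t : R) : (U k).[cos t] * sin t = sin (k.+1%:R * t).
Proof.
have b2 (l : nat) : 0 < (2^-1 : R) by rewrite invr_gt0.
suff : (U k).[cos t] * sin t = sin (k.+1%:R * t) /\
   (U k.+1).[cos t] * sin t = sin (k.+2%:R * t) by case.
elim: k => [|k [IH1 IH2]].
  rewrite mul1r hornerC mul1r; split=> //.
  have := horner_orthopoly_rec0 (fun=> 0) b2 (cos t).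
  rewrite orthopoly0 hornerC mul0r add0r mulr1 => e.
  rewrite (_ : 2%:R * t = t + t); last by rewrite mulr_natl mulr2n.
  rewrite sinD; have -> : (U 1).[cos t] = 2 * cos t by rewrite [X in _ = 2 * X]e /chebyU; field.
  by ring.
split=> //.
have := horner_orthopoly_recS (fun=> 0) b2 (cos t) k.
rewrite mul0r addr0 -/(chebyU R) => e.
have -> : (U k.+2).[cos t] = 2 * cos t * (U k.+1).[cos t] - (U k).[cos t].
  have -> : 2 * cos t * (U k.+1).[cos t] = 2 * (cos t * (U k.+1).[cos t]) by ring.
  by rewrite e; field.
rewrite mulrBl -[_ * _ * sin t]mulrA IH2 IH1.
have -> : k.+3%:R * t = k.+2%:R * t + t by rewrite -natr1 mulrDl mul1r.
have -> : k.+1%:R * t = k.+2%:R * t - t by rewrite -[k.+2%:R]natr1 mulrDl mul1r addrK.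
by rewrite sinB sinD; ring.
Qed.

Lemma sin_natpi k : sin (k%:R * pi) = 0 :> R.
Proof.
elim: k => [|k IH]; first by rewrite mul0r sin0.
by rewrite -natr1 mulrDl mul1r sinDpi IH oppr0.
Qed.

Lemma integral_sin_sin k :
  (\int[leb]_(t in `[0%R, pi]) (sin (k.+1%:R * t) * sin t)%:E =
   (pi / 2 * (k == 0%N)%:R)%:E)%E.
Proof.
pose h (t : R) := 2^-1 * (cos (k%:R * t) - cos (k.+2%:R * t)).
pose H (t : R) := 2^-1 * ((if k == 0%N then t else k%:R^-1 * sin (k%:R * t)) -
  k.+2%:R^-1 * sin (k.+2%:R * t)).
have -> : (\int[leb]_(t in `[0%R, pi]) (sin (k.+1%:R * t) * sin t)%:E =
           \int[leb]_(t in `[0%R, pi]) (h t)%:E)%E.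
  apply: eq_integral => t _; congr (_%:E); rewrite /h.
  have -> : k.+2%:R * t = k.+1%:R * t + t by rewrite -natr1 mulrDl mul1r.
  have -> : k%:R * t = k.+1%:R * t - t by rewrite -[k.+1%:R]natr1 mulrDl mul1r addrK.
  by rewrite cosB cosD; field.
have dH (t : R) : is_derive t 1 H (h t).
  have d2 := is_derive_sinM k.+2%:R t.
  rewrite /H /h; case: eqVneq => [->|k0].
    by apply: is_derive_eq; rewrite /GRing.scale /= mul0r cos0; field.
  have d1 := is_derive_sinM k%:R t.
  have := is_deriveZ (2^-1 : R) (is_deriveB (is_deriveZ (k%:R^-1 : R) d1)
    (is_deriveZ (k.+2%:R^-1 : R) d2)).
  by rewrite /GRing.scale /= !mulKf ?pnatr_eq0.
rewrite (integral_derivative (pi_gt0 R) _ dH); last first.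
  by move=> t; rewrite /h; apply: cvgM; [exact: cvg_cst|apply: cvgB];
    apply: continuous_comp; try exact: continuous_cos; exact: mulrl_continuous.
rewrite /H !mulr0 !sin0 !sin_natpi !mulr0 !subr0; congr (_%:E).
by case: eqVneq => _ /=; move: (pi : R) => p; field.
Qed.

(** The decreasing substitution s = cos t turns the integrand into sin((k+1)t) sin t on [0, pi]. *)
Lemma integral_chebyU_semicircle k :
  (\int[leb]_(s in `[(-1)%R, 1%R]) ((U k).[s] * Num.sqrt (1 - s ^+ 2))%:E =
   (pi / 2 * (k == 0%N)%:R)%:E)%E.
Proof.
have dcos : derive1 (@cos R) = (fun t => - sin t).
  by apply/funext => t; rewrite derive1E derive_val.
have csin : continuous (fun t : R => - sin t).
  by move=> t; apply: cvgN; exact: continuous_sin.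
have := @integration_by_substitution_decreasing R cos
  (fun s => (U k).[s] * Num.sqrt (1 - s ^+ 2)) 0 pi (pi_ge0 R).
rewrite cospi cos0 => ->.
- rewrite -integral_sin_sin; apply: eq_integral => t; rewrite inE /= in_itv /=.
  move=> tpi; rewrite dcos.
  rewrite -[LHS]/(((U k).[cos t] * Num.sqrt (1 - cos t ^+ 2)) * - - sin t)%:E.
  rewrite opprK -sin2cos2 sqrtr_sqr ger0_norm ?chebyU_cos//.
  exact: sin_ge0_pi.
- by move=> x y xI yI; rewrite ltr_cos.
- by rewrite dcos => t _; exact: csin.
- by rewrite dcos; apply/cvg_ex; eexists; exact/cvg_at_right_filter/csin.
- by rewrite dcos; apply/cvg_ex; eexists; exact/cvg_at_left_filter/csin.
- split.
  + by move=> t _; exact: ex_derive.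
  + exact/cvg_at_right_filter/continuous_cos.
  + exact/cvg_at_left_filter/continuous_cos.
- apply: continuous_subspaceT => s; apply: cvgM; first exact: continuous_horner.
  apply: continuous_comp; last exact: sqrt_continuous.
  by apply: cvgB; [exact: cvg_cst|exact: exprn_continuous].
Qed.

Lemma free_moment L k : 1 <= L ->
  wint leb L (@free_density R) (U k) = (k == 0%N)%:R.
Proof.
move=> L1; have sub : `[-1, 1] `<=` (`[- L, L]%classic : set R).
  by apply: subset_itv; rewrite bnd_simp ?lerN2.
rewrite /wint /free_density /Rintegral.
transitivity (fine (\int[leb]_(s in `[(-1)%R, 1%R])
   ((2 / pi)%:E * ((U k).[s] * Num.sqrt (1 - s ^+ 2))%:E))%E).
  congr fine; rewrite -[in RHS](setIidr sub) integral_mkcondr; apply: eq_integral => s _.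
  rewrite /patch; case: ifPn => sI.
    move: sI; rewrite inE => sI.
    by rewrite indicE mem_set// -EFinM; congr (_%:E); rewrite /=; ring.
  by move: sI; rewrite notin_setE => sI; rewrite indicE memNset//= !mulr0.
rewrite integralZl//; last first.
  apply: continuous_compact_integrable; first exact: segment_compact.
  apply: continuous_subspaceT => s; apply: cvgM; first exact: continuous_horner.
  apply: continuous_comp; last exact: sqrt_continuous.
  by apply: cvgB; [exact: cvg_cst|exact: exprn_continuous].
rewrite integral_chebyU_semicircle /= mulrA.
rewrite (_ : 2 / pi * (pi / 2) = 1) ?mul1r//.
by have := pi_gt0 R; move: (pi : R) => p p0; field; rewrite gt_eqF.
Qed.

End FreeMoments.

(** * Polynomial approximation of indicators of rays *)

Section PowerCutoff.
Variable R : realType.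

Lemma bernoulli_le (x : R) k : -1 <= x -> 1 + k%:R * x <= (1 + x) ^+ k.
Proof.
move=> x1; elim: k => [|k IH]; first by rewrite mul0r addr0.
have x0 : 0 <= 1 + x by lra.
rewrite exprSr (le_trans _ (ler_wpM2r x0 IH))// -natr1.
have := mulr_ge0 (ler0n R k) (sqr_ge0 x); nra.
Qed.

Lemma cvg_natmul_exp (q : R) : 0 <= q -> q < 1 ->
  (fun k => k%:R * q ^+ k) @ \oo --> (0 : R).
Proof.
(* Since q <= r^2, k q^k is at most (k r^k) r^k, where k r^k is bounded by Bernoulli's
   inequality. *)
move=> q0 q1; pose r := (1 + q) / 2.
have r0 : 0 < r by rewrite /r; lra.
have r1 : r < 1 by rewrite /r; lra.
have qr : q <= r ^+ 2 by rewrite /r; have := sqr_ge0 (1 - q); nra.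
have d0 : 0 < r^-1 - 1 by rewrite subr_gt0 invf_gt1.
apply: (@squeeze_cvgr _ _ _ _ (fun=> 0) (fun k => (r^-1 - 1)^-1 * r ^+ k)).
- apply: nearW => k; rewrite mulr_ge0 ?exprn_ge0//=.
  have h : k%:R * r ^+ k <= (r^-1 - 1)^-1.
    rewrite -[leRHS]mul1r ler_pdivlMr// mulrAC -ler_pdivlMr ?exprn_gt0// mul1r -exprVn.
    have := @bernoulli_le (r^-1 - 1) k.
    by rewrite (_ : 1 + (r^-1 - 1) = r^-1); [move=> /(_ ltac:(lra)); lra|ring].
  rewrite (@le_trans _ _ (k%:R * (r ^+ k * r ^+ k)))//.
    by rewrite ler_wpM2l// -expr2 -exprM mulnC exprM lerXn2r ?nnegrE ?sqr_ge0.
  by rewrite mulrA ler_wpM2r// exprn_ge0// ltW.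
- exact: cvg_cst.
- by apply: cvg_geometric; rewrite gtr0_norm.
Qed.

(** An exponent M of size k a^-k: for 0 <= u < a <= 1 the product M u^k tends to 0, while for u >= a
    it is at least k. This is the dichotomy that separates the limits 1 and 0. *)
Definition cutoff_deg (a : R) k : nat := (Num.truncn (k%:R * a^-1 ^+ k)).+1.

(* Polynomials in [u] converging boundedly on [0, 1] to the indicator of u < a. *)
Lemma cvg_cutoff (a u : R) : 0 < a -> a <= 1 -> 0 <= u -> u <= 1 ->
  (fun k => (1 - u ^+ k) ^+ cutoff_deg a k) @ \oo --> ((u < a)%R%:R : R).
Proof.
move=> a0 a1 u0 u1.
have x01 k : 0 <= u ^+ k <= 1 by rewrite exprn_ge0// exprn_ile1.
have t0 k : 0 <= k%:R * a^-1 ^+ k by rewrite mulr_ge0// exprn_ge0// invr_ge0 ltW.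
have M1 k : k%:R * a^-1 ^+ k <= (cutoff_deg a k)%:R.
  by have /andP[_ /ltW] := truncn_itv (t0 k).
have M2 k : (cutoff_deg a k)%:R <= k%:R * a^-1 ^+ k + 1.
  by have /andP[h _] := truncn_itv (t0 k); rewrite -natr1 lerD2r.
case: ltP => ua.
  have u1' : u < 1 by exact: lt_le_trans a1.
  apply: (@squeeze_cvgr _ _ _ _
    (fun k => 1 - (k%:R * (u / a) ^+ k + u ^+ k)) (fun=> 1)).
  - apply: nearW => k; have /andP[x0 x1] := x01 k; apply/andP; split.
      have := @bernoulli_le (- u ^+ k) (cutoff_deg a k); rewrite lerN2 => /(_ x1).
      apply: le_trans; rewrite mulrN lerD2l lerN2.
      rewrite (le_trans (ler_wpM2r x0 (M2 k)))// mulrDl mul1r lerD2r.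
      by rewrite exprMn mulrA mulrAC.
    by rewrite exprn_ile1 ?subr_ge0// gerBl.
  - rewrite -[X in _ --> X]subr0; apply: cvgB; first exact: cvg_cst.
    rewrite -[X in _ --> X]addr0; apply: cvgD.
      by apply: cvg_natmul_exp; rewrite ?divr_ge0 ?(ltW a0)// ltr_pdivrMr// mul1r.
    have := @cvg_geometric R 1 u; rewrite ger0_norm// => /(_ u1').
    by rewrite -exprn_geometric.
  - exact: cvg_cst.
(* For u >= a, with x = u^k and exponent M, (1 - x)^M (1 + x)^M <= 1 while (1 + x)^M >= 1 + M x >= k
   + 1. *)
apply: (@squeeze_cvgr _ _ _ _ (fun=> 0) (@harmonic R)).
- apply: nearW => k; have /andP[x0 x1] := x01 k.
  rewrite exprn_ge0 ?subr_ge0//=.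
  have h1 : k.+1%:R <= (1 + u ^+ k) ^+ cutoff_deg a k.
    have x1' : -1 <= u ^+ k by lra.
    apply: le_trans (bernoulli_le _ x1'); rewrite -natr1 addrC lerD2l.
    apply: le_trans (ler_wpM2r x0 (M1 k)); rewrite -mulrA -exprMn ler_peMr//.
    by rewrite exprn_ege1// mulrC ler_pdivlMr// mul1r.
  have h2 : 0 < (1 + u ^+ k) ^+ cutoff_deg a k by rewrite (lt_le_trans _ h1).
  rewrite (@le_trans _ _ ((1 + u ^+ k) ^+ cutoff_deg a k)^-1)//; last first.
    by rewrite lef_pV2 ?posrE.
  rewrite -[leRHS]mul1r ler_pdivlMr// -exprMn exprn_ile1//.
    by rewrite mulr_ge0//; lra.
  by have := sqr_ge0 (u ^+ k); lra.
- exact: cvg_cst.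
- exact: cvg_harmonic.
Qed.

Definition cutoff_poly (L a : R) k : {poly R} :=
  (1 - ((2 * L)^-1 *: ('X + L%:P)) ^+ k) ^+ cutoff_deg ((2 * L)^-1 * (a + L)) k.

Lemma horner_cutoff_poly L a k x : (cutoff_poly L a k).[x] =
  (1 - ((2 * L)^-1 * (x + L)) ^+ k) ^+ cutoff_deg ((2 * L)^-1 * (a + L)) k.
Proof.
rewrite /cutoff_poly horner_exp hornerD hornerN horner_exp hornerZ hornerD.
by rewrite hornerX !hornerC.
Qed.

Lemma cutoff_poly_le1 L a k x : 0 < L -> `|x| <= L -> `|(cutoff_poly L a k).[x]| <= 1.
Proof.
move=> L0; rewrite ler_norml => /andP[x1 x2]; rewrite horner_cutoff_poly normrX.
have u0 : 0 <= (2 * L)^-1 * (x + L) by rewrite mulr_ge0 ?invr_ge0; lra.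
have u1 : (2 * L)^-1 * (x + L) <= 1 by rewrite ler_pdivrMl; lra.
have h1 := exprn_ge0 k u0; have h2 := exprn_ile1 k u0 u1.
by rewrite exprn_ile1// ler_norml; apply/andP; split; lra.
Qed.

Lemma cvg_cutoff_poly L a x : 0 < L -> `|x| <= L -> - L < a -> a <= L ->
  (fun k => (cutoff_poly L a k).[x]) @ \oo --> ((x < a)%R%:R : R).
Proof.
move=> L0; rewrite ler_norml => /andP[x1 x2] a1 a2.
have i0 : 0 < (2 * L)^-1 by rewrite invr_gt0; lra.
under eq_fun do rewrite horner_cutoff_poly.
have -> : (x < a) = ((2 * L)^-1 * (x + L) < (2 * L)^-1 * (a + L)).
  by rewrite ltr_pM2l// ltrD2r.
apply: cvg_cutoff.
- by rewrite mulr_gt0//; lra.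
- by rewrite ler_pdivrMl; lra.
- by rewrite mulr_ge0 ?(ltW i0)//; lra.
- by rewrite ler_pdivrMl; lra.
Qed.

End PowerCutoff.

(** * Moments determine a weighted measure on a bounded interval *)

Section MomentsDetermine.
Variables (R : realType) (L : R).
Local Notation TR := (measurableTypeR R).
Hypothesis L_gt0 : 0 < L.
Local Notation D := (`[- L, L]%classic : set TR).
Let mD : measurable D. Proof. exact: measurable_itv. Qed.

Section OneMeasure.
Variables (m : {measure set TR -> \bar R}) (w : R -> R).
Hypothesis m_fin : (m D < +oo)%E.
Hypothesis mw : measurable_fun D (w : TR -> TR).
Hypothesis w_bounded : exists M, forall x, `|x| <= L -> `|w x| <= M.

Lemma weight_integrable A : measurable A ->
  m.-integrable (D `&` A) (EFin \o w).
Proof.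
move=> mA; have [M wM] := w_bounded.
apply: (@integrableS _ _ _ m D) => //; first exact: measurableI.
exact: bounded_integrable wM.
Qed.

Lemma weight_fin_num A : measurable A ->
  (\int[m]_(s in D `&` A) (w s)%:E)%E \is a fin_num.
Proof.
move=> mA; apply: integrable_fin_num; first exact: measurableI.
exact: weight_integrable.
Qed.

Lemma cvg_wint_cutoff a : - L < a -> a <= L ->
  (fun k => wint m L w (cutoff_poly L a k)) @ \oo -->
  \int[m]_(s in D `&` `]-oo, a[) w s.
Proof.
move=> a1 a2; have [M wM] := w_bounded.
have iw : m.-integrable D (EFin \o w) by exact: bounded_integrable wM.
have mray : measurable (`]-oo, a[%classic : set TR) by exact: measurable_itv.
pose f (s : TR) := ((w \_ `]-oo, a[) s)%:E.
have mf : measurable_fun D f.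
  apply/measurable_EFinP; apply/measurable_restrict => //.
  by apply: measurable_funS mw => //; exact: subIsetl.
have cf s : D s -> (fun k => ((cutoff_poly L a k).[s] * w s)%:E) @ \oo --> f s.
  rewrite /= norm_itv => sL.
  have -> : f s = ((s < a)%R%:R * w s)%:E.
    rewrite /f /patch mem_setE in_itv /=.
    by case: (s < a); rewrite ?mul1r ?mul0r.
  apply: cvg_EFin; first exact: nearW.
  exact: cvgM (cvg_cutoff_poly L_gt0 sL a1 a2) (@cvg_cst _ (w s) _ \oo _).
have bf s k : D s -> (`|((cutoff_poly L a k).[s] * w s)%:E| <= `|(w s)%:E|)%E.
  by rewrite /= norm_itv => sL; rewrite lee_fin normrM ler_piMl// cutoff_poly_le1.
have [i1 _] := @dominated_convergence _ _ _ m D mD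
  (fun k s => ((cutoff_poly L a k).[s] * w s)%:E) f (fun s => `|(w s)%:E|%E)
  (fun k => measurable_int _ (wint_integrable m_fin mw w_bounded (cutoff_poly L a k)))
  mf (aeW _ cf) (integrable_abse iw) (aeW _ (fun s k Ds => bf s k Ds)).
rewrite Rintegral_mkcondr => h; apply: fine_cvg; rewrite /Rintegral fineK//.
exact: integrable_fin_num.
Qed.

End OneMeasure.

Variables (m1 m2 : {measure set TR -> \bar R}) (w1 w2 : R -> R).
Hypothesis m1_fin : (m1 D < +oo)%E.
Hypothesis m2_fin : (m2 D < +oo)%E.
Hypothesis mw1 : measurable_fun D (w1 : TR -> TR).
Hypothesis mw2 : measurable_fun D (w2 : TR -> TR).
Hypothesis w1_bounded : exists M, forall x, `|x| <= L -> `|w1 x| <= M.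
Hypothesis w2_bounded : exists M, forall x, `|x| <= L -> `|w2 x| <= M.
Hypothesis eq_moments : forall p, wint m1 L w1 p = wint m2 L w2 p.

Let iw1 A := weight_integrable m1_fin mw1 w1_bounded (A := A).
Let iw2 A := weight_integrable m2_fin mw2 w2_bounded (A := A).

Let fin1 A := weight_fin_num m1_fin mw1 w1_bounded (A := A).
Let fin2 A := weight_fin_num m2_fin mw2 w2_bounded (A := A).

Let eq_total : (\int[m1]_(s in D `&` setT) (w1 s)%:E = \int[m2]_(s in D `&` setT) (w2 s)%:E)%E.
Proof.
rewrite -[LHS]fineK; last exact: (fin1 measurableT).
rewrite -[RHS]fineK; last exact: (fin2 measurableT).
rewrite setIT; congr (_%:E); have := eq_moments 1; rewrite /wint.
have e (m : {measure set TR -> \bar R}) w :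
    \int[m]_(s in D) ((1 : {poly R}).[s] * w s) = fine (\int[m]_(s in D) (w s)%:E)%E.
  by apply: eq_Rintegral => s _; rewrite hornerC mul1r.
by rewrite !e.
Qed.

Let eq_ray a : (\int[m1]_(s in D `&` `]-oo, a[) (w1 s)%:E =
  \int[m2]_(s in D `&` `]-oo, a[) (w2 s)%:E)%E.
Proof.
have mray : measurable (`]-oo, a[%classic : set TR) by exact: measurable_itv.
have [aL|La] := leP a (- L).
  rewrite (_ : D `&` _ = set0) ?integral_set0//.
  rewrite -subset0 => x [] /=; rewrite !in_itv /= => /andP[x1 _] x2; lra.
have [aL|La'] := leP a L; last first.
  rewrite (_ : D `&` _ = D `&` setT); first exact: eq_total.
  rewrite setIT setIidl// => x /=; rewrite !in_itv /= => /andP[_ x1]; lra.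
rewrite -[LHS]fineK; last exact: (fin1 mray).
rewrite -[RHS]fineK; last exact: (fin2 mray).
congr (_%:E).
have h1 := cvg_wint_cutoff m1_fin mw1 w1_bounded La aL.
have h2 := cvg_wint_cutoff m2_fin mw2 w2_bounded La aL.
have h1' : (fun k => wint m1 L w1 (cutoff_poly L a k)) @ \oo -->
    \int[m2]_(s in D `&` `]-oo, a[) w2 s.
  by rewrite (_ : (fun k => _) = fun k => wint m2 L w2 (cutoff_poly L a k))//;
     apply/funext => k; exact: eq_moments.
exact: cvg_unique h1 h1'.
Qed.

(** The cutoff polynomials and dominated convergence give equality on rays, and a Dynkin class
    argument extends it. The weights may change sign, so the class is built from the integrals
    themselves; complements use that these are finite. *)
Lemma moments_determine A : measurable A ->
  (\int[m1]_(s in D `&` A) (w1 s)%:E = \int[m2]_(s in D `&` A) (w2 s)%:E)%E.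
Proof.
pose H : set (set TR) := [set A | measurable A /\
  (\int[m1]_(s in D `&` A) (w1 s)%:E = \int[m2]_(s in D `&` A) (w2 s)%:E)%E].
have split_int (m : {measure set TR -> \bar R}) w B : measurable B ->
    (forall A, measurable A -> m.-integrable (D `&` A) (EFin \o w)) ->
    (\int[m]_(s in D `&` setT) (w s)%:E =
     \int[m]_(s in D `&` B) (w s)%:E + \int[m]_(s in D `&` ~` B) (w s)%:E)%E.
  move=> mB iw; have mC := measurableC mB.
  rewrite -(setUv B) setIUr integral_setU//=; try exact: measurableI.
    rewrite -setIUr setUv; apply: measurable_int; exact: iw.
  by apply/disj_setPS => x [[_ ?] [_ ?]].
have dH : dynkin H.
  split.
  - by split => //; exact: eq_total.
  - move=> B [mB eB]; have mC := measurableC mB; split=> //.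
    have f1 := fin1 mB.
    have e1 := split_int m1 w1 B mB (fun A => @iw1 A).
    have e2 := split_int m2 w2 B mB (fun A => @iw2 A).
    move: eq_total; rewrite e1 e2 -eB addeC [RHS]addeC.
    by move/(congr1 (fun z => z - \int[m1]_(s in D `&` B) (w1 s)%:E)%E); rewrite !addeK.
  - move=> F tF HF; have mF k : measurable (F k) by have [] := HF k.
    have mUF : measurable (\bigcup_k F k) by exact: bigcupT_measurable.
    split=> //; rewrite setI_bigcupr.
    have tDF : trivIset setT (fun k => D `&` F k) by exact: trivIset_setIl.
    have mDF k : measurable (D `&` F k) by exact: measurableI.
    rewrite !integral_bigcup//; first last.
    - by rewrite -setI_bigcupr; exact: iw1.
    - by rewrite -setI_bigcupr; exact: iw2.
    by apply: eq_eseriesr => k _; have [] := HF k.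
have GH : @RGenInftyO.G R `<=` H.
  by move=> _ [x ->]; split; [exact: measurable_itv|exact: eq_ray].
have GI : setI_closed (@RGenInftyO.G R).
  move=> _ _ [x ->] [y ->]; exists (Num.min x y).
  by apply/seteqP; split => s /=; rewrite !in_itv /= lt_min => /andP.
move=> mA; have : <<s @RGenInftyO.G R >> A.
  by have := RGenInftyO.measurableE R; rewrite /measurable /= => <-.
move/(lambda_system_subset GI (iffLR (dynkin_lambda_system H) dH) GH (fun _ _ _ _ => I)).
by case.
Qed.

End MomentsDetermine.

(** * Integration against a measure with a density *)

Section Density.
Variable R : realType.
Local Notation TR := (measurableTypeR R).
Import HBNNSimple.
Variables (m nu : {measure set TR -> \bar R}) (E : set TR) (f g : TR -> R).
Hypothesis mE : measurable E.
Hypothesis mf : measurable_fun E (f : TR -> TR).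
Hypothesis mg : measurable_fun E (g : TR -> TR).
Hypothesis f_ge0 : forall x, 0 <= f x.
Hypothesis g_ge0 : forall x, 0 <= g x.
Hypothesis nuE : forall B, measurable B ->
  (nu (E `&` B) = \int[m]_(x in E `&` B) (f x)%:E)%E.

Let mfE : measurable_fun E (EFin \o f). Proof. exact/measurable_EFinP. Qed.

Let integral_density_nnsfun (h : {nnsfun TR >-> R}) :
  (\int[nu]_(x in E) (h x)%:E = \int[m]_(x in E) ((h x)%:E * (f x)%:E))%E.
Proof.
have mB y : measurable (h @^-1` [set y]) by exact: measurable_sfunP.
have indich y : measurable_fun E (fun x => (y * \1_(h @^-1` [set y]) x)%:E).
  by apply: (measurable_comp measurableT) => //; exact: measurable_funM.
transitivity (\int[nu]_(x in E)
   (\sum_(y \in range h) (y * \1_(h @^-1` [set y]) x)%:E))%E.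
  by apply: eq_integral => t tE; rewrite fsumEFin// -fimfunE.
rewrite ge0_integral_fsum//; last by move=> y x Ex; exact: nnfun_muleindic_ge0.
transitivity (\int[m]_(x in E) (\sum_(y \in range h)
    (y * \1_(h @^-1` [set y]) x)%:E * (f x)%:E))%E; last first.
  apply: eq_integral => x xE.
  rewrite -ge0_mule_fsuml => [|y]; last exact: nnfun_muleindic_ge0.
  by rewrite fsumEFin// -fimfunE.
rewrite ge0_integral_fsum//; last 2 first.
- by move=> y; apply: emeasurable_funM.
- by move=> y x Ex; rewrite mule_ge0 ?lee_fin ?nnfun_muleindic_ge0//; exact: nnfun_muleindic_ge0.
apply: eq_fsbigr => y; rewrite inE => -[x0 _ yE].
have y0 : 0 <= y by rewrite -yE fun_ge0.
have mI : measurable_fun E (fun x : TR => (\1_(h @^-1` [set y]) x : R)%:E).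
  by apply/measurable_EFinP; exact: measurable_indic.
under eq_integral do rewrite EFinM.
rewrite ge0_integralZl//.
under [RHS]eq_integral do rewrite EFinM -muleA.
rewrite ge0_integralZl//; first last.
- by move=> x _; rewrite mule_ge0 ?lee_fin.
- exact: emeasurable_funM.
congr (_ * _)%E; rewrite integral_indic// setIC nuE// integral_mkcondr.
apply: eq_integral => x _; rewrite /patch indicE.
by case: ifPn => _; rewrite ?mul1e ?mul0e.
Qed.

(** Simple functions first, then monotone convergence. It serves to invert a density: with [g] the
    inverse of [f] on [E], the right side becomes the [m]-measure of [E]. *)
Lemma integral_density :
  (\int[nu]_(x in E) (g x)%:E = \int[m]_(x in E) ((g x)%:E * (f x)%:E))%E.
Proof.
have mgE : measurable_fun E (EFin \o g) by exact/measurable_EFinP.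
have g0 x : E x -> (0 <= (EFin \o g) x)%E by rewrite lee_fin.
pose h := nnsfun_approx mE mgE.
have hcvg x : E x -> (fun n => (h n x)%:E) @ \oo --> (g x)%:E.
  by move=> Ex; exact: (cvg_nnsfun_approx mE mgE g0 Ex).
have hnd x : E x -> {homo (fun n => (h n x)%:E) : a b / (a <= b)%N >-> (a <= b)%E}.
  by move=> Ex a b ab; rewrite lee_fin; exact/lefP/nd_nnsfun_approx.
have mh n : measurable_fun E (fun x => (h n x)%:E).
  by apply/measurable_EFinP; apply: measurable_funTS; exact: measurable_funP.
have -> : (\int[nu]_(x in E) (g x)%:E =
    limn (fun n => \int[nu]_(x in E) (h n x)%:E))%E.
  rewrite -monotone_convergence//; last by move=> n x Ex; rewrite lee_fin.
  by apply: eq_integral => x; rewrite inE => Ex; apply/esym/cvg_lim => //; exact: hcvg.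
have -> : (\int[m]_(x in E) ((g x)%:E * (f x)%:E) =
    limn (fun n => \int[m]_(x in E) ((h n x)%:E * (f x)%:E)))%E.
  rewrite -monotone_convergence//.
  - apply: eq_integral => x; rewrite inE => Ex; apply/esym/cvg_lim => //.
    by apply: cvgeZr => //; exact: hcvg.
  - by move=> n; exact: emeasurable_funM.
  - by move=> n x Ex; rewrite mule_ge0 ?lee_fin.
  - by move=> x Ex a b ab; rewrite lee_wpmul2r ?lee_fin//; exact: hnd.
by congr (limn _); apply/funext => n; exact: integral_density_nnsfun.
Qed.

End Density.

(** * Decay of the orthonormal polynomials at a point *)

Lemma cvg_cst_eq (R : realType) (a l : R) : (fun _ : nat => a) @ \oo --> l -> a = l.
Proof. by move=> h; rewrite -(cvg_lim _ h)// lim_cst. Qed.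

Lemma joukowski_onto (R : realType) (s : R) : 1 < `|s| ->
  exists y : R, [/\ y != 0, `|y| < 1 & joukowski y = s].
Proof.
have pos (t : R) : 1 < t -> exists y : R, [/\ y != 0, `|y| < 1 & joukowski y = t].
  move=> t1; have d0 : 0 <= t ^+ 2 - 1 by nra.
  have := sqr_sqrtr d0; have := sqrtr_ge0 (t ^+ 2 - 1).
  set r := Num.sqrt _ => r0 rE; have rt : r < t by nra.
  have rt1 : t - 1 < r by nra.
  have yz : t - r != 0 by rewrite subr_eq0 gt_eqF.
  (* The smaller root of y^2 - 2 t y + 1 = 0; its inverse is t + r. *)
  exists (t - r); split=> //; first by rewrite gtr0_norm; lra.
  have -> : joukowski (t - r) = 2^-1 * ((t - r) + (t + r)).
    congr (_ * (_ + _)); apply: (mulfI yz); rewrite mulfV//.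
    have -> : (t - r) * (t + r) = t ^+ 2 - r ^+ 2 by ring.
    by rewrite rE; ring.
  by field.
case: (ltrP 0 s) => s0; first by rewrite gtr0_norm//; exact: pos.
rewrite ler0_norm// => /pos[y [y0 y1 yE]]; exists (- y).
rewrite oppr_eq0 normrN; split=> //; rewrite /joukowski invrN -opprD mulrN.
by rewrite -[_ * _]/(joukowski y) yE opprK.
Qed.

Section SolutionAsymptotics.
Variables (R : realType) (alpha beta : nat -> R) (n : nat).
Hypothesis beta_gt0 : forall k, 0 < beta k.
Hypothesis free_ge : forall k, (n <= k)%N -> alpha k = 0 /\ offdiag beta k = 2^-1.
Local Notation P := (orthopoly alpha beta).
Local Notation G := (jost alpha (offdiag beta) n).
Local Notation F := (jost_sol alpha (offdiag beta) n).

Lemma orthopoly_consecutive_neq0 s k : (P k).[s] = 0 -> (P k.+1).[s] = 0 -> False.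
Proof.
elim: k => [|k IH] h1 h2.
  by move: h1; rewrite orthopoly0 hornerC => /eqP; rewrite oner_eq0.
apply: IH => //; have := horner_orthopoly_recS alpha beta_gt0 s k.
rewrite h1 h2 !mulr0 !addr0 => /esym/eqP.
by rewrite mulf_eq0 gt_eqF//= => /eqP.
Qed.

Lemma orthopoly_free_rec s k : (n <= k.+1)%N ->
  (P k.+2).[s] = 2 * s * (P k.+1).[s] - (P k).[s].
Proof.
move=> nk; have := horner_orthopoly_recS alpha beta_gt0 s k.
have [-> /= ->] := free_ge nk; have [_ /= ->] := free_ge (leqW nk).
rewrite mul0r addr0 => e.
by rewrite -[2 * s * _]mulrA e; field.
Qed.

(** A conserved quadratic form in consecutive values would have limit 0, hence vanish. For |s| < 1
    it is definite; for s = 1 or -1 it is a perfect square that forces p_(k+1) = s p_k, so |p_k| is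
    eventually constant. Either way two consecutive values vanish. *)
Lemma orthopoly_not_cvg0 s : `|s| <= 1 -> ~ ((fun k => (P k).[s]) @ \oo --> (0 : R)).
Proof.
move=> s1 P0; pose p k := (P k).[s].
(* The quadratic form conserved by p_(k+2) = 2 s p_(k+1) - p_k. *)
pose q k := p k.+1 ^+ 2 - 2 * s * (p k * p k.+1) + p k ^+ 2.
have qS k : (n <= k.+1)%N -> q k.+1 = q k.
  by move=> nk; rewrite /q /p orthopoly_free_rec//; ring.
have q0 k : (n <= k.+1)%N -> q k = 0.
  move=> nk; have qk m : q (m + k)%N = q k.
    by elim: m => // m IH; rewrite addSn qS ?IH//; lia.
  have P1 : (fun m => p m.+1) @ \oo --> (0 : R) by rewrite (cvg_shiftS p).
  have : q @ \oo --> (0 : R).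
    have -> : (0 : R) = 0 * 0 - 2 * s * (0 * 0) + 0 * 0 by ring.
    rewrite (_ : q = fun m => p m.+1 * p m.+1 - 2 * s * (p m * p m.+1) + p m * p m).
      apply: cvgD; last exact: cvgM.
      apply: cvgB; first exact: cvgM.
      by apply: cvgM; [exact: cvg_cst|exact: cvgM].
    by apply/funext => m; rewrite /q !expr2.
  rewrite -(cvg_shiftn k) (_ : (fun m => q (m + k)%N) = fun=> q k); last first.
    by apply/funext => m; rewrite qk.
  exact: cvg_cst_eq.
have s2 : s ^+ 2 <= 1 by rewrite -real_normK ?num_real// expr_le1.
have [sl|sl] : s ^+ 2 < 1 \/ s ^+ 2 = 1.
  by move: s2; rewrite le_eqVlt => /predU1P[->|->]; [right|left].
- have := q0 n (leqnSn n); rewrite /q => e.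
  have e1 : p n = 0.
    by apply/eqP; rewrite -sqrf_eq0; apply/eqP; have := sqr_ge0 (p n.+1 - s * p n);
       have := sqr_ge0 (p n); nra.
  apply: (@orthopoly_consecutive_neq0 s n); first exact: e1.
  move: e; rewrite e1 mul0r mulr0 subr0 expr0n addr0 => /eqP.
  by rewrite sqrf_eq0 => /eqP.
have step k : (n <= k)%N -> p k.+1 = s * p k.
  move=> nk; apply/eqP; rewrite -subr_eq0 -sqrf_eq0; apply/eqP.
  have e : q k = (p k.+1 - s * p k) ^+ 2 + (1 - s ^+ 2) * p k ^+ 2 by rewrite /q; ring.
  by rewrite -(q0 k (leqW nk)) e sl subrr mul0r addr0.
have const m : p (m + n)%N ^+ 2 = p n ^+ 2.
  elim: m => // m IH; rewrite addSn step; last exact: leq_addl.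
  by rewrite exprMn sl mul1r IH.
have pn : p n = 0.
  apply/eqP; rewrite -sqrf_eq0; apply/eqP.
  have : (fun m => p m * p m) @ \oo --> (0 * 0 : R) by exact: cvgM.
  rewrite mul0r -(cvg_shiftn n) (_ : (fun m => _) = fun=> p n ^+ 2); last first.
    by apply/funext => m; rewrite -(const m) expr2.
  exact: cvg_cst_eq.
by apply: (@orthopoly_consecutive_neq0 s n) => //; rewrite -/(p _) step// pn mulr0.
Qed.

Lemma orthopoly_cvg0_root s : (fun k => (P k).[s]) @ \oo --> (0 : R) ->
  exists y, [/\ `|y| < 1, joukowski y = s & root (G 0) y].
Proof.
move=> P0; case: (lerP `|s| 1) => s1; first by case: (orthopoly_not_cvg0 s1).
have [y [y0 y1 ys]] := joukowski_onto s1; exists y; split=> //.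
have yV : y^-1 != 0 by rewrite invr_eq0.
have yk0 : (fun k => y ^+ k) @ \oo --> (0 : R).
  by have := @cvg_geometric R 1 y y1; rewrite -exprn_geometric.
have yS : (fun k => y ^+ k.+1) @ \oo --> (0 : R) by rewrite (cvg_shiftS (fun k => y ^+ k)).
(* Multiplying the Jost formula by y^(k+1) isolates G_0(y): [d] is eventually this constant, yet
   tends to 0. *)
pose d k := y ^+ k.+1 * y ^+ k.+1 * (G 0).[y^-1] - y ^+ k.+1 * ((y - y^-1) * (P k).[s]).
have d0 : d @ \oo --> (0 : R).
  have -> : (0 : R) = 0 * 0 * (G 0).[y^-1] - 0 * ((y - y^-1) * 0) by ring.
  apply: cvgB; first by apply: cvgM; [exact: cvgM|exact: cvg_cst].
  by apply: cvgM => //; apply: cvgM => //; exact: cvg_cst.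
have dE k : (n <= k)%N -> d k = (G 0).[y].
  move=> nk; rewrite /d -ys (orthopoly_jost beta_gt0 free_ge)//.
  rewrite !jost_sol_ge ?leqW// exprVn; field.
  by rewrite expf_neq0.
apply/eqP; move: d0; rewrite -(cvg_shiftn n) (_ : (fun m => _) = fun=> (G 0).[y]).
  exact: cvg_cst_eq.
by apply/funext => m; rewrite dE// leq_addl.
Qed.

End SolutionAsymptotics.

(** * The Christoffel-Darboux kernel *)

Section ChristoffelDarboux.
Variables (R : realType) (alpha beta : nat -> R).
Hypothesis beta_gt0 : forall k, 0 < beta k.
Local Notation P := (orthopoly alpha beta).

Definition cd_kernel s N : {poly R} := \sum_(k < N) (P k).[s] *: P k.
Definition christoffel s N : R := \sum_(k < N) (P k).[s] ^+ 2.

Lemma cd_kernel_diag s N : (cd_kernel s N).[s] = christoffel s N.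
Proof. by rewrite horner_sum; apply: eq_bigr => k _; rewrite hornerZ expr2. Qed.

Lemma christoffel_ge1 s N : 1 <= christoffel s N.+1.
Proof.
by rewrite /christoffel big_ord_recl orthopoly0 hornerC expr1n lerDl sumr_ge0// => k _;
  exact: sqr_ge0.
Qed.

Lemma christoffel_darboux s N : ('X - s%:P) * cd_kernel s N.+1 =
  beta N *: ((P N).[s] *: P N.+1 - (P N.+1).[s] *: P N).
Proof.
pose Q k := (orthopoly_pair alpha beta k).1.
have rX k : 'X * Q k.+1 = (offdiag beta k)%:P * Q k + (alpha k)%:P * Q k.+1 +
    (offdiag beta k.+1)%:P * Q k.+2.
  by rewrite !mul_polyC; exact: orthopoly_shift_rec.
have rs k : s%:P * (Q k.+1).[s]%:P = (offdiag beta k)%:P * (Q k).[s]%:P +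
    (alpha k)%:P * (Q k.+1).[s]%:P + (offdiag beta k.+1)%:P * (Q k.+2).[s]%:P.
  rewrite -!polyCM -!polyCD; congr (_%:P).
  have := congr1 (horner^~ s) (rX k).
  by rewrite hornerM hornerX !hornerD !hornerM !hornerC.
have := wronskian_sum (phi := Q) (psi := fun k => (Q k).[s]%:P) rX rs N.+1.
rewrite /wronskian /Q !orthopoly_pair1 /= horner0 polyC0 !mul0r subrr mulr0 sub0r.
rewrite /cd_kernel (_ : \sum_(k < N.+1) _ = \sum_(k < N.+1) (P k).[s] *: P k).
  by move=> ->; rewrite -mulrN opprB ![P _ * _%:P]mulrC !mul_polyC.
by apply: eq_bigr => k _; rewrite !orthopoly_pair1 mulrC mul_polyC.
Qed.

Variable L : {poly R} -> R.
Hypothesis L_lin : forall a p q, L (a *: p + q) = a * L p + L q.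
Hypothesis LP : forall k, L (P k) = (k == 0%N)%:R.

Let L0 : L 0 = 0.
Proof. by have := L_lin (-1) 0 0; rewrite scaler0 addr0 mulN1r addNr. Qed.

Let LZ a p : L (a *: p) = a * L p.
Proof. by rewrite -[a *: p]addr0 L_lin L0 addr0. Qed.

Let LD p q : L (p + q) = L p + L q.
Proof. by rewrite -{1}(scale1r p) L_lin mul1r. Qed.

Lemma linear_form_sum m (f : nat -> {poly R}) :
  L (\sum_(k < m) f k) = \sum_(k < m) L (f k).
Proof. by elim: m => [|m IH]; rewrite ?big_ord0// !big_ord_recr LD IH. Qed.

Let ortho := orthopoly_orthonormal beta_gt0 L_lin LP.

Lemma linear_form_mul_sum m (d : nat -> R) j :
  L ((\sum_(k < m) d k *: P k) * P j) = if (j < m)%N then d j else 0.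
Proof.
rewrite mulr_suml (linear_form_sum m (fun k => d k *: P k * P j)).
have e k : L (d k *: P k * P j) = d k * (k == j)%:R by rewrite -scalerAl LZ ortho.
under eq_bigr do rewrite e.
case: ltnP => jm.
  rewrite (bigD1 (Ordinal jm))//= eqxx mulr1 big1 ?addr0// => i ij.
  rewrite (_ : (i == j :> nat) = false) ?mulr0//.
  by apply/negbTE; apply: contra ij => /eqP e'; apply/eqP/val_inj.
rewrite big1// => i _; rewrite (_ : (i == j :> nat) = false) ?mulr0//.
by rewrite ltn_eqF// (leq_trans (ltn_ord i)).
Qed.

Lemma cd_kernel_norm s N : L (cd_kernel s N ^+ 2) = christoffel s N.
Proof.
rewrite expr2 {2}/cd_kernel mulr_sumr.
rewrite (linear_form_sum N (fun k => cd_kernel s N * ((P k).[s] *: P k))).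
apply: eq_bigr => k _; rewrite -scalerAr LZ.
by rewrite (linear_form_mul_sum N (fun k => (P k).[s])) ltn_ord expr2.
Qed.

Lemma christoffel_darboux_norm s N : L ((('X - s%:P) * cd_kernel s N.+1) ^+ 2) =
  beta N ^+ 2 * ((P N).[s] ^+ 2 + (P N.+1).[s] ^+ 2).
Proof.
rewrite christoffel_darboux exprZn LZ; congr (_ * _).
set u := (P N).[s]; set v := (P N.+1).[s].
have -> : (u *: P N.+1 - v *: P N) ^+ 2 = (u * u) *: (P N.+1 * P N.+1) +
    (- (u * v) *: (P N.+1 * P N) + (- (u * v) *: (P N.+1 * P N) +
     (v * v) *: (P N * P N))).
  by rewrite -!mul_polyC !polyCN !polyCM; ring.
by rewrite !LD !LZ !ortho !eqxx gtn_eqF//=; ring.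
Qed.

End ChristoffelDarboux.

(** * Location and mass of the atoms of the spectral measure *)

Section Atoms.
Variables (R : realType) (alpha beta : nat -> R).
Local Notation TR := (measurableTypeR R).
Hypothesis beta_gt0 : forall k, 0 < beta k.
Local Notation P := (orthopoly alpha beta).
Variables (mu : probability TR R) (L : R).
Local Notation D := (`[- L, L]%classic : set TR).
Hypothesis mu_supp : mu (~` D) = 0%E.
Local Notation mom := (wint mu L (fun=> 1)).
Hypothesis momP : forall k, mom (P k) = (k == 0%N)%:R.

Let mD : measurable D. Proof. exact: measurable_itv. Qed.
Let mu_fin : (mu D < +oo)%E. Proof. exact: mu_D_lty. Qed.
Let mom_lin := mom_lin mu L.

Let poly_integrable (p : {poly R}) : mu.-integrable D (EFin \o horner p).
Proof.
have [M _ pM] := horner_bounded p L.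
by apply: (bounded_integrable mu_fin (M := M)) => //; exact: measurable_horner.
Qed.

Lemma mom_off_null p (N : set TR) : measurable N -> mu N = 0%E ->
  mom p = \int[mu]_(x in D `\` N) p.[x].
Proof.
move=> mN N0; rewrite /wint /Rintegral; congr fine.
rewrite -(negligible_integral mN mD (poly_integrable p) N0).
by apply: eq_integral => x _; rewrite mulr1.
Qed.

Let indic1_integrable (s : R) (E : set TR) : measurable E ->
  mu.-integrable E (EFin \o \1_[set s]).
Proof.
move=> mE; apply: (@integrableS _ _ _ mu setT) => //.
by apply: integrable_indic; exact: measurable_set1.
Qed.

Lemma integral_atom (c s : R) (E : set TR) : measurable E -> E s ->
  \int[mu]_(x in E) (c * \1_[set s] x) = c * fine (mu [set s]).
Proof.
move=> mE Es; have ms : measurable ([set s] : set TR) by exact: measurable_set1.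
rewrite RintegralZl//; last exact: indic1_integrable.
congr (_ * _); rewrite /Rintegral integral_indic//.
by congr (fine (mu _)); apply/seteqP; split => x /=; [case|move=> ->].
Qed.

Let indic_integrable (c s : R) (E : set TR) : measurable E ->
  mu.-integrable E (EFin \o (fun x => c * \1_[set s] x)).
Proof.
move=> mE; exact: (@integrableZl _ _ _ mu E mE c _ (indic1_integrable s mE)).
Qed.

(** The square of the kernel K_N(s, x) integrates to K_N(s, s), and the atom alone contributes
    K_N(s, s)^2 times its mass. *)
Lemma atom_christoffel_le s N : `|s| <= L ->
  christoffel alpha beta s N ^+ 2 * fine (mu [set s]) <= christoffel alpha beta s N.
Proof.
move=> sL; rewrite -[leRHS](cd_kernel_norm beta_gt0 mom_lin momP).
rewrite (@mom_off_null _ set0)// setD0 -(@integral_atom _ _ D)//; last by rewrite /= norm_itv.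
apply: (le_Rintegral mD (indic_integrable _ s mD)
  (poly_integrable (cd_kernel alpha beta s N ^+ 2))) => x _.
rewrite indicE; have [xs|xs] := eqVneq x s.
  by rewrite xs mem_set// mulr1 horner_exp cd_kernel_diag.
by rewrite memNset ?mulr0 ?horner_exp ?sqr_ge0//; apply/eqP.
Qed.

(** The left side is the integral of K^2 away from s, where |x - s| >= d almost everywhere; there
    K^2 is at most d^-2 ((x - s) K)^2, whose integral is given by the Christoffel-Darboux
    formula. *)
Lemma atom_christoffel_ge s N (d : R) : `|s| <= L -> 0 < d ->
  mu [set x | 0 < `|x - s| < d] = 0%E ->
  christoffel alpha beta s N.+1 - christoffel alpha beta s N.+1 ^+ 2 * fine (mu [set s])
  <= d ^- 2 * (beta N ^+ 2 * ((P N).[s] ^+ 2 + (P N.+1).[s] ^+ 2)).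
Proof.
move=> sL d0; set gap := [set x | _] => gap0.
have mgap : measurable (gap : set TR).
  rewrite (_ : gap = (`]s - d, s + d[ `\` [set s])%classic).
    by apply: measurableD; [exact: measurable_itv|exact: measurable_set1].
  apply/seteqP; split => x; rewrite /gap /= in_itv /= normr_gt0 subr_eq0 ltr_distl.
    by move=> /andP[/eqP ? ?].
  by move=> [-> /eqP ->].
have mDg : measurable (D `\` gap) by exact: measurableD.
have sub : D `\` gap `<=` D by exact: subDsetl.
rewrite -(christoffel_darboux_norm beta_gt0 mom_lin momP).
rewrite -{1}(cd_kernel_norm beta_gt0 mom_lin momP).
rewrite !(mom_off_null _ mgap gap0).
rewrite -(@integral_atom _ _ (D `\` gap))//; last first.
  split; first by rewrite /= norm_itv.
  by rewrite /gap /= subrr normr0 ltxx.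
have ip p : mu.-integrable (D `\` gap) (EFin \o horner p).
  exact: integrableS (poly_integrable p).
set K := cd_kernel _ _ _ _; set S := ('X - s%:P) * K.
have iS : mu.-integrable (D `\` gap) (EFin \o (fun x => d ^- 2 * (S ^+ 2).[x])).
  exact: (@integrableZl _ _ _ mu _ mDg (d ^- 2) _ (ip _)).
have iI := indic_integrable (christoffel alpha beta s N.+1 ^+ 2) s mDg.
rewrite lerBlDl -(RintegralZl (d ^- 2) mDg (ip _)) -(RintegralD mDg iI iS).
apply: (le_Rintegral mDg (ip _) (integrableD mDg iI iS)).
move=> x [_ gx]; rewrite /S !horner_exp hornerM hornerXsubC indicE.
have [xs|xs] := eqVneq x s.
  rewrite xs mem_set// mulr1 cd_kernel_diag lerDl.
  by rewrite mulr_ge0 ?invr_ge0 ?sqr_ge0.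
rewrite memNset; last exact/eqP.
rewrite mulr0 add0r exprMn mulrA ler_peMl ?sqr_ge0//.
have xd : d <= `|x - s|.
  by rewrite leNgt; apply/negP => h; apply: gx; rewrite /gap /= h normr_gt0 subr_eq0 xs.
rewrite mulrC ler_pdivlMr ?exprn_gt0// mul1r -[leRHS]real_normK ?num_real//.
by rewrite ler_sqr ?nnegrE ?(ltW d0).
Qed.

Variable n : nat.
Hypothesis n_gt0 : (0 < n)%N.
Hypothesis free_ge : forall k, (n <= k)%N -> alpha k = 0 /\ offdiag beta k = 2^-1.
Local Notation G := (jost alpha (offdiag beta) n).
Local Notation F := (jost_sol alpha (offdiag beta) n).

Lemma atom_support s : mu [set s] != 0%E -> `|s| <= L.
Proof.
move=> ms0; rewrite leNgt; apply/negP => sL; move/eqP: ms0; apply.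
apply/eqP; rewrite -measure_le0 -mu_supp; apply: le_measure; rewrite ?inE.
- exact: measurable_set1.
- exact: measurableC.
- by move=> x ->; rewrite /= norm_itv; apply/negP; rewrite -ltNge.
Qed.

(** The upper estimate bounds the sums of P_k(s)^2 by the inverse of the mass, so P_k(s) tends to
    0. *)
Lemma atom_root s : mu [set s] != 0%E ->
  exists y, [/\ `|y| < 1, joukowski y = s & root (G 0) y].
Proof.
move=> ms0; have sL := atom_support ms0.
have ms : measurable ([set s] : set TR) by exact: measurable_set1.
have m0 : 0 < fine (mu [set s]).
  rewrite fine_gt0// lt0e ms0 measure_ge0/= (le_lt_trans (probability_le1 mu ms))//.
  exact: ltry.
apply: (orthopoly_cvg0_root beta_gt0 free_ge).
pose u k : R := (P k).[s] ^+ 2.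
have uk N : series u N = christoffel alpha beta s N by rewrite /series /= big_mkord.
have cu : cvgn (series u).
  apply: nondecreasing_is_cvgn.
    apply/nondecreasing_seqP => N; rewrite !uk /christoffel big_ord_recr /= lerDl.
    exact: sqr_ge0.
  exists (fine (mu [set s]))^-1 => _ [N _ <-]; rewrite uk.
  have x0 : 0 <= christoffel alpha beta s N by apply: sumr_ge0 => k _; exact: sqr_ge0.
  move: x0 (atom_christoffel_le N sL); move: (christoffel _ _ _ _) => x x0 h.
  have [->|xn0] := eqVneq x 0; first by rewrite invr_ge0 ltW.
  have xgt0 : 0 < x by rewrite lt0r xn0.
  by rewrite -[leRHS]mul1r ler_pdivlMr// -(ler_pM2l xgt0) mulrA -expr2 mulr1.
have u0 := cvg_series_cvg_0 cu.
apply/norm_cvg0P; rewrite -[X in _ --> X]sqrtr0.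
rewrite (_ : (fun k => `|(P k).[s]|) = Num.sqrt \o u); last first.
  by apply/funext => k; rewrite /u /= sqrtr_sqr.
exact: (cvg_comp _ _ u0 (@sqrt_continuous R 0)).
Qed.

(** At a root y the Jost formula makes P_k(s) proportional to F_{k+1}(y), which decays
    geometrically. The upper and lower estimates then meet in the limit, and the mass is the inverse
    of the sum of all P_k(s)^2. *)
Lemma atom_mass y (d : R) : root (G 0) y -> `|y| < 1 ->
  0 < d -> `|joukowski y| <= L ->
  mu [set x | 0 < `|x - joukowski y| < d] = 0%E ->
  fine (mu [set joukowski y]) = eigen_mass (G 0) y.
Proof.
move=> ry y1 d0 sL gap0; set s := joukowski y in sL gap0 *.
have y0 : y != 0 by exact: (jost_root_neq0 beta_gt0 free_ge ry).
have yV : y^-1 != 0 by rewrite invr_eq0.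
have c1 : (G 0).[y^-1] != 0 by exact: (jost_root_inv beta_gt0 free_ge ry y1).
have c' : (G 0)^`().[y] != 0.
  exact: (jost_root_deriv beta_gt0 n_gt0 free_ge ry (ltW y1)).
have y2 : 1 - y ^+ 2 != 0.
  by rewrite subr_eq0 eq_sym lt_eqF// -real_normK ?num_real// expr_lt1.
have W := jost_sol_wronskian beta_gt0 free_ge y0.
rewrite (eqP ry : (G 0).[y] = 0) mulr0 subr0 in W.
have yy : y - y^-1 = - (1 - y ^+ 2) / y by field.
have yy0 : y - y^-1 != 0 by rewrite yy mulf_neq0// oppr_eq0.
have F0 : F y 1 != 0.
  by apply: contraNneq yy0 => F1; rewrite -W F1 mul0r.
have PF k : (P k).[s] = F y k.+1 / F y 1.
  have := orthopoly_jost beta_gt0 free_ge k y0.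
  rewrite (eqP ry : (G 0).[y] = 0) mulr0 subr0 -W => e.
  by apply: (mulfI (mulf_neq0 F0 c1)); rewrite e; field.
(* The value of the sum of all P_k(s)^2. *)
pose kap := y ^+ 2 * bezout_form alpha (offdiag beta) n y y / ((1 - y ^+ 2) * F y 1 ^+ 2).
(* For N = n this is the definition of the form on the diagonal; afterwards each new term is a power
   of y and the sum telescopes. *)
have sumF N : (n <= N)%N -> (1 - y ^+ 2) * \sum_(k < N) F y k.+1 ^+ 2 =
    y ^+ 2 * bezout_form alpha (offdiag beta) n y y - (y ^+ N.+1) ^+ 2.
  move=> /subnK <-; elim: (N - n)%N => [|m IH].
    rewrite add0n /bezout_form; set T := \sum_(k < n) (y * y) ^+ k * _.
    have -> : \sum_(k < n) F y k.+1 ^+ 2 = y ^+ 2 * T.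
      rewrite mulr_sumr; apply: eq_bigr => k _.
      by rewrite /jost_sol (exprS y k) [(y * y) ^+ k]exprMn; ring.
    by rewrite [(y * y) ^+ n]exprMn (exprS y n); ring.
  rewrite addSn big_ord_recr /= mulrDr IH jost_sol_ge; last by rewrite ltnW// ltnS leq_addl.
  by rewrite !exprS; ring.
have kapN N : (n <= N)%N -> christoffel alpha beta s N =
    kap - (y ^+ N.+1) ^+ 2 / ((1 - y ^+ 2) * F y 1 ^+ 2).
  move=> nN; apply: (mulfI (mulf_neq0 y2 (expf_neq0 2 F0))).
  rewrite /kap mulrBr [RHS](_ : _ = y ^+ 2 * bezout_form alpha (offdiag beta) n y y
     - (y ^+ N.+1) ^+ 2); last by field; rewrite y2 F0.
  rewrite -sumF// -mulrA; congr (_ * _); rewrite /christoffel mulr_sumr.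
  by apply: eq_bigr => k _; rewrite PF; field.
have yS : (fun k => y ^+ k.+1) @ \oo --> (0 : R).
  rewrite (cvg_shiftS (fun k => y ^+ k)).
  by have := @cvg_geometric R 1 y y1; rewrite -exprn_geometric.
set m0 := fine (mu [set s]).
have kap_cvg : (fun N => christoffel alpha beta s N) @ \oo --> kap.
  rewrite -(cvg_shiftn n) (_ : (fun N => _) = fun N => kap -
     (y ^+ (N + n).+1 * y ^+ (N + n).+1) / ((1 - y ^+ 2) * F y 1 ^+ 2)); last first.
    by apply/funext => N; rewrite kapN ?leq_addl// expr2.
  rewrite (cvg_shiftn n (fun N => kap - (y ^+ N.+1 * y ^+ N.+1) /
     ((1 - y ^+ 2) * F y 1 ^+ 2))).
  have e : kap - 0 * 0 / ((1 - y ^+ 2) * F y 1 ^+ 2) = kap by ring.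
  have h := cvgB (@cvg_cst _ kap _ \oo _) (cvgM (cvgM yS yS)
    (@cvg_cst _ ((1 - y ^+ 2) * F y 1 ^+ 2)^-1 _ \oo _)).
  by rewrite e in h; exact: h.
have lim0 : kap - kap * kap * m0 = 0.
  have h1 : (fun N => christoffel alpha beta s N.+1 -
      christoffel alpha beta s N.+1 * christoffel alpha beta s N.+1 * m0) @ \oo -->
      kap - kap * kap * m0.
    have kS : (fun N => christoffel alpha beta s N.+1) @ \oo --> kap.
      by rewrite (cvg_shiftS (christoffel alpha beta s)).
    exact: (cvgB kS (cvgM (cvgM kS kS) (cvg_cst _))).
  pose e N := d ^- 2 * (4^-1 * ((y ^+ N.+1 * y ^+ N.+1 + y ^+ N.+2 * y ^+ N.+2)
      / F y 1 ^+ 2)).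
  have h2 : e @ \oo --> (0 : R).
    have -> : (0 : R) = d ^- 2 * (4^-1 * ((0 * 0 + 0 * 0) / F y 1 ^+ 2)) by ring.
    have ySS : (fun k => y ^+ k.+2) @ \oo --> (0 : R).
      by rewrite (cvg_shiftS (fun k => y ^+ k.+1)).
    apply: cvgM; first exact: cvg_cst.
    apply: cvgM; first exact: cvg_cst.
    apply: cvgM; last exact: cvg_cst.
    exact: (cvgD (cvgM yS yS) (cvgM ySS ySS)).
  apply/eqP; rewrite eq_le; apply/andP; split.
    apply: (ler_cvg_to h1 h2); exists n => // N /= nN.
    rewrite -expr2 (le_trans (atom_christoffel_ge N sL d0 gap0))// /e.
    rewrite ler_wpM2l ?invr_ge0 ?sqr_ge0//.
    have [_ /= ->] := free_ge (leqW nN : (n <= N.+1)%N).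
    rewrite !PF (jost_sol_ge _ _ _ (leqW nN)) (jost_sol_ge _ _ _ (leqW (leqW nN))).
    by rewrite le_eqVlt; apply/orP; left; apply/eqP; field.
  apply: (cvgr_to_ge h1); apply: nearW => N.
  by rewrite subr_ge0 -expr2; exact: atom_christoffel_le.
have kap1 : 1 <= kap.
  by apply: (cvgr_to_ge kap_cvg); exists 1%N => // -[//|N] _; exact: christoffel_ge1.
have kap0 : kap != 0 by rewrite gt_eqF// (lt_le_trans _ kap1).
have -> : m0 = kap^-1.
  apply: (mulfI kap0); apply: (mulfI kap0); rewrite mulfV// mulr1 mulrA.
  by apply/esym/eqP; rewrite -subr_eq0 lim0.
rewrite /kap (bezout_form_diag_root beta_gt0 n_gt0 free_ge ry) /eigen_mass -W.
have FE : y * (G 1).[y] = F y 1 by rewrite /jost_sol expr1.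
rewrite FE; have -> : 1 - y ^+ 2 = - (F y 1 * (G 0).[y^-1]) * y by rewrite W yy; field.
by field; rewrite y0 c' F0 c1.
Qed.

End Atoms.

(** * Finite sets, null sets and bounds for the semicircle density *)

Lemma exists_all_roots (R : idomainType) (p : {poly R}) : p != 0 ->
  exists s : seq R, forall x, root p x -> x \in s.
Proof.
have [m] := ubnP (size p); elim: m p => // m IH p pm p0.
have [[a ra]|nr] := pselect (exists a, root p a); last first.
  by exists [::] => x rx; case: nr; exists x.
have /factor_theorem[q qE] := ra.
have q0 : q != 0 by apply: contraNneq p0 => q0; rewrite qE q0 mul0r.
have [|s sE] := IH q _ q0.
  move: pm; rewrite qE size_Mmonic ?monicXsubC// size_XsubC addn2 /=; lia.
exists (a :: s) => x; rewrite qE rootM root_XsubC in_cons => /orP[/sE ->|->//].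
by rewrite orbT.
Qed.

Lemma exists_separation (R : realType) (s : seq R) (a : R) :
  exists2 d, 0 < d & forall z, z \in s -> z != a -> d <= `|z - a|.
Proof.
elim: s => [|b s [d d0 dE]]; first by exists 1.
have [->|ba] := eqVneq b a.
  by exists d => // z; rewrite in_cons => /orP[/eqP ->|]; [rewrite eqxx|exact: dE].
exists (Num.min d `|b - a|); first by rewrite lt_min d0 normr_gt0 subr_eq0.
move=> z; rewrite in_cons => /orP[/eqP -> _|zs za]; first by rewrite ge_min lexx orbT.
by rewrite ge_min dE.
Qed.

Lemma set_seq_cons (T : eqType) (a : T) (s : seq T) : [set` a :: s] = a |` [set` s].
Proof.
apply/seteqP; split => x /=; rewrite in_cons; first by case/orP => [/eqP ->|]; [left|right].
by case=> [->|->]; rewrite ?eqxx ?orbT.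
Qed.

Section FiniteSets.
Variable R : realType.
Local Notation TR := (measurableTypeR R).
Variable m : {measure set TR -> \bar R}.

Lemma measurable_seq_set (s : seq R) : measurable ([set` s] : set TR).
Proof.
elim: s => [|a s IH]; first by rewrite set_nil.
by rewrite set_seq_cons; apply: measurableU => //; exact: measurable_set1.
Qed.

Lemma measure_seq_set (s : seq R) (A : set TR) : uniq s -> measurable A ->
  (m (A `&` [set` s]) = \sum_(z <- s) m [set z] * \d_z A)%E.
Proof.
move=> + mA; elim: s => [|a s IH]; first by rewrite set_nil setI0 measure0 big_nil.
move=> /= /andP[as_ us]; rewrite big_cons -IH// set_seq_cons setIUr.
have ma : measurable ([set a] : set TR) by exact: measurable_set1.
have ms := measurable_seq_set s.
rewrite measureU; [|exact: measurableI|exact: measurableI|].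
  congr (_ + _)%E; rewrite diracE; have [aA|aA] := boolP (a \in A).
    by rewrite mule1; congr (m _); apply/seteqP; split => x /= => [[]|->]//;
      split => //; move: aA; rewrite inE.
  rewrite mule0 (_ : _ `&` _ = set0) ?measure0// -subset0 => x [/= xA xa].
  by move: aA; rewrite -xa; move=> /negP; apply; rewrite inE.
by rewrite -subset0 => x [[_ /= ->] [_ /=]]; rewrite (negbTE as_).
Qed.

Lemma measure_seq_set0 (s : seq R) : (forall z, z \in s -> m [set z] = 0%E) ->
  m [set` s] = 0%E.
Proof.
elim: s => [|a s IH] h; first by rewrite set_nil measure0.
rewrite set_seq_cons; apply: null_set_setU.
- exact: measurable_set1.
- exact: measurable_seq_set.
- by rewrite h ?mem_head.
- by apply: IH => z zs; rewrite h// in_cons zs orbT.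
Qed.

Lemma null_of_integral_abs0 (S : set TR) (f : TR -> R) : measurable S ->
  measurable_fun S (f : TR -> TR) -> (forall s, S s -> f s != 0) ->
  (\int[m]_(s in S) `|f s|%:E = 0)%E -> m S = 0%E.
Proof.
move=> mS mf f0 i0.
have mE : measurable_fun S (EFin \o f) by exact/measurable_EFinP.
have := (ae_eq_integral_abs m mS mE).1 i0 => -[N [mN N0 SN]].
apply: (subset_measure0 mS mN _ N0) => s Ss; apply: SN => /= /(_ Ss) [] /eqP.
by rewrite (negbTE (f0 s Ss)).
Qed.

End FiniteSets.

Lemma free_density_le (R : realType) (s : R) : `|free_density s| <= 2 / pi.
Proof.
rewrite ger0_norm ?free_density_ge0// /free_density.
have p0 : 0 <= 2 / pi :> R by rewrite divr_ge0 ?pi_ge0.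
rewrite -mulrA ler_piMr// mulr_ile1 ?sqrtr_ge0//.
by rewrite -[leRHS]sqrtr1 ler_wsqrtr// gerBl sqr_ge0.
Qed.

Lemma free_density_out (R : realType) (s : R) : 1 <= `|s| -> free_density s = 0.
Proof.
move=> s1; rewrite /free_density ler0_sqrtr ?mulr0 ?mul0r//.
by rewrite subr_le0 -real_normK ?num_real// expr_ge1.
Qed.

Lemma norm_gt1_near (R : realType) (a x : R) : `|x - a| < `|a| - 1 -> 1 < `|x|.
Proof. by have := ler_normD (a - x) x; rewrite subrK distrC; lra. Qed.

(** * The decomposition of the spectral measure *)

Section SpectralDecomposition.
Variables (R : realType) (alpha beta : nat -> R) (n : nat) (C : nat -> nat -> R).
Local Notation TR := (measurableTypeR R).
Local Notation leb := (@lebesgue_measure R).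
Local Notation muF := (@mu_free R).
Hypothesis beta_gt0 : forall k, 0 < beta k.
Hypothesis n_gt0 : (0 < n)%N.
Hypothesis free_ge : forall k, (n <= k)%N -> alpha k = 0 /\ offdiag beta k = 2^-1.
Hypothesis C_conn : is_connection alpha beta C.
Local Notation P := (orthopoly alpha beta).
Local Notation G := (jost alpha (offdiag beta) n).
Local Notation p := (pC alpha beta n C).
Variables (mu : probability TR R) (L : R).
Hypothesis L_ge1 : 1 <= L.
Local Notation D := (`[- L, L]%classic : set TR).
Hypothesis mu_supp : mu (~` D) = 0%E.
Hypothesis momP : forall k, wint mu L (fun=> 1) (P k) = (k == 0%N)%:R.

Let mD : measurable D. Proof. exact: measurable_itv. Qed.
Let mu_fin : (mu D < +oo)%E. Proof. exact: mu_D_lty. Qed.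
Let L_gt0 : 0 < L. Proof. exact: lt_le_trans L_ge1. Qed.

Let leb_fin : (leb D < +oo)%E.
Proof. by rewrite lebesgue_measure_itv//=; case: ifPn => // _; rewrite -EFinB ltry. Qed.

Let mp (A : set TR) : measurable_fun A (horner p : TR -> TR).
Proof. exact: measurable_horner. Qed.

Let p_bounded : exists M, forall x, `|x| <= L -> `|p.[x]| <= M.
Proof. by have [M _ h] := horner_bounded p L; exists M. Qed.

Let mfree : measurable_fun D (@free_density R : TR -> TR).
Proof. apply: measurable_funTS; exact: measurable_free_density. Qed.

Let free_bounded : exists M : R, forall x, `|x| <= L -> `|free_density x| <= M.
Proof. by exists (2 / pi) => x _; exact: free_density_le. Qed.

(** On the basis P_k both sides are c_{0,k}: on the left by orthonormality, with c_{0,k} = 0 beyond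
    the range of p_C; on the right because only U_0 has a nonzero free moment. *)
Lemma wint_pC q : wint mu L (horner p) q = wint leb L (@free_density R) q.
Proof.
elim/(orthopoly_span beta_gt0 (alpha := alpha)) : q => [a q r h1 h2|k].
  by rewrite !wint_lin ?h1 ?h2.
transitivity (C 0 k).
  transitivity (wint mu L (fun=> 1) (p * P k)).
    by apply: eq_Rintegral => s _; rewrite hornerM mulr1 mulrC.
  rewrite (linear_form_mul_sum beta_gt0 (mom_lin mu L) momP n.*2 (C 0)).
  by case: ltnP => // kn; rewrite (connection0_eq0 beta_gt0 n_gt0 free_ge C_conn).
have [_ /(_ k) ->] := C_conn.
rewrite (wint_sum leb_fin mfree free_bounded _ (fun i => C i k *: chebyU R i)).
under eq_bigr do rewrite (wintZ leb_fin mfree free_bounded) free_moment//.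
by rewrite big_ord_recl mulr1 big1 ?addr0// => i _; rewrite mulr0.
Qed.

Lemma integral_pC (A : set TR) : measurable A -> A `<=` D ->
  (\int[mu]_(s in A) (p.[s])%:E = muF A)%E.
Proof.
move=> mA AD; have := moments_determine L_gt0 mu_fin leb_fin (@mp D) mfree
  p_bounded free_bounded wint_pC mA.
by rewrite setIidr.
Qed.

Lemma pC_neq0 : p != 0.
Proof.
apply/eqP => p0; have := wint_pC (chebyU R 0); rewrite free_moment//= /wint p0.
rewrite (_ : \int[mu]_(s in D) _ = \int[mu]_(s in D) (0 : R)).
  by rewrite Rintegral_cst// mul0r => /esym/eqP; rewrite oner_eq0.
by apply: eq_Rintegral => s _; rewrite horner0 mulr0.
Qed.

Lemma mu_free_set1 z : muF [set z] = 0%E.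
Proof. exact: integral_set1. Qed.

Lemma mu_free_out (A : set TR) : measurable A -> (forall s, A s -> 1 <= `|s|) ->
  muF A = 0%E.
Proof.
by move=> mA A1; apply: integral0_eq => s As; rewrite free_density_out// A1.
Qed.

Let mpos : measurable ([set s | 0 < p.[s]] : set TR).
Proof.
rewrite (_ : [set s | _] = setT `&` (horner p : TR -> TR) @^-1` `]0, +oo[).
  by apply: (@mp setT) => //; exact: measurable_itv.
by apply/seteqP; split => s /=; rewrite in_itv /= andbT; [move=> ?; split|case].
Qed.

Let mneg : measurable ([set s | p.[s] < 0] : set TR).
Proof.
rewrite (_ : [set s | _] = setT `&` (horner p : TR -> TR) @^-1` `]-oo, 0[).
  by apply: (@mp setT) => //; exact: measurable_itv.
by apply/seteqP; split => s /=; rewrite in_itv /=; [move=> ?; split|case].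
Qed.

Let integral_neg (S : set TR) : measurable S -> S `<=` D ->
  (forall s, S s -> p.[s] < 0) -> (\int[mu]_(s in S) `|p.[s]|%:E = - muF S)%E.
Proof.
move=> mS SD Sn.
have abs0 s : S s -> (0 <= `|p.[s]|%:E)%E by move=> _; rewrite lee_fin normr_ge0.
have e : (\int[mu]_(s in S) (p.[s])%:E = - \int[mu]_(s in S) `|p.[s]|%:E)%E.
  rewrite -(integral_ge0N mu abs0); apply: eq_integral => s; rewrite inE => /Sn ps.
  by rewrite ltr0_norm// -EFinN opprK.
by rewrite -integral_pC// e oppeK.
Qed.

(** Since p_C mu = mu_Delta, the integral of |p_C| against mu vanishes on the parts of S where p_C
    is positive and where it is negative. *)
Lemma null_of_mu_free_null (S : set TR) : measurable S -> S `<=` D -> muF S = 0%E ->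
  (forall s, S s -> p.[s] != 0) -> mu S = 0%E.
Proof.
move=> mS SD S0 Sp.
have -> : S = (S `&` [set s | 0 < p.[s]]) `|` (S `&` [set s | p.[s] < 0]).
  apply/seteqP; split => [s Ss|s [[]|[]]//].
  by have := Sp s Ss; rewrite neq_lt => /orP[|]; [right|left].
have m1 := measurableI _ _ mS mpos; have m2 := measurableI _ _ mS mneg.
have z1 : muF (S `&` [set s | 0 < p.[s]]) = 0%E.
  by apply: (subset_measure0 m1 mS _ S0) => s [].
have z2 : muF (S `&` [set s | p.[s] < 0]) = 0%E.
  by apply: (subset_measure0 m2 mS _ S0) => s [].
apply: null_set_setU => //.
- apply: (@null_of_integral_abs0 _ mu _ (horner p)) => //.
    by move=> s [/Sp].
  rewrite -z1 -integral_pC//; last by move=> s [/SD].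
  by apply: eq_integral => s; rewrite inE => -[_ /= ps]; rewrite gtr0_norm.
- apply: (@null_of_integral_abs0 _ mu _ (horner p)) => //.
    by move=> s [/Sp].
  rewrite integral_neg//; first by rewrite z2 oppe0.
    by move=> s [/SD].
  by move=> s [].
Qed.

Let I1 : set TR := `]-1, 1[%classic.
Let I1D : I1 `<=` D.
Proof.
move=> s; rewrite /I1 /= !in_itv /= => /andP[s1 s2]; apply/andP; split.
  by rewrite (le_trans _ (ltW s1))// lerN2.
by rewrite (le_trans (ltW s2)).
Qed.
Let mI1 : measurable I1. Proof. exact: measurable_itv. Qed.
(** The part of (-1, 1) where p_C is negative. It is null for both measures, since p_C mu = mu_Delta
    is nonnegative. *)
Let N : set TR := I1 `&` [set s | p.[s] < 0].
Let mN : measurable N. Proof. exact: measurableI. Qed.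
Let ND : N `<=` D. Proof. by move=> s [/I1D]. Qed.

Let mu_free_N : muF N = 0%E.
Proof.
apply/eqP; rewrite -measure_le0 -oppe_ge0 -integral_neg//; last by move=> s [].
by apply: integral_ge0 => s _; rewrite lee_fin.
Qed.

Let mu_N : mu N = 0%E.
Proof.
by apply: null_of_mu_free_null mu_free_N _ => // s [_ /= ps]; rewrite lt_eqF.
Qed.

(** The part of [D] outside (-1, 1) and off the zeros of p_C. It carries no mass of mu, so outside
    (-1, 1) only zeros of p_C matter. *)
Let O : set TR := D `&` ~` I1 `&` ~` [set s | p.[s] = 0].
Let mZ : measurable ([set s | p.[s] = 0] : set TR).
Proof.
rewrite (_ : [set s | _] = setT `&` (horner p : TR -> TR) @^-1` [set 0]).
  by apply: (@mp setT) => //; exact: measurable_set1.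
by rewrite setTI.
Qed.
Let mO : measurable O.
Proof. by apply: measurableI; [apply: measurableI|]; try exact: measurableC. Qed.

Let notI1 s : ~ I1 s -> 1 <= `|s|.
Proof. by rewrite /I1 /= in_itv /= -ltr_norml => /negP; rewrite -leNgt. Qed.

Let mu_O : mu O = 0%E.
Proof.
apply: null_of_mu_free_null => //.
- by move=> s [[]].
- by apply: mu_free_out => // s [[_ /notI1]].
- by move=> s [_ /= /eqP].
Qed.

Let outD : measurable (~` D). Proof. exact: measurableC. Qed.

Variable xs : seq R.
Hypothesis xs_uniq : uniq xs.
Hypothesis xsP : forall y, (y \in xs) = root (G 0) y && (`|y| < 1).
Hypothesis xs_L : forall y, y \in xs -> `|joukowski y| <= L.

Let xs_neq0 y : y \in xs -> y != 0.
Proof. by rewrite xsP => /andP[ry _]; exact: (jost_root_neq0 beta_gt0 free_ge ry). Qed.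

Lemma joukowski_gt1 (y : R) : y != 0 -> `|y| < 1 -> 1 < `|joukowski y|.
Proof.
move=> y0 y1; have yp : 0 < `|y| by rewrite normr_gt0.
have -> : `|joukowski y| = 2^-1 * (1 + `|y| ^+ 2) / `|y|.
  rewrite (_ : joukowski y = 2^-1 * (1 + y ^+ 2) / y); last first.
    by rewrite /joukowski; field.
  rewrite normrM normfV normrM gtr0_norm ?invr_gt0// real_normK ?num_real//.
  by rewrite (ger0_norm (_ : 0 <= 1 + y ^+ 2))// addr_ge0 ?sqr_ge0.
by rewrite ltr_pdivlMr// mul1r; nra.
Qed.

Let uniq_joukowski : uniq [seq joukowski y | y <- xs].
Proof.
rewrite map_inj_in_uniq// => x y xx yy; rewrite /joukowski.
have x0 := xs_neq0 xx; have y0 := xs_neq0 yy.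
move: xx yy; rewrite !xsP => /andP[_ x1] /andP[_ y1] e.
have : (x - y) * (x * y - 1) = 0.
  transitivity (2 * x * y * (2^-1 * (x + x^-1) - 2^-1 * (y + y^-1))).
    by field; rewrite x0 y0.
  by rewrite e subrr mulr0.
move/eqP; rewrite mulf_eq0 !subr_eq0 => /orP[/eqP//|/eqP xy1].
have : `|x * y| < 1 by rewrite normrM mulr_ilt1.
by rewrite xy1 normr1 ltxx.
Qed.

Lemma atom_joukowski y : y \in xs -> mu [set joukowski y] = (eigen_mass (G 0) y)%:E.
Proof.
move=> yx; have := yx; rewrite xsP => /andP[ry y1].
have s1 := joukowski_gt1 (xs_neq0 yx) y1.
have [Z ZP] := exists_all_roots pC_neq0.
have [d d0 dP] := exists_separation Z (joukowski y).
(* Within this radius the punctured neighbourhood avoids both [-1, 1] and the zeros of p_C, so it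
   lies in the null set of [O] and the complement of [D]. *)
pose e := Num.min d (`|joukowski y| - 1).
have e0 : 0 < e by rewrite lt_min d0 subr_gt0.
have gap0 : mu [set x | 0 < `|x - joukowski y| < e] = 0%E.
  apply: (@subset_measure0 _ _ _ mu _ (O `|` ~` D)).
  - rewrite (_ : [set x | _] = (`]joukowski y - e, joukowski y + e[ `\`
       [set joukowski y])%classic).
      by apply: measurableD; [exact: measurable_itv|exact: measurable_set1].
    apply/seteqP; split => x; rewrite /= in_itv /= normr_gt0 subr_eq0 ltr_distl.
      by move=> /andP[/eqP ? ?].
    by move=> [-> /eqP ->].
  - exact: measurableU.
  - move=> x /= /andP[]; rewrite normr_gt0 subr_eq0 lt_min => xy /andP[xd x1].
    have [xD|xD] := pselect (D x); [left|by right].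
    split; [split=> //|].
      rewrite /I1 /= in_itv /= -ltr_norml => /ltW.
      by rewrite leNgt (norm_gt1_near x1).
    move=> /= px; have := dP x (ZP x _) xy; rewrite leNgt xd => /(_ _)/negP; apply => //.
    by rewrite /root px.
  - exact: null_set_setU.
rewrite -(atom_mass beta_gt0 momP n_gt0 free_ge ry y1 e0 (xs_L yx) gap0) fineK//.
have ms : measurable ([set joukowski y] : set TR) by exact: measurable_set1.
by rewrite ge0_fin_numE// (le_lt_trans (probability_le1 mu ms)) ?ltry.
Qed.

Let X : set TR := [set` [seq joukowski y | y <- xs]].
Let mX : measurable X. Proof. exact: measurable_seq_set. Qed.
Let E : set TR := I1 `&` [set s | 0 < p.[s]].
Let mE : measurable E. Proof. exact: measurableI. Qed.
Let ED : E `<=` D. Proof. by move=> s [/I1D]. Qed.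

Let EX0 : E `&` X = set0.
Proof.
rewrite -subset0 => s [[sI _] /= /mapP[y yx ys]].
have := yx; rewrite xsP => /andP[_ y1].
have := joukowski_gt1 (xs_neq0 yx) y1.
by move: sI; rewrite /I1 /= in_itv /= -ltr_norml ys => /ltW; rewrite leNgt => /negbTE ->.
Qed.

(** Beyond the null sets above, only zeros of p_C that are not eigenvalues remain; they are finitely
    many and none is an atom, by [atom_root]. *)
Let mu_rest : mu (~` (E `|` X)) = 0%E.
Proof.
have [Z ZP] := exists_all_roots pC_neq0.
pose W := [seq z <- Z | z \notin [seq joukowski y | y <- xs]].
have W0 : mu [set` W] = 0%E.
  apply: measure_seq_set0 => z; rewrite mem_filter => /andP[zX _].
  apply: contraNeq zX => /(atom_root beta_gt0 mu_supp momP free_ge)[y [y1 ys ry]].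
  by apply/mapP; exists y => //; rewrite xsP ry.
have mW := measurable_seq_set W.
apply: (@subset_measure0 _ _ _ mu _ (~` D `|` (N `|` (O `|` [set` W])))).
- exact/measurableC/measurableU.
- by do !apply: measurableU.
- move=> s /= /not_orP[nE nX].
  have [sD|nD] := pselect (D s); [right|by left].
  have [p0|pn0] := pselect (p.[s] = 0).
    right; right; rewrite /= mem_filter ZP ?andbT; last by rewrite /root p0.
    by apply/negP.
  have [sI|nI] := pselect (I1 s); last by right; left.
  left; split=> //=; have /eqP := pn0; rewrite neq_lt => /orP[//|pp].
  by case: nE.
- by do !apply: null_set_setU => //; do ?apply: measurableU.
Qed.

Let mu_free_rest : muF (~` E) = 0%E.
Proof.
have [Z ZP] := exists_all_roots pC_neq0.
have mZs := measurable_seq_set Z.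
have mI1C := measurableC mI1.
apply: (@subset_measure0 _ _ _ muF _ (~` I1 `|` (N `|` [set` Z]))).
- exact: measurableC.
- by do !apply: measurableU.
- move=> s /= nE; have [sI|nI] := pselect (I1 s); [right|by left].
  have [p0|/eqP] := pselect (p.[s] = 0); first by right; apply: ZP; rewrite /root p0.
  by rewrite neq_lt => /orP[pn|pp]; [left|case: nE].
- apply: null_set_setU => //; first exact: measurableU.
    by apply: mu_free_out => // s /notI1.
  by apply: null_set_setU => //; apply: measure_seq_set0 => z _; exact: mu_free_set1.
Qed.

(** On [E] the measure mu_Delta has density p_C > 0 with respect to mu, so dividing by p_C returns
    mu. The complement of [E] is null for mu_Delta, including the zeros of p_C, where the inverse is
    0 by convention. *)
Lemma integral_inv_pC (A : set TR) : measurable A ->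
  (\int[muF]_(s in A) (p.[s]^-1)%:E = mu (A `&` E))%E.
Proof.
move=> mA; pose g (s : TR) : R := `|p.[s]|^-1; pose f (s : TR) : R := `|p.[s]|.
have mg (B : set TR) : measurable_fun B (g : TR -> TR).
  apply: measurable_funTS; apply: (@measurableT_comp _ _ _ _ _ _ (fun x : TR => x^-1 : TR)).
    exact: measurable_invr.
  by apply: (measurableT_comp (@normr_measurable R setT)); exact: mp.
have mpV (B : set TR) : measurable_fun B (fun s : TR => (p.[s])^-1 : TR).
  apply: measurable_funTS; apply: (@measurableT_comp _ _ _ _ _ _ (fun x : TR => x^-1 : TR)).
    exact: measurable_invr.
  exact: mp.
have mf (B : set TR) : measurable_fun B (f : TR -> TR).
  by apply: (measurableT_comp (@normr_measurable R setT)); exact: mp.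
have mAE : measurable (A `&` E) by exact: measurableI.
have mCE := measurableC mE.
transitivity (\int[muF]_(s in A) (g s)%:E)%E.
  apply: ae_eq_integral => //.
  - by apply/measurable_EFinP; exact: mpV.
  - by apply/measurable_EFinP; exact: mg.
  exists (~` E); split=> // s /= h Es; apply: h => _.
  by rewrite /g gtr0_norm//; case: Es.
transitivity (\int[muF]_(s in A `&` E) (g s)%:E)%E.
  rewrite (@ge0_negligible_integral _ _ _ muF A (~` E))//.
  - by rewrite setDE setCK.
  - by apply/measurable_EFinP; exact: mg.
  - by move=> s _; rewrite lee_fin invr_ge0.
have f0 s : 0 <= f s by exact: normr_ge0.
have g0 s : 0 <= g s by rewrite invr_ge0.
have nuE B : measurable B ->
    (muF (A `&` E `&` B) = \int[mu]_(s in A `&` E `&` B) (f s)%:E)%E.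
  move=> mB; rewrite -integral_pC; [|exact: measurableI|by move=> s [[_ /ED]]].
  by apply: eq_integral => s; rewrite inE => -[[_ [_ /= ps]] _]; rewrite /f gtr0_norm.
rewrite (integral_density mAE (mf _) (mg _) f0 g0 nuE).
rewrite -[RHS]mul1e -integral_cst//; apply: eq_integral => s.
by rewrite inE => -[_ [_ /= ps]]; rewrite -EFinM /g /f mulVf// normr_eq0 gt_eqF.
Qed.

Lemma spectral_decomposition (A : set TR) : measurable A ->
  (mu A = \int[muF]_(s in A) (p.[s]^-1)%:E +
     \sum_(y <- xs) (eigen_mass (G 0) y)%:E * \d_(joukowski y) A)%E.
Proof.
move=> mA; rewrite integral_inv_pC//.
transitivity (mu (A `&` (E `|` X))).
  rewrite (@measureDI _ _ _ mu A (E `|` X))//; last exact: measurableU.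
  rewrite [X in (X + _)%E](_ : _ = 0%E) ?add0e//.
  apply: (@subset_measure0 _ _ _ mu _ _ _ _ _ mu_rest).
  - by apply: measurableD => //; exact: measurableU.
  - by apply: measurableC; exact: measurableU.
  - by move=> s [].
rewrite setIUr measureU; [|exact: measurableI|exact: measurableI|]; last first.
  by rewrite setIACA EX0 setI0.
have eX := measure_seq_set mu uniq_joukowski mA; rewrite big_map in eX.
congr (_ + _)%E; apply: (eq_trans eX).
by apply: eq_big_seq => y yx; congr (_ * _)%E; exact: atom_joukowski.
Qed.

End SpectralDecomposition.
Theorem theorem4p22 (R : realType) (alpha beta : nat -> R) (n : nat)
    (C : nat -> nat -> R) (t : nat -> R) (z : seq R[i])
    (mu : probability (measurableTypeR R) R)
    (HJ : is_jacobi alpha beta)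
    (Hn : (0 < n)%N)
    (Hfree : forall k, (n <= k)%N -> alpha k = 0 /\ beta k.-1 = 2^-1)
    (HC : is_connection alpha beta C)
    (Ht : is_toeplitz_part C t)
    (Hmu : is_spectral_measure alpha beta mu)
    (c := toeplitz_symbol n t)
    (cC := map_poly (real_complex R) c)
    (Hzuniq : uniq z)
    (Hz : forall w : R[i], (w \in z) = root cC w && (`|w| < 1)) :
  exists x : seq R,
    [/\ z = [seq y%:C | y <- x],
        forall w, w \in z -> mup w cC = 1%N,
        forall w, root cC w -> `|w| = 1 -> (w = 1 \/ w = -1) /\ mup w cC = 1%N,
        (size z <= n)%N
      & (forall y, y \in x -> y * c^`().[y] * c.[y^-1] != 0) /\
        (forall A : set (measurableTypeR R), measurable A ->
          mu A =
          (\int[@mu_free R]_(s in A) ((pC alpha beta n C).[s]^-1)%:E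
           + \sum_(y <- x) (eigen_mass c y)%:E * \d_(joukowski y) A)%E)].
Proof.
have beta_gt0 : forall k, 0 < beta k by case: HJ.
have free_ge k : (n <= k)%N -> alpha k = 0 /\ offdiag beta k = 2^-1.
  by case: k => [|k] nk; [move: Hn; rewrite ltnNge nk|exact: Hfree nk].
have cE : c = jost alpha (offdiag beta) n 0.
  exact: (toeplitz_symbolE beta_gt0 Hn free_ge HC Ht).
have zR w : w \in z -> exists2 x : R, w = x%:C & root c x.
  rewrite Hz /cC cE => /andP[rw w1].
  exact: (complex_root_real beta_gt0 Hn free_ge rw (ltW w1)).
pose xs := [seq complex.Re w | w <- z].
have zxs : z = [seq y%:C | y <- xs].
  rewrite -map_comp -[LHS]map_id; apply/eq_in_map => w /zR[x -> _] //.
have xs_uniq : uniq xs by move: Hzuniq; rewrite {1}zxs => /map_uniq.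
have normC (y : R) : (`|y%:C| < 1 :> R[i]) = (`|y| < 1).
  by rewrite normc_def /= expr0n addr0 sqrtr_sqr ltcR.
have xsP y : (y \in xs) = root (jost alpha (offdiag beta) n 0) y && (`|y| < 1).
  rewrite -cE -normC -(fmorph_root (real_complex R)) -Hz zxs mem_map//.
  exact: complexI.
exists xs; split=> //.
- move=> w; rewrite Hz /cC cE => /andP[rw w1].
  exact: (mup_jost_root beta_gt0 Hn free_ge rw (ltW w1)).
- rewrite /cC cE => w rw w1; split; last first.
    by apply: (mup_jost_root beta_gt0 Hn free_ge rw); rewrite w1.
  (* The reality argument covers the closed disc, so a root on the circle is a real number of
     modulus 1. *)
  have [|x wx _] := complex_root_real beta_gt0 Hn free_ge rw; first by rewrite w1.
  move: w1; rewrite wx normc_def /= expr0n addr0 sqrtr_sqr.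
  move=> /(congr1 (@complex.Re R)) /= /eqP; rewrite eqr_norml ler01 andbT.
  by case/orP => /eqP ->; [left|right]; rewrite ?rmorphN1.
- rewrite -(size_map (@complex.Re R)) -/xs.
  apply: (jost_root_count beta_gt0 Hn free_ge xs_uniq) => y.
  by rewrite xsP => /andP.
split.
  move=> y; rewrite xsP cE => /andP[ry y1]; rewrite !mulf_neq0//.
  - exact: (jost_root_neq0 beta_gt0 free_ge ry).
  - exact: (jost_root_deriv beta_gt0 Hn free_ge ry (ltW y1)).
  - exact: (jost_root_inv beta_gt0 free_ge ry y1).
have [[S [cS S0]] mu_res] := Hmu.
have [M SM] : exists M : R, forall x, S x -> `|x| <= M.
  have [M [_ hM]] := compact_bounded cS.
  by exists (M + 1) => x Sx; apply: (hM (M + 1)) => //; rewrite ltrDl.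
(* One interval for everything: it contains [-1, 1], the compact set carrying mu, and all the points
   lambda(y). *)
pose L := 1 + `|M| + \sum_(y <- xs) `|joukowski y|.
have L_ge1 : 1 <= L by rewrite /L -addrA lerDl addr_ge0// sumr_ge0.
have mD : measurable (`[- L, L]%classic : set (measurableTypeR R)) by exact: measurable_itv.
have mu_supp : mu (~` `[- L, L]%classic) = 0%E.
  apply: (@subset_measure0 _ _ _ mu _ (~` S)) S0 => //.
  - exact: measurableC.
  - by apply: measurableC; exact: compact_measurable.
  - move=> x /= xL Sx; apply: xL; rewrite norm_itv (le_trans (SM x Sx))//.
    rewrite /L (le_trans (ler_norm M))// addrAC lerDr addr_ge0// sumr_ge0//.
have xs_L y : y \in xs -> `|joukowski y| <= L.
  move=> yx; rewrite /L (big_rem y)//= addrCA lerDl.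
  by rewrite !addr_ge0// sumr_ge0.
have [K K0 KP] := coefficients_bounded free_ge.
have momP := moment_orthopoly beta_gt0 free_ge (lt_le_trans ltr01 L_ge1) mu_supp
  mu_res K0 KP.
rewrite cE => A mA.
exact: (spectral_decomposition beta_gt0 Hn free_ge HC L_ge1 mu_supp momP xs_uniq xsP xs_L mA).
Qed.
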